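(* Let $0\le b_1\le b_2<\infty$ with $b_2>0$. Assume that $B\in\mathrm{Ad}$ is an optimal structure for a frequency $\alpha\in\mathbb{R}$. Then, after possible correction on a set of measure zero, $B$ is a piecewise constant function on $[0,1]$ taking only the values $b_1$ and $b_2$.
   Context: $\mathrm{Ad}:=\{B\in L^\infty_{\mathbb{R}}(0,1): b_1\le B(x)\le b_2 \text{ for a.a. } x\in(0,1)\}$. For $B\in L^\infty(0,1)$, a number $\kappa\in\mathbb{C}$, $\kappa\ne0$, is called a quasi-eigenvalue of $B$ if there is a nonzero solution $y\in W^{2,\infty}_{\mathbb{C}}[0,1]$ of $y''(x)+\kappa^2B(x)y(x)=0$ for a.a. $x\in(0,1)$ with $y'(0)=0$ and $y(1)-\mathrm{i}\,y'(1)/\kappa=0$. $K(B)$ denotes the set of all quasi-eigenvalues of $B$, and $K(\mathrm{Ad}):=\bigcup_{B\in\mathrm{Ad}}K(B)$. For $\alpha\in\mathbb{R}$ put $\mathcal{I}(\alpha):=+\infty$ if there is no $\kappa\in K(\mathrm{Ad})$ with $\operatorname{Re}\kappa=\alpha$; otherwise $\mathcal{I}(\alpha):=\min\{\operatorname{Im}\kappa:\operatorname{Re}\kappa=\alpha,\ \kappa\in K(\mathrm{Ad})\}$ (this minimum is attained and positive). A structure $B\in\mathrm{Ad}$ is called optimal for the frequency $\alpha$ if $\mathcal{I}(\alpha)<\infty$ and $\alpha+\mathrm{i}\,\mathcal{I}(\alpha)\in K(B)$. A function $B$ on $[0,1]$ is piecewise constant if there is a finite partition $0=x_0<x_1<\dots<x_n<x_{n+1}=1$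 such that $B$ is constant on each interval $(x_{j-1},x_j)$. *)

(* Defs.v *)
From HB Require Import structures.
From mathcomp Require Import all_boot all_order all_algebra.
From mathcomp Require Import complex.
From mathcomp Require Import all_classical all_reals all_analysis.
Set Implicit Arguments.
Unset Strict Implicit.
Unset Printing Implicit Defensive.
Import Order.TTheory GRing.Theory Num.Theory.
Import numFieldNormedType.Exports.
Local Open Scope classical_set_scope.
Local Open Scope ring_scope.
Local Open Scope complex_scope.

(* Functions on (0,1) or [0,1] are encoded as total functions on R whose
   values outside the interval are irrelevant; an element of L^oo(0,1) is
   represented by any Borel function of its class. *)

Definition ess_bounded01 (R : realType) (f : R -> R) : Prop :=
  measurable_fun (`]0, 1[ : set R) f /\
  exists M : R, {ae lebesgue_measure, forall x : R, 0 < x < 1 -> `|f x| <= M}.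

Definition test_function01 (R : realType) (phi : R -> R) : Prop :=
  [/\ forall x : R, derivable phi x 1,
      continuous (derive1 phi) &
      exists K : set R, [/\ compact K, K `<=` `]0, 1[ &
        forall x : R, ~ K x -> phi x = 0]].

(* u belongs to W^{1,oo}(0,1) and g is (a representative of) its weak
   derivative. *)
Definition sobolev1_deriv (R : realType) (u g : R -> R) : Prop :=
  [/\ ess_bounded01 u, ess_bounded01 g &
      forall phi : R -> R, test_function01 phi ->
        \int[lebesgue_measure]_(x in (`]0, 1[ : set R)) (u x * derive1 phi x) =
        - \int[lebesgue_measure]_(x in (`]0, 1[ : set R)) (g x * phi x)].

Definition csobolev1_deriv (R : realType) (u g : R -> R[i]) : Prop :=
  sobolev1_deriv (fun x => complex.Re (u x)) (fun x => complex.Re (g x)) /\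
  sobolev1_deriv (fun x => complex.Im (u x)) (fun x => complex.Im (g x)).

Definition ccontinuous01 (R : realType) (u : R -> R[i]) : Prop :=
  {within (`[0, 1] : set R), continuous (fun x : R => complex.Re (u x))} /\
  {within (`[0, 1] : set R), continuous (fun x : R => complex.Im (u x))}.

(* y belongs to the complex space W^{2,oo}[0,1] with first and second
   derivatives dy and ddy. Both y and dy are the representatives that are
   continuous on [0,1]; these are the ones through which the boundary values
   y(1), y'(0), y'(1) are defined. *)
Definition csobolev2 (R : realType) (y dy ddy : R -> R[i]) : Prop :=
  [/\ ccontinuous01 y, ccontinuous01 dy,
      csobolev1_deriv y dy & csobolev1_deriv dy ddy].

Definition Ad (R : realType) (b1 b2 : R) : set (R -> R) :=
  [set B | ess_bounded01 B /\
    {ae lebesgue_measure, forall x : R, 0 < x < 1 -> b1 <= B x <= b2}].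

Definition quasi_eigenvalues (R : realType) (B : R -> R) : set R[i] :=
  [set kappa | kappa != 0 /\
    exists y dy ddy : R -> R[i],
      [/\ csobolev2 y dy ddy,
          exists2 x : R, 0 <= x <= 1 & y x != 0,
          {ae lebesgue_measure, forall x : R, 0 < x < 1 ->
             ddy x + kappa ^+ 2 * (B x)%:C * y x = 0},
          dy 0 = 0 &
          y 1 - 'i%C * dy 1 / kappa = 0]].

Definition quasi_eigenvalues_Ad (R : realType) (b1 b2 : R) : set R[i] :=
  \bigcup_(B in Ad b1 b2) quasi_eigenvalues B.

(* The infimum is +oo when no quasi-eigenvalue has real part alpha, and is a
   minimum otherwise. *)
Definition min_im (R : realType) (b1 b2 alpha : R) : \bar R :=
  ereal_inf [set (complex.Im kappa)%:E | kappa in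
    [set kappa | quasi_eigenvalues_Ad b1 b2 kappa /\
                 complex.Re kappa = alpha]].

Definition optimal (R : realType) (b1 b2 alpha : R) (B : R -> R) : Prop :=
  exists m : R, min_im b1 b2 alpha = m%:E /\
                quasi_eigenvalues B (alpha +i* m).

Definition piecewise_constant01 (R : realType) (f : R -> R) : Prop :=
  exists (n : nat) (x : nat -> R),
    [/\ x 0%N = 0, x n.+1 = 1,
        forall j : nat, (j <= n)%N -> x j < x j.+1 &
        forall j : nat, (j <= n)%N ->
          exists c : R, forall t : R, x j < t < x j.+1 -> f t = c].

(* Main.v *)
Require Import Defs.
From mathcomp Require Import all_boot all_order all_algebra.
From mathcomp Require Import complex.
From mathcomp Require Import all_classical all_reals all_analysis.
From mathcomp Require Import measurable_realfun ring lra.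
Import Order.TTheory GRing.Theory Num.Theory.
Import numFieldNormedType.Exports.
Local Open Scope classical_set_scope.
Local Open Scope ring_scope.
Local Open Scope complex_scope.
Set Implicit Arguments.
Unset Strict Implicit.
Unset Printing Implicit Defensive.

(** Let [kappa = alpha + i beta] be the optimal quasi-eigenvalue and [y] an
    eigenfunction of [B].

    Case [alpha <> 0].  Replacing [B] by [B + V] changes the outgoing boundary
    condition, to first order, by a nonzero multiple of [w(V)], the integral
    of [y ^ 2 * V].  Consider the convex cone of all [w(V)], where [V] ranges
    over the variations for which [B + d V] stays between [b1] and [b2] for
    some [d > 0].  If this cone were the whole plane, two real parameters
    would suffice to satisfy the boundary condition inside the admissible set,
    at every frequency near [kappa], in particular at one with the same real
    part and a smaller imaginary part ([quasi_eigenvalue_perturbation]).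
    Only the dependence on [B] is inverted here, so that multiple
    quasi-eigenvalues are covered as well.  Hence
    optimality puts the cone in a half-plane ([full_cone_or_halfplane],
    [halfplane_of_optimal]): for some [(a, b) <> 0] the function
    [h = a Re (y ^ 2) + b Im (y ^ 2)] satisfies [int h V >= 0] for all these
    [V], and testing with the extreme [V] gives [B = b1] where [h > 0] and
    [B = b2] where [h < 0] ([bang_bang]).

    It remains to see that [h] changes sign finitely often.  The momentum
    [Im (conj y * y')] at [x] equals [- 2 alpha beta] times the integral of
    [B |y| ^ 2] over [[0, x]].  It follows that [beta > 0], that [y] has no
    zero, and that the argument of [y] is strictly monotone to the right of
    the initial interval on which [B] vanishes.  So the zeros of [h] there are
    isolated, also near the left end of that range ([crossings_separated]), and
    compactness of [[0, 1]] makes them finite in number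
    ([interval_partition]).  On the initial interval, if it is not a
    point, [B = 0 = b1].

    Case [alpha = 0].  The equation is real and the cone argument loses a
    dimension, but a comparison is available: if [B] is not [b2], Sturm
    comparison with [cosh (beta * sqrt b2 * x)] and the intermediate value
    theorem give the constant structure [b2] a quasi-eigenvalue [i s] with
    [0 < s < beta] ([stationary_structure]).

    Weak derivatives are translated at once into integral identities ([prim]),
    in which products, reciprocals and Gronwall's inequality are elementary
    because all the functions involved are Lipschitz. *)

Local Notation Re := complex.Re.
Local Notation Im := complex.Im.

(** * Integrals of bounded measurable functions *)

(** Boundedness and measurability are required on the whole line, so that the
    class is closed under the ring operations and all the integrals below
    exist without further conditions. *)
Definition bmeas (R : realType) (f : R -> R) : Prop :=
  measurable_fun setT f /\ exists M : R, forall x, `|f x| <= M.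

Definition intg (R : realType) (a b : R) (f : R -> R) : R :=
  \int[lebesgue_measure]_(x in `[a, b]) f x.

Lemma bmeas_bound (R : realType) (f : R -> R) : bmeas f ->
  exists2 M : R, 0 <= M & forall x, `|f x| <= M.
Proof.
by case=> _ [M fM]; exists M => //; exact: le_trans (fM 0).
Qed.

Lemma bmeasW (R : realType) (f : R -> R) (M : R) : measurable_fun setT f ->
  (forall x, `|f x| <= M) -> bmeas f.
Proof. by move=> mf fM; split => //; exists M. Qed.

Lemma bmeas_cst (R : realType) (c : R) : bmeas (fun _ : R => c).
Proof. by apply: (@bmeasW _ _ `|c|) => //; exact: measurable_cst. Qed.

Lemma bmeasD (R : realType) (f g : R -> R) :
  bmeas f -> bmeas g -> bmeas (fun x => f x + g x).
Proof.
move=> fb gb.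
have [M _ fM] := bmeas_bound fb; have [L _ gL] := bmeas_bound gb.
case: fb gb => mf _ [mg _].
apply: (@bmeasW _ _ (M + L)); first exact: measurable_funD.
by move=> x; apply: le_trans (ler_normD _ _) _; exact: lerD.
Qed.

Lemma bmeasM (R : realType) (f g : R -> R) :
  bmeas f -> bmeas g -> bmeas (fun x => f x * g x).
Proof.
move=> fb gb.
have [M M0 fM] := bmeas_bound fb; have [L L0 gL] := bmeas_bound gb.
case: fb gb => mf _ [mg _].
apply: (@bmeasW _ _ (M * L)); first exact: measurable_funM.
by move=> x; rewrite normrM; apply: ler_pM.
Qed.

Lemma bmeasN (R : realType) (f : R -> R) : bmeas f -> bmeas (fun x => - f x).
Proof.
move=> [mf [M fM]]; apply: (@bmeasW _ _ M); first exact: measurableT_comp.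
by move=> x; rewrite normrN.
Qed.

Lemma bmeasB (R : realType) (f g : R -> R) :
  bmeas f -> bmeas g -> bmeas (fun x => f x - g x).
Proof. by move=> fb gb; exact: (bmeasD fb (bmeasN gb)). Qed.

Lemma lebesgue_measure_itvcc_fin (R : realType) (a b : R) :
  (lebesgue_measure (`[a, b] : set R) < +oo)%E.
Proof. by rewrite lebesgue_measure_itv /=; case: ifP => // _; rewrite -EFinB ltry. Qed.

Lemma bmeas_integrable (R : realType) (f : R -> R) (a b : R) : bmeas f ->
  lebesgue_measure.-integrable `[a, b] (EFin \o f).
Proof.
move=> [mf [M fM]].
apply: measurable_bounded_integrable.
- exact: measurable_itv.
- exact: lebesgue_measure_itvcc_fin.
- exact: measurable_funTS mf.
- exists M; split; first exact: num_real.
  by move=> N MN x _ /=; exact: le_trans (fM x) (ltW MN).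
Qed.

Lemma intgxx (R : realType) (a : R) (f : R -> R) : intg a a f = 0.
Proof. by rewrite /intg set_itv1 Rintegral_set1. Qed.

Lemma intgD (R : realType) (a b : R) (f g : R -> R) : bmeas f -> bmeas g ->
  intg a b (fun x => f x + g x) = intg a b f + intg a b g.
Proof.
move=> fb gb; rewrite /intg RintegralD //; exact: bmeas_integrable.
Qed.

Lemma intgB (R : realType) (a b : R) (f g : R -> R) : bmeas f -> bmeas g ->
  intg a b (fun x => f x - g x) = intg a b f - intg a b g.
Proof.
move=> fb gb; rewrite /intg RintegralB //; exact: bmeas_integrable.
Qed.

Lemma intgZ (R : realType) (a b c : R) (f : R -> R) : bmeas f ->
  intg a b (fun x => c * f x) = c * intg a b f.
Proof.
move=> fb; rewrite /intg RintegralZl //; exact: bmeas_integrable.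
Qed.

Lemma intg_cst (R : realType) (a b c : R) : a <= b ->
  intg a b (fun _ => c) = c * (b - a).
Proof.
move=> ab; rewrite /intg.
have -> : b - a = fine (lebesgue_measure (`[a, b] : set R)).
  rewrite lebesgue_measure_itv /= lte_fin; case: ltP => // ba.
  by have -> : a = b; [apply/eqP; rewrite eq_le ab ba | rewrite subrr].
by rewrite Rintegral_cst.
Qed.

Lemma intg_le (R : realType) (a b : R) (f g : R -> R) : bmeas f -> bmeas g ->
  (forall x, a <= x <= b -> f x <= g x) -> intg a b f <= intg a b g.
Proof.
by move=> fb gb fg; apply: le_Rintegral => //; try exact: bmeas_integrable.
Qed.

Lemma eq_intg (R : realType) (a b : R) (f g : R -> R) :
  (forall x, a <= x <= b -> f x = g x) -> intg a b f = intg a b g.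
Proof.
move=> fg; apply: eq_Rintegral => x; rewrite inE /= in_itv /= => /fg //.
Qed.

Lemma intg_norm_le (R : realType) (a b M : R) (f : R -> R) : a <= b ->
  bmeas f -> (forall x, a <= x <= b -> `|f x| <= M) ->
  `|intg a b f| <= M * (b - a).
Proof.
move=> ab fb fM; rewrite ler_norml -mulNr -!intg_cst //.
by apply/andP; split; apply: intg_le => //; try exact: bmeas_cst;
  move=> x /fM; rewrite ler_norml => /andP[].
Qed.

Lemma intg_chasles (R : realType) (a b c : R) (f : R -> R) : bmeas f ->
  a <= b -> b <= c -> intg a c f = intg a b f + intg b c f.
Proof.
move=> fb ab bc; rewrite /intg.
have H : lebesgue_measure.-integrable [set` Interval (BLeft a) (BRight c)] (EFin \o f).
  exact: bmeas_integrable.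
have := @Rintegral_itvB R f (BLeft a) (BRight c) b H.
rewrite !bnd_simp => /(_ ab bc) E.
rewrite -[X in _ = _ + X](@Rintegral_itv_obnd_cbnd R b (BRight c)).
  by rewrite -E addrC subrK.
apply: (integrableS _ _ _ H) => //.
by apply: subset_itvr; rewrite bnd_simp.
Qed.

Lemma ae_imp (R : realType) (P Q : R -> Prop) :
  {ae lebesgue_measure, forall x : R, P x} -> (forall x, P x -> Q x) ->
  {ae lebesgue_measure, forall x : R, Q x}.
Proof.
by move=> [A [mA A0 sub]] PQ; exists A; split=> // x /= nQ; apply: sub => /PQ.
Qed.

Lemma ae_imp2 (R : realType) (P P' Q : R -> Prop) :
  {ae lebesgue_measure, forall x : R, P x} ->
  {ae lebesgue_measure, forall x : R, P' x} ->
  (forall x, P x -> P' x -> Q x) ->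
  {ae lebesgue_measure, forall x : R, Q x}.
Proof.
move=> HP HP' PQ; apply: negligibleS (negligibleU HP HP') => x /= nQ.
apply: contrapT => /not_orP[/contrapT ? /contrapT ?]; apply: nQ; exact: PQ.
Qed.

Lemma subset_oo_cc (R : realType) (a b : R) :
  (`]a, b[ : set R) `<=` (`[a, b] : set R).
Proof. by move=> x /=; rewrite !in_itv /= => /andP[/ltW-> /ltW->]. Qed.

Lemma intg_open (R : realType) (a b : R) (f : R -> R) : bmeas f ->
  intg a b f = \int[lebesgue_measure]_(x in `]a, b[) f x.
Proof.
move=> fb; have fi := @bmeas_integrable R f a b fb; rewrite /intg.
rewrite -Rintegral_itv_obnd_cbnd; last first.
  by apply: (integrableS _ _ _ fi) => //; apply: subset_itvr; rewrite bnd_simp.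
rewrite Rintegral_itv_bndo_bndc //; apply: (integrableS _ _ _ fi) => //.
exact: subset_oo_cc.
Qed.

Lemma intg_ae_eq (R : realType) (a b : R) (f g : R -> R) : 0 <= a -> b <= 1 ->
  bmeas f -> bmeas g ->
  {ae lebesgue_measure, forall x : R, 0 < x < 1 -> f x = g x} ->
  intg a b f = intg a b g.
Proof.
move=> a0 b1 fb gb fg; rewrite !intg_open //.
rewrite /Rintegral; congr fine; apply: ae_eq_integral => //.
- by apply/measurable_EFinP; exact: measurable_funTS fb.1.
- by apply/measurable_EFinP; exact: measurable_funTS gb.1.
- case: fg => A [mA A0 sub]; exists A; split => // x /= H; apply: sub => /= fg.
  apply: H; rewrite in_itv /= => /andP[ax xb].
  by rewrite fg // (le_lt_trans a0 ax) (lt_le_trans xb b1).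
Qed.

Lemma intg_ge0_eq0 (R : realType) (a b : R) (f : R -> R) : bmeas f ->
  (forall x, a < x < b -> 0 <= f x) -> intg a b f = 0 ->
  {ae lebesgue_measure, forall x : R, a < x < b -> f x = 0}.
Proof.
move=> fb f0; rewrite intg_open // /Rintegral => I0.
have fi : lebesgue_measure.-integrable `]a, b[ (EFin \o f).
  by apply: (integrableS _ _ _ (@bmeas_integrable R f a b fb)) => //;
    exact: subset_oo_cc.
have I0' : (\int[lebesgue_measure]_(x in `]a, b[) (f x)%:E = 0)%E.
  by rewrite -[LHS]fineK ?I0 //; exact: integrable_fin_num fi.
have mf : measurable_fun (`]a, b[ : set R) (EFin \o f).
  by apply/measurable_EFinP; exact: measurable_funTS fb.1.
have /(ae_eq_integral_abs lebesgue_measure _ mf) :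
    (\int[lebesgue_measure]_(x in `]a, b[) `|(EFin \o f) x| = 0)%E.
  rewrite -[RHS]I0'; apply: eq_integral => x; rewrite inE /= in_itv /= => /f0 fx.
  by rewrite ger0_norm.
move=> /(_ (measurable_itv _)); apply: filterS => x H axb.
by have := H; rewrite /= in_itv /= axb => /(_ isT) [].
Qed.

Lemma intg_ge0 (R : realType) (a b : R) (f : R -> R) :
  (forall x, a <= x <= b -> 0 <= f x) -> 0 <= intg a b f.
Proof.
by move=> f0; apply: Rintegral_ge0 => x /=; rewrite in_itv /= => /f0.
Qed.

Lemma intgN (R : realType) (a b : R) (f : R -> R) : bmeas f ->
  intg a b (fun x => - f x) = - intg a b f.
Proof.
move=> fb; rewrite -[RHS]mulN1r -intgZ //; apply: eq_intg => x _.
by rewrite mulN1r.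
Qed.

(** * Primitives of bounded functions *)

(** Telescoping over [n] equal steps bounds the total increment by
    [n * C * (x / n) ^ 2], which tends to [0]. *)
Lemma quadratic_increment_cst (R : realType) (D : R -> R) (C : R) :
  (forall x y, 0 <= x -> x <= y -> y <= 1 -> `|D y - D x| <= C * (y - x) ^+ 2) ->
  forall x, 0 <= x <= 1 -> D x = D 0.
Proof.
move=> DC x /andP[x0 x1]; apply/eqP; rewrite -subr_eq0 -normr_eq0.
rewrite eq_le normr_ge0 andbT; apply/ler_addgt0Pr => e e0; rewrite add0r.
have C0 : 0 <= C.
  have := DC 0 1 (lexx _) ler01 (lexx _); rewrite subr0 expr1n mulr1; exact: le_trans.
(* [n] exceeds [C / e], so that [C * x ^ 2 / n <= e] at the end *)
pose n := (Num.truncn (C / e)).+1.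
have Cn : C / e < n%:R by apply: truncnS_gt.
have n0 : 0 < n%:R :> R by rewrite ltr0n.
have step k : (k <= n)%N -> `|D (x * k%:R / n%:R) - D 0| <= k%:R * (C * (x / n%:R) ^+ 2).
  elim: k => [|k IH] kn.
    by rewrite mulr0 mul0r subrr normr0 mul0r.
  have kR : k.+1%:R <= n%:R :> R by rewrite ler_nat.
  have -> : D (x * k.+1%:R / n%:R) - D 0 =
    (D (x * k.+1%:R / n%:R) - D (x * k%:R / n%:R)) + (D (x * k%:R / n%:R) - D 0).
    by rewrite addrA subrK.
  apply: le_trans (ler_normD _ _) _.
  have -> : k.+1%:R * (C * (x / n%:R) ^+ 2) =
      C * (x / n%:R) ^+ 2 + k%:R * (C * (x / n%:R) ^+ 2) by rewrite -natr1; ring.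
  apply: lerD; last exact/IH/ltnW.
  have := DC (x * k%:R / n%:R) (x * k.+1%:R / n%:R).
  have -> : x * k.+1%:R / n%:R - x * k%:R / n%:R = x / n%:R.
    by rewrite -natr1; field; rewrite gt_eqF.
  apply.
  - by rewrite divr_ge0 ?mulr_ge0 ?ler0n.
  - by rewrite ler_pM2r ?invr_gt0 // ler_wpM2l // ler_nat.
  - rewrite ler_pdivrMr // mul1r; apply: le_trans (_ : 1 * n%:R <= _); last by rewrite mul1r.
    by apply: ler_pM.
have := step n (leqnn _); rewrite mulfK ?gt_eqF // => /le_trans; apply.
have -> : n%:R * (C * (x / n%:R) ^+ 2) = C * x ^+ 2 / n%:R.
  by field; rewrite gt_eqF.
rewrite ler_pdivrMr //; apply: le_trans (_ : C * 1 <= _).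
  by apply: ler_wpM2l => //; rewrite expr_le1.
by rewrite mulr1 -ler_pdivrMl // mulrC ltW.
Qed.

(** The relation [F' = f] almost everywhere, for Lipschitz [F], in integrated
    form: at a given point [F] may fail to be differentiable. *)
Definition prim (R : realType) (F f : R -> R) : Prop :=
  [/\ bmeas F, bmeas f & forall x, 0 <= x <= 1 -> F x = F 0 + intg 0 x f].

Lemma primE (R : realType) (F f : R -> R) (x y : R) : prim F f ->
  0 <= x -> x <= y -> y <= 1 -> F y - F x = intg x y f.
Proof.
move=> [_ fb FE] x0 xy y1.
rewrite (FE y) ?(le_trans x0 xy) // (FE x) ?x0 ?(le_trans xy y1) //.
rewrite (intg_chasles fb x0 xy); ring.
Qed.

(** A density is determined by the increments up to second-order errors, which
    is what makes the product and quotient rules below easy. *)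
Lemma primW (R : realType) (F f : R -> R) (C : R) : bmeas F -> bmeas f ->
  (forall x y, 0 <= x -> x <= y -> y <= 1 ->
     `|F y - F x - intg x y f| <= C * (y - x) ^+ 2) -> prim F f.
Proof.
move=> Fb fb FC; split=> // x x01.
have := @quadratic_increment_cst R (fun x => F x - intg 0 x f) C _ x x01.
rewrite intgxx subr0 => <-; first by rewrite subrK.
move=> {x01} {}x y x0 xy y1; rewrite (intg_chasles fb x0 xy).
have -> : F y - (intg 0 x f + intg x y f) - (F x - intg 0 x f) =
  F y - F x - intg x y f by ring.
exact: FC.
Qed.

Lemma prim_lipschitz (R : realType) (F f : R -> R) : prim F f ->
  exists2 M : R, 0 <= M & forall x y, 0 <= x -> x <= y -> y <= 1 ->
    `|F y - F x| <= M * (y - x).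
Proof.
move=> Ff; have [_ fb _] := Ff; have [M M0 fM] := bmeas_bound fb.
exists M => // x y x0 xy y1; rewrite (primE Ff) //; exact: intg_norm_le.
Qed.

Lemma prim_cst (R : realType) (c : R) : prim (fun=> c) (fun=> 0).
Proof.
split; [exact: bmeas_cst|exact: bmeas_cst|].
by move=> x /andP[x0 _]; rewrite intg_cst // mul0r addr0.
Qed.

Lemma primD (R : realType) (F f G g : R -> R) : prim F f -> prim G g ->
  prim (fun x => F x + G x) (fun x => f x + g x).
Proof.
move=> [Fb fb FE] [Gb gb GE]; split; try exact: bmeasD.
by move=> x x01; rewrite intgD // FE // GE //; ring.
Qed.

(** The increment of [F G] differs from the integral of [f G + F g] by
    integrals of [f (t) (G y - G t)] and [g (t) (F x - F t)], both of second
    order as [F] and [G] are Lipschitz. *)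
Lemma primM (R : realType) (F f G g : R -> R) : prim F f -> prim G g ->
  prim (fun x => F x * G x) (fun x => f x * G x + F x * g x).
Proof.
move=> Ff Gg; have [M M0 FM] := prim_lipschitz Ff.
have [L L0 GL] := prim_lipschitz Gg.
have [Fb fb _] := Ff; have [Gb gb _] := Gg.
have [A A0 fA] := bmeas_bound fb; have [A' A'0 gA'] := bmeas_bound gb.
apply: (@primW R _ _ (A * L + A' * M)); [exact: bmeasM| |].
  by apply: bmeasD; exact: bmeasM.
move=> x y x0 xy y1.
have h1 : bmeas (fun t => f t * (G y - G t)).
  by apply: bmeasM => //; apply: bmeasB => //; exact: bmeas_cst.
have h2 : bmeas (fun t => g t * (F x - F t)).
  by apply: bmeasM => //; apply: bmeasB => //; exact: bmeas_cst.
have -> : F y * G y - F x * G x - intg x y (fun t => f t * G t + F t * g t) =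
    intg x y (fun t => f t * (G y - G t)) + intg x y (fun t => g t * (F x - F t)).
  have -> : F y * G y - F x * G x = G y * (F y - F x) + F x * (G y - G x) by ring.
  rewrite (primE Ff) // (primE Gg) // -!intgZ // -!intgD // -?intgB //.
  - by apply: eq_intg => t _; ring.
  - by apply: bmeasD; apply: bmeasM => //; exact: bmeas_cst.
  - by apply: bmeasD; apply: bmeasM => //; exact: bmeas_cst.
  - by apply: bmeasM => //; exact: bmeas_cst.
  - by apply: bmeasM => //; exact: bmeas_cst.
apply: le_trans (ler_normD _ _) _; rewrite mulrDl; apply: lerD.
- rewrite expr2 mulrA; apply: intg_norm_le => // t /andP[xt ty].
  rewrite normrM -mulrA; apply: ler_pM => //.
  apply: le_trans (GL t y _ ty y1) _; first exact: le_trans xt.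
  by apply: ler_wpM2l => //; lra.
- rewrite expr2 mulrA; apply: intg_norm_le => // t /andP[xt ty].
  rewrite normrM -mulrA; apply: ler_pM => //.
  rewrite distrC; apply: le_trans (FM x t x0 xt (le_trans ty y1)) _.
  by apply: ler_wpM2l => //; lra.
Qed.

Lemma eq_prim (R : realType) (F f g : R -> R) : (forall x, f x = g x) ->
  prim F f -> prim F g.
Proof. by move=> fg; have -> : f = g by exact/funext. Qed.

Lemma primZ (R : realType) (c : R) (F f : R -> R) : prim F f ->
  prim (fun x => c * F x) (fun x => c * f x).
Proof.
move=> Ff; apply: eq_prim (primM (prim_cst c) Ff) => x.
by rewrite mul0r add0r.
Qed.

(** * Functions on the unit interval *)

Lemma is_derive_quadratic (R : realType) (F : R -> R) (x d C e : R) : 0 < e ->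
  (forall h, `|h| < e -> `|F (x + h) - F x - d * h| <= C * h ^+ 2) ->
  is_derive x 1 F d.
Proof.
move=> e0 FC.
have C0 : 0 <= C.
  have := FC (e / 2); rewrite gtr0_norm ?divr_gt0 // => /(_ ltac:(lra)) H.
  have : 0 <= C * (e / 2) ^+ 2 by apply: le_trans H.
  by rewrite pmulr_lge0 // exprn_gt0 // divr_gt0.
have H : (fun h : R => h^-1 *: (F (h *: 1 + x) - F x)) @ 0^' --> d.
  apply/cvgrPdist_le => /= r r0; near=> h.
  have h0 : h != 0 by near: h; exact: nbhs_dnbhs_neq.
  have he : `|h| < e by near: h; exact: dnbhs0_lt.
  have hr : `|h| < r / (C + 1).
    by near: h; apply: dnbhs0_lt; rewrite divr_gt0 // ltr_wpDl.
  have -> : d - h^-1 *: (F (h *: 1 + x) - F x) =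
      - (h^-1 * (F (x + h) - F x - d * h)).
    by rewrite /GRing.scale /= mulr1 [h + x]addrC; field.
  rewrite normrN normrM normfV ler_pdivrMl ?normr_gt0 //.
  apply: le_trans (FC h he) _.
  have -> : h ^+ 2 = `|h| * `|h| by rewrite -expr2 real_normK // num_real.
  rewrite mulrCA; apply: ler_wpM2l => //.
  move: hr; rewrite ltr_pdivlMr ?ltr_wpDl // mulrDr mulr1 => hr.
  by rewrite mulrC; apply: le_trans (ltW hr); rewrite lerDl.
by apply: DeriveDef; [exact: cvgP H|exact: cvg_lim H].
Unshelve. all: by end_near. Qed.

(** The retraction of the line onto [[0, 1]]; composing with it turns functions
    that are meaningful on [[0, 1]] only into functions on the line. *)
Definition clamp (R : realType) (x : R) : R := Num.max 0 (Num.min 1 x).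

Lemma clamp_ge0 (R : realType) (x : R) : 0 <= clamp x.
Proof. by rewrite /clamp le_max lexx. Qed.

Lemma clamp_le1 (R : realType) (x : R) : clamp x <= 1.
Proof. by rewrite /clamp ge_max ler01 ge_min lexx. Qed.

Lemma clamp01 (R : realType) (x : R) : 0 <= clamp x <= 1.
Proof. by rewrite clamp_ge0 clamp_le1. Qed.

Lemma clampE (R : realType) (x : R) : 0 <= x <= 1 -> clamp x = x.
Proof.
by move=> /andP[x0 x1]; rewrite /clamp (min_idPr x1) (max_idPr x0).
Qed.

Lemma clamp_le0 (R : realType) (x : R) : x <= 0 -> clamp x = 0.
Proof.
move=> x0; rewrite /clamp; apply/max_idPl; rewrite ge_min x0 orbT //.
Qed.

Lemma clamp_ge1 (R : realType) (x : R) : 1 <= x -> clamp x = 1.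
Proof.
by move=> x1; rewrite /clamp (min_idPl x1); apply/max_idPr; exact: ler01.
Qed.

Lemma clamp_lipschitz (R : realType) (x y : R) : `|clamp x - clamp y| <= `|x - y|.
Proof.
have [x0|x0] := leP x 0; have [y0|y0] := leP y 0;
have [x1|x1] := leP x 1; have [y1|y1] := leP y 1;
 do ?[rewrite (clamp_le0 x0)|rewrite (clamp_ge1 (ltW x1))
     |rewrite (clampE (x := x)) ?(ltW x0) ?x1 //];
 do ?[rewrite (clamp_le0 y0)|rewrite (clamp_ge1 (ltW y1))
     |rewrite (clampE (x := y)) ?(ltW y0) ?y1 //];
 rewrite ler_norml; apply/andP; split; have := ler_norm (x - y); have := ler_norm (y - x);
 rewrite (distrC y x); lra.
Qed.

Lemma lipschitz_continuous (R : realType) (f : R -> R) (M : R) :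
  (forall x y, `|f x - f y| <= M * `|x - y|) -> continuous f.
Proof.
move=> fM x; apply/cvgrPdist_le => /= e e0; near=> y.
apply: le_trans (fM x y) _.
have xy : `|x - y| <= e / (`|M| + 1).
  by near: y; apply: cvgr_dist_le; [exact: cvg_id|rewrite divr_gt0 // ltr_wpDl].
apply: le_trans (_ : (`|M| + 1) * `|x - y| <= _).
  by apply: ler_wpM2r => //; apply: le_trans (ler_norm _) _; rewrite lerDl.
by rewrite mulrC -ler_pdivlMr // ltr_wpDl.
Unshelve. all: by end_near. Qed.

Lemma continuous_clamp (R : realType) : continuous (@clamp R).
Proof.
by apply: (@lipschitz_continuous _ _ 1) => x y; rewrite mul1r clamp_lipschitz.
Qed.

Lemma within_clamp (R : realType) (f : R -> R) :
  {within (`[0, 1] : set R), continuous f} -> continuous (f \o @clamp R).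
Proof.
move=> /subspace_continuousP fc x.
have c01 : (`[0, 1]%classic : set R) (clamp x) by rewrite /= in_itv /= clamp01.
apply: (cvg_comp _ _ _ (fc _ c01)).
move=> A /= wA.
have : nbhs x (@clamp R @^-1` [set t | `[0, 1]%classic t -> A t]).
  exact: (@continuous_clamp R x _ wA).
apply: filterS => y /=; apply; rewrite in_itv; exact: clamp01.
Qed.

Lemma bmeas_clamp (R : realType) (f : R -> R) :
  {within (`[0, 1] : set R), continuous f} -> bmeas (f \o @clamp R).
Proof.
move=> fc; have [a _ aM] := EVT_max ler01 fc; have [b _ bM] := EVT_min ler01 fc.
split; first by apply: continuous_measurable_fun; exact: within_clamp.
exists (`|f a| + `|f b|); move=> x /=.
have c01 : clamp x \in `[0, 1] by rewrite in_itv /= clamp01.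
have := aM _ c01; have := bM _ c01; rewrite ler_norml.
have := ler_norm (f a); have := ler_norm (- f b); rewrite normrN.
have := normr_ge0 (f a); have := normr_ge0 (f b); lra.
Qed.

Lemma bmeas_clamp_continuous (R : realType) (f : R -> R) : continuous f ->
  bmeas (f \o @clamp R).
Proof. by move=> fc; apply: bmeas_clamp; exact: continuous_subspaceT. Qed.

Lemma intg_clamp (R : realType) (f : R -> R) (x : R) : 0 <= x <= 1 ->
  intg 0 x (f \o @clamp R) = intg 0 x f.
Proof.
move=> /andP[x0 x1]; apply: eq_intg => t /andP[t0 tx] /=.
by rewrite clampE // t0 (le_trans tx x1).
Qed.

Lemma continuous_clamp_lipschitz (R : realType) (f : R -> R) (M : R) :
  (forall x y, 0 <= x -> x <= y -> y <= 1 -> `|f y - f x| <= M * (y - x)) ->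
  continuous (f \o @clamp R).
Proof.
move=> fM; apply: (@lipschitz_continuous _ _ M) => x y /=.
have M0 : 0 <= M.
  have := fM 0 1 (lexx _) ler01 (lexx _); rewrite subr0 mulr1; exact: le_trans.
apply: le_trans (_ : M * `|clamp x - clamp y| <= _); last first.
  by apply: ler_wpM2l => //; exact: clamp_lipschitz.
have [xy|/ltW xy] := leP (clamp x) (clamp y).
  rewrite distrC [X in M * X]distrC [`|clamp y - _|]ger0_norm ?subr_ge0 //.
  by apply: fM; rewrite ?clamp_ge0 ?clamp_le1.
rewrite [`|clamp x - _|]ger0_norm ?subr_ge0 //.
by apply: fM; rewrite ?clamp_ge0 ?clamp_le1.
Qed.

Lemma prim_continuous (R : realType) (F f : R -> R) : prim F f ->
  {within (`[0, 1] : set R), continuous F}.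
Proof.
move=> /prim_lipschitz [M _ FM].
apply: (@subspace_eq_continuous _ _ _ (F \o @clamp R)); last first.
  by apply: continuous_subspaceT; exact: continuous_clamp_lipschitz FM.
by move=> x; rewrite inE /= in_itv /= => x01; rewrite /= clampE.
Qed.

Lemma prim_clamp_continuous (R : realType) (F f : R -> R) : prim F f ->
  (forall x, F (clamp x) = F x) -> continuous F.
Proof.
move=> /prim_continuous /within_clamp H Fc.
by have -> : F = F \o @clamp R by apply/funext => x; rewrite /= Fc.
Qed.

Lemma prim_intg (R : realType) (c : R) (f : R -> R) : bmeas f ->
  prim (fun x => c + intg 0 (clamp x) f) f.
Proof.
move=> fb; have [M M0 fM] := bmeas_bound fb.
split => //; last first.
  by move=> x x01; rewrite (clampE x01) clampE ?lexx ?ler01 // intgxx addr0.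
have H : continuous ((fun x => c + intg 0 x f) \o @clamp R).
  apply: (@continuous_clamp_lipschitz _ _ M) => x y x0 xy y1.
  rewrite (intg_chasles fb x0 xy).
  have -> : c + (intg 0 x f + intg x y f) - (c + intg 0 x f) = intg x y f by ring.
  exact: intg_norm_le.
apply: (@bmeasW _ _ (`|c| + M)); first exact: continuous_measurable_fun.
move=> x; apply: le_trans (ler_normD _ _) _; apply: lerD => //.
apply: le_trans (intg_norm_le (clamp_ge0 x) fb (fun t _ => fM t)) _.
by rewrite subr0 ler_piMr // clamp_le1.
Qed.

Lemma prim_is_derive (R : realType) (F f g : R -> R) (x : R) : prim F f -> prim f g ->
  0 < x < 1 -> is_derive x 1 F (f x).
Proof.
move=> Ff fg /andP[x0 x1]; have [M M0 fM] := prim_lipschitz fg.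
have [Fb fb _] := Ff.
have e0 : 0 < Num.min x (1 - x) by rewrite lt_min x0 subr_gt0.
apply: (@is_derive_quadratic _ _ _ _ M _ e0) => h; rewrite lt_min !ltr_norml.
move=> /andP[/andP[h1 h2] /andP[h3 h4]].
have cb : bmeas (fun t => f t - f x) by apply: bmeasB => //; exact: bmeas_cst.
have [h0|h0] := leP 0 h.
- have -> : F (x + h) - F x - f x * h = intg x (x + h) (fun t => f t - f x).
    rewrite intgB // ?intg_cst //; [|lra|exact: bmeas_cst].
    by rewrite (primE Ff) //; [ring|lra..].
  have -> : M * h ^+ 2 = (M * h) * (x + h - x) by ring.
  apply: intg_norm_le => //; first by lra.
  move=> t /andP[t1 t2]; apply: le_trans (fM _ _ _ _ _) _; try lra.
  by apply: ler_wpM2l => //; lra.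
- have -> : F (x + h) - F x - f x * h = - intg (x + h) x (fun t => f t - f x).
    rewrite intgB // ?intg_cst //; [|lra|exact: bmeas_cst].
    by rewrite -(primE Ff) //; [ring|lra..].
  have -> : M * h ^+ 2 = (M * - h) * (x - (x + h)) by ring.
  rewrite normrN; apply: intg_norm_le => //; first by lra.
  move=> t /andP[t1 t2]; rewrite distrC; apply: le_trans (fM _ _ _ _ _) _; try lra.
  by apply: ler_wpM2l => //; lra.
Qed.

Lemma prim_C1 (R : realType) (F f : R -> R) : continuous f ->
  (forall x : R, is_derive x 1 F (f x)) -> prim (F \o @clamp R) (f \o @clamp R).
Proof.
move=> fc dF.
have Fc : continuous F.
  by move=> x; apply/differentiable_continuous/derivable1_diffP/(@ex_derive _ _ _ _ _ _ _ (dF x)).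
split; try exact: bmeas_clamp_continuous.
move=> x /[dup] x01 /andP[x0 x1]; rewrite intg_clamp // /= !clampE ?lexx ?ler01 //.
move: x0; rewrite le_eqVlt => /predU1P[<-|x0]; first by rewrite intgxx addr0.
have c1 : {within (`[0, x] : set R), continuous f} by exact: continuous_subspaceT.
have c2 : derivable_oo_LRcontinuous F 0 x.
  split; first by move=> t _; exact: (@ex_derive _ _ _ _ _ _ _ (dF t)).
  - exact/cvg_at_right_filter/Fc.
  - exact/cvg_at_left_filter/Fc.
have c3 : {in `]0, x[, F^`()%classic =1 f}.
  by move=> t _; rewrite derive1E; exact: (@derive_val _ _ _ _ _ _ _ (dF t)).
have E := continuous_FTC2 x0 c1 c2 c3.
have -> : intg 0 x f = F x - F 0 by rewrite /intg /Rintegral E -EFinB.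
by rewrite addrC subrK.
Qed.

(** * Weak derivatives *)

(** The truncated square, a C^1 function whose second-order Taylor remainder
    is globally bounded by [h ^ 2]. *)
Definition sqpos (R : realType) (x : R) : R := Num.max 0 x ^+ 2.

Lemma maxr0_cases (R : realType) (x : R) :
  (x <= 0 /\ Num.max 0 x = 0) \/ (0 <= x /\ Num.max 0 x = x).
Proof.
have [x0|x0] := leP x 0; first by left.
by right; split; rewrite // ltW.
Qed.

Lemma maxr0_sub (R : realType) (s : R) : Num.max 0 s - Num.max 0 (- s) = s.
Proof.
by have [[? ->]|[? ->]] := maxr0_cases s; have [[? ->]|[? ->]] := maxr0_cases (- s); lra.
Qed.

Lemma maxr0_add (R : realType) (s : R) : Num.max 0 s + Num.max 0 (- s) = `|s|.
Proof.
have [[s0 ->]|[s0 ->]] := maxr0_cases s; have [[? ->]|[? ->]] := maxr0_cases (- s);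
  rewrite ?(ger0_norm s0) ?(ler0_norm s0); lra.
Qed.

(** Splitting a real parameter into its positive and negative parts does not
    increase distances; this makes the tents below, and later the family of
    variations, Lipschitz. *)
Lemma maxr0_lipschitz (R : realType) (s t : R) :
  `|Num.max 0 s - Num.max 0 t| + `|Num.max 0 (- s) - Num.max 0 (- t)| <= `|s - t|.
Proof.
have G (X Y Z : R) : X + Y <= Z -> X - Y <= Z -> - X + Y <= Z -> - X - Y <= Z ->
    `|X| + `|Y| <= Z.
  by move=> ? ? ? ?; case: (ger0P X) => ?; case: (ger0P Y) => ?; lra.
have := ler_norm (s - t); have := ler_norm (t - s); rewrite (distrC t s).
move: `|s - t| => d h2 h1.
have e1 := maxr0_sub s; have e2 := maxr0_sub t.
have p0 (u : R) : 0 <= Num.max 0 u by rewrite le_max lexx.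
have z (u : R) : Num.max 0 u = 0 \/ Num.max 0 (- u) = 0.
  case/orP: (le_total u 0) => u0; first by left; apply/max_idPl.
  by right; apply/max_idPl; rewrite oppr_le0.
move: (p0 s) (p0 (- s)) (p0 t) (p0 (- t)) (z s) (z t) e1 e2; clear -h1 h2 G.
move: (Num.max 0 s) (Num.max 0 (- s)) (Num.max 0 t) (Num.max 0 (- t)).
move=> a a' c c' ? ? ? ? zs zt e1 e2.
by apply: G; case: zs => ?; case: zt => ?; lra.
Qed.

Lemma sqpos_quadratic (R : realType) (x h : R) :
  `|sqpos (x + h) - sqpos x - 2 * Num.max 0 x * h| <= h ^+ 2.
Proof.
rewrite /sqpos ler_norml.
have [[? ->]|[? ->]] := maxr0_cases x;
  have [[? ->]|[? ->]] := maxr0_cases (x + h); apply/andP; split; nra.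
Qed.

(** A C^1 quadratic spline that climbs from [0] to [2 * e ^ 2] across
    [[a - e, a + e]]; the difference of two such functions is a test function
    whose derivative is a difference of two tents. *)
Definition bump (R : realType) (a e x : R) : R :=
  sqpos (x + (e - a)) - 2 * sqpos (x + (- a)) + sqpos (x + (- e - a)).

Definition tent (R : realType) (a e x : R) : R :=
  2 * Num.max 0 (x + (e - a)) - 4 * Num.max 0 (x + (- a))
   + 2 * Num.max 0 (x + (- e - a)).

Lemma is_derive_bump (R : realType) (a e x : R) :
  is_derive x 1 (bump a e) (tent a e x).
Proof.
apply: (@is_derive_quadratic _ _ _ _ 4 1) => // h _; rewrite /bump /tent.
have := sqpos_quadratic (x + (e - a)) h; have := sqpos_quadratic (x + (- a)) h.
have := sqpos_quadratic (x + (- e - a)) h; rewrite !(addrAC x _ h) !ler_norml.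
by lra.
Qed.

Lemma continuous_tent (R : realType) (a e : R) : continuous (tent a e).
Proof.
apply: (@lipschitz_continuous _ _ 8) => x y.
have H c : `|Num.max 0 (x + c) - Num.max 0 (y + c)| <= `|x - y|.
  have := maxr0_lipschitz (x + c) (y + c); have -> : x + c - (y + c) = x - y by ring.
  by apply: le_trans; rewrite lerDl.
have := H (e - a); have := H (- a); have := H (- e - a).
rewrite /tent !ler_norml; lra.
Qed.

Lemma tent_ge0 (R : realType) (a e x : R) : 0 <= e -> 0 <= tent a e x.
Proof.
move=> e0; rewrite /tent.
have [[? ->]|[? ->]] := maxr0_cases (x + (e - a));
have [[? ->]|[? ->]] := maxr0_cases (x + (- a));
have [[? ->]|[? ->]] := maxr0_cases (x + (- e - a)); lra.
Qed.

Lemma tent_out (R : realType) (a e x : R) : 0 <= e -> e <= `|x - a| -> tent a e x = 0.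
Proof.
move=> e0; rewrite /tent ler_normr => /orP[?|?];
have [[? ->]|[? ->]] := maxr0_cases (x + (e - a));
have [[? ->]|[? ->]] := maxr0_cases (x + (- a));
have [[? ->]|[? ->]] := maxr0_cases (x + (- e - a)); lra.
Qed.

Lemma bump_left (R : realType) (a e x : R) : 0 <= e -> x <= a - e -> bump a e x = 0.
Proof.
move=> e0 xa; rewrite /bump /sqpos.
rewrite !(max_idPl _) ?expr0n /=; lra.
Qed.

Lemma bump_right (R : realType) (a e x : R) : 0 <= e -> a + e <= x -> bump a e x = 2 * e ^+ 2.
Proof.
move=> e0 xa; rewrite /bump /sqpos.
have -> : Num.max 0 (x + (e - a)) = x + (e - a) by apply/max_idPr; lra.
have -> : Num.max 0 (x + (- a)) = x + (- a) by apply/max_idPr; lra.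
have -> : Num.max 0 (x + (- e - a)) = x + (- e - a) by apply/max_idPr; lra.
ring.
Qed.

Lemma Rintegral_clamp (R : realType) (f g : R -> R) : bmeas f -> continuous g ->
  \int[lebesgue_measure]_(x in (`]0, 1[ : set R)) (f x * g x) =
  intg 0 1 (fun x => f x * g (clamp x)).
Proof.
move=> fb gc; rewrite intg_open; last by apply: bmeasM => //; exact: bmeas_clamp_continuous.
apply: eq_Rintegral => x; rewrite inE /= in_itv /= => /andP[x0 x1].
by rewrite clampE // !ltW.
Qed.

Lemma prim_test_function (R : realType) (phi : R -> R) : test_function01 phi ->
  [/\ continuous phi, prim (phi \o @clamp R) (derive1 phi \o @clamp R),
    phi 0 = 0 & phi 1 = 0].
Proof.
move=> [dphi cphi [K [_ K01 K0]]].
have dphi' (x : R) : is_derive x 1 phi (derive1 phi x).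
  by rewrite derive1E; exact/derivableP.
split.
- by move=> x; apply/differentiable_continuous/derivable1_diffP.
- exact: prim_C1.
- by apply: K0 => /K01 /=; rewrite in_itv /= ltxx.
- by apply: K0 => /K01 /=; rewrite in_itv /= ltxx andbF.
Qed.

Lemma prim_by_parts (R : realType) (F f phi : R -> R) : prim F f ->
  test_function01 phi ->
  intg 0 1 (fun x => F x * derive1 phi (clamp x)) =
  - intg 0 1 (fun x => f x * phi (clamp x)).
Proof.
move=> Ff /prim_test_function[_ pphi phi0 phi1].
have [Fb fb _] := Ff; have [pb db _] := pphi.
have [_ _ /(_ 1)] := primM Ff pphi.
rewrite /= ler01 lexx !clampE ?lexx ?ler01 // phi0 phi1 !mulr0 add0r => /(_ isT).
by rewrite intgD; [lra|exact: bmeasM|exact: bmeasM].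
Qed.

Lemma bmeas_ess_bounded (R : realType) (f : R -> R) : bmeas f -> ess_bounded01 f.
Proof.
move=> [mf [M fM]]; split; first exact: measurable_funTS mf.
by exists M; apply: aeW => x _.
Qed.

(** Test functions are primitives that vanish at both ends, so integration by
    parts is the product rule for [prim]. *)
Lemma prim_sobolev (R : realType) (F f : R -> R) : prim F f -> sobolev1_deriv F f.
Proof.
move=> Ff; have [Fb fb _] := Ff; split; try exact: bmeas_ess_bounded.
move=> phi tphi; have [cphi _ _ _] := prim_test_function tphi.
have [_ cd _] := tphi.
by rewrite !Rintegral_clamp // (prim_by_parts Ff).
Qed.

Lemma test_function_bumps (R : realType) (a c e : R) : 0 < e ->
  0 < a - e -> a + e < 1 -> 0 < c - e -> c + e < 1 ->
  test_function01 (fun x => bump a e x - bump c e x) /\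
  derive1 (fun x => bump a e x - bump c e x) = (fun x => tent a e x - tent c e x).
Proof.
move=> e0 a0 a1 c0 c1.
have dphi (x : R) : is_derive x 1 (fun x => bump a e x - bump c e x) (tent a e x - tent c e x).
  exact: is_deriveB (is_derive_bump a e x) (is_derive_bump c e x).
have dE : derive1 (fun x => bump a e x - bump c e x) = (fun x => tent a e x - tent c e x).
  by apply/funext => x; rewrite derive1E; exact: (@derive_val _ _ _ _ _ _ _ (dphi x)).
split=> //; split.
- by move=> x; exact: (@ex_derive _ _ _ _ _ _ _ (dphi x)).
- by rewrite dE => x; apply: cvgB; exact: continuous_tent.
- exists `[Num.min (a - e) (c - e), Num.max (a + e) (c + e)]%classic; split.
  + exact: segment_compact.
  + move=> x /=; rewrite !in_itv /= ge_min le_max => /andP[H1 H2].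
    by apply/andP; split; [case/orP: H1|case/orP: H2]; lra.
  + move=> x /=; rewrite in_itv /= => /negP; rewrite negb_and -!ltNge lt_min gt_max.
    case/orP => /andP[H1 H2].
      by rewrite !bump_left ?subrr //; lra.
    by rewrite !bump_right ?subrr //; lra.
Qed.

Lemma intg_tent (R : realType) (a e : R) : 0 < e -> 0 < a - e -> a + e < 1 ->
  intg 0 1 (tent a e \o @clamp R) = 2 * e ^+ 2.
Proof.
move=> e0 a0 a1.
have [_ _ /(_ 1)] := @prim_C1 R (bump a e) (tent a e) (@continuous_tent _ _ _) (is_derive_bump a e).
rewrite /= ler01 lexx !clampE ?lexx ?ler01 // => /(_ isT).
by rewrite bump_right ?bump_left ?add0r; [move=> <-| lra..].
Qed.

Lemma continuous_eps (R : realType) (f : R -> R) (a r : R) :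
  {for a, continuous f} -> 0 < r ->
  exists2 e : R, 0 < e & forall x, `|a - x| < e -> `|f a - f x| < r.
Proof.
move=> /cvgrPdist_lt H r0; have /nbhs_ballP[e /= e0 He] := H _ r0.
by exists e => // x xe; exact: He.
Qed.

(** If [h c > h a], then [h] lies above some level near [c] and below it near
    [a]; a tent at [a] minus a tent at [c] is the derivative of a test function
    and would give a negative integral. *)
Lemma orthogonal_test_le (R : realType) (h : R -> R) (a c : R) :
  continuous h -> bmeas h ->
  (forall phi, test_function01 phi ->
     intg 0 1 (fun x => h x * derive1 phi (clamp x)) = 0) ->
  0 < a < 1 -> 0 < c < 1 -> h c <= h a.
Proof.
move=> hc hb H /andP[a0 a1] /andP[c0 c1]; rewrite leNgt; apply/negP => ac.
(* windows around [a] and [c] on which [h] stays below [m - r] and above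
   [m + r], respectively *)
pose m := (h a + h c) / 2; pose r := (h c - h a) / 4.
have mE : m = (h a + h c) / 2 by []; have rE : r = (h c - h a) / 4 by [].
have r0 : 0 < r by rewrite divr_gt0 // subr_gt0.
have [e1 e10 He1] := continuous_eps (hc a) r0.
have [e2 e20 He2] := continuous_eps (hc c) r0.
pose e := Num.min (Num.min e1 e2) (Num.min (Num.min a (1 - a)) (Num.min c (1 - c))) / 2.
have e0 : 0 < e by rewrite divr_gt0 // !lt_min e10 e20 a0 c0 !subr_gt0 a1 c1.
have : 2 * e <= Num.min (Num.min e1 e2) (Num.min (Num.min a (1 - a)) (Num.min c (1 - c))).
  by rewrite /e mulrC divfK.
rewrite !le_min => /andP[/andP[ee1 ee2] /andP[/andP[ea ea'] /andP[ec ec']]].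
have [||||tphi dphi] := @test_function_bumps R a c e e0; try lra.
have := H _ tphi; rewrite dphi => {}H.
have [tphic [_ db _] _ _] := prim_test_function tphi; rewrite dphi in db.
have bt (b : R) : bmeas (tent b e \o @clamp R) by exact: bmeas_clamp_continuous (@continuous_tent _ _ _).
have : intg 0 1 (fun x => (h x - m) * (tent a e (clamp x) - tent c e (clamp x))) = 0.
  transitivity (intg 0 1 (fun x => h x * (tent a e (clamp x) - tent c e (clamp x))
     - m * (tent a e (clamp x) - tent c e (clamp x)))).
    by apply: eq_intg => x _; ring.
  rewrite intgB ?H; [|exact: bmeasM|by apply: bmeasM => //; exact: bmeas_cst].
  rewrite intgZ // intgB ?intg_tent //; try lra.
  - exact: bt.
  - exact: bt.
have : intg 0 1 (fun x => (h x - m) * (tent a e (clamp x) - tent c e (clamp x))) <=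
       intg 0 1 (fun x => - r * (tent a e (clamp x) + tent c e (clamp x))).
  apply: intg_le.
  - by apply: bmeasM => //; apply: bmeasB => //; exact: bmeas_cst.
  - by apply: bmeasM; [exact: bmeas_cst|apply: bmeasD; exact: bt].
  move=> x x01; rewrite !clampE //.
  have ta := @tent_ge0 R a e x (ltW e0); have tc := @tent_ge0 R c e x (ltW e0).
  suff : (h x - m + r) * tent a e x <= 0 /\ 0 <= (h x - m - r) * tent c e x by nra.
  split.
  - have [xa|xa] := leP e `|x - a|; first by rewrite (tent_out (ltW e0) xa) mulr0.
    have /He1 : `|a - x| < e1 by rewrite distrC; apply: lt_le_trans xa _; lra.
    by rewrite ltr_norml => /andP[? ?]; rewrite mulr_le0_ge0 //; lra.
  - have [xc|xc] := leP e `|x - c|; first by rewrite (tent_out (ltW e0) xc) mulr0.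
    have /He2 : `|c - x| < e2 by rewrite distrC; apply: lt_le_trans xc _; lra.
    by rewrite ltr_norml => /andP[? ?]; rewrite mulr_ge0 //; lra.
rewrite intgZ; last by apply: bmeasD; exact: bt.
rewrite intgD; [|exact: bt|exact: bt].
rewrite !intg_tent //; try lra.
have := exprn_gt0 2 e0; nra.
Qed.

Lemma orthogonal_test_cst (R : realType) (h : R -> R) (b : R) :
  continuous h -> bmeas h ->
  (forall phi, test_function01 phi ->
     intg 0 1 (fun x => h x * derive1 phi (clamp x)) = 0) ->
  0 <= b <= 1 -> h b = h (1 / 2).
Proof.
move=> hc hb H /andP[b0 b1].
have hin x : 0 < x < 1 -> h x = h (1 / 2).
  move=> x01; have h12 : 0 < (1 / 2 : R) < 1 by lra.
  by apply/eqP; rewrite eq_le; apply/andP; split; exact: orthogonal_test_le.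
apply/eqP; apply: contraT => hb12.
have r0 : 0 < `|h b - h (1 / 2)| by rewrite normr_gt0 subr_eq0.
have [e e0 He] := continuous_eps (hc b) r0.
(* [b] may be an end point, where test functions give no information *)
have [x x01 xe] : exists2 x, 0 < x < 1 & `|b - x| < e.
  clear -b0 b1 e0; pose t := Num.min (1 / 2) (e / 2).
  have t0 : 0 < t by rewrite lt_min !divr_gt0.
  have t12 : t <= 1 / 2 by rewrite ge_min lexx.
  have te : t <= e / 2 by rewrite ge_min lexx orbT.
  exists (b + t * (1 / 2 - b)); first by apply/andP; split; nra.
  by rewrite ltr_norml; apply/andP; split; nra.
by have := He _ xe; rewrite (hin _ x01) ltxx.
Qed.

(** The difference of [u] and the primitive of [f] has weak derivative [0]; this
    is the lemma of du Bois-Reymond. *)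
Lemma sobolev_prim (R : realType) (u g f : R -> R) :
  {within (`[0, 1] : set R), continuous u} -> sobolev1_deriv u g -> bmeas f ->
  {ae lebesgue_measure, forall x : R, 0 < x < 1 -> g x = f x} ->
  prim (u \o @clamp R) f.
Proof.
move=> uc [_ [mg _] ug] fb gf.
have ub := bmeas_clamp uc.
have cc (x : R) : clamp (clamp x) = clamp x by rewrite clampE // clamp01.
have [F Ff [Fc F0]] : exists2 F, prim F f & (forall x, F (clamp x) = F x) /\ F 0 = 0.
  exists (fun x => 0 + intg 0 (clamp x) f); first exact: prim_intg.
  by split=> [x|]; rewrite ?cc // clampE ?lexx ?ler01 // intgxx addr0.
have [Fb _ FE] := Ff.
have uE (x : R) : `]0, 1[%classic x -> u x = (u \o @clamp R) x.
  by rewrite /= in_itv /= => /andP[x0 x1]; rewrite clampE // !ltW.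
have H (phi : R -> R) : test_function01 phi ->
    intg 0 1 (fun x => ((u \o @clamp R) x - F x) * derive1 phi (clamp x)) = 0.
  move=> tphi; have [cphi [_ db _] _ _] := prim_test_function tphi.
  have [_ cd _] := tphi.
  have udb := bmeasM ub db; have Fdb := bmeasM Fb db.
  have E1 : \int[lebesgue_measure]_(x in (`]0, 1[ : set R)) (u x * derive1 phi x) =
      intg 0 1 (fun x => (u \o @clamp R) x * derive1 phi (clamp x)).
    rewrite -(Rintegral_clamp ub cd); apply: eq_Rintegral => x.
    by rewrite inE => /uE ->.
  have E2 : \int[lebesgue_measure]_(x in (`]0, 1[ : set R)) (g x * phi x) =
      intg 0 1 (fun x => f x * phi (clamp x)).
    have mphi : measurable_fun (`]0, 1[ : set R) phi.
      exact: measurable_funTS (continuous_measurable_fun cphi).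
    have mf : measurable_fun (`]0, 1[ : set R) f by exact: measurable_funTS fb.1.
    rewrite -(Rintegral_clamp fb cphi) /Rintegral; congr fine; apply: ae_eq_integral.
    - exact: measurable_itv.
    - by apply/measurable_EFinP; exact: measurable_funM.
    - by apply/measurable_EFinP; exact: measurable_funM.
    - case: gf => A [mA A0 sub]; exists A; split; [exact: mA|exact: A0|].
      move=> x /= nH; apply: sub => /= gfx; apply: nH.
      by rewrite in_itv /= => /gfx ->.
  have := ug _ tphi; rewrite E1 E2 -(prim_by_parts Ff tphi) => E.
  transitivity (intg 0 1 (fun x => (u \o @clamp R) x * derive1 phi (clamp x)) -
      intg 0 1 (fun x => F x * derive1 phi (clamp x))); last by rewrite E subrr.
  by rewrite -(intgB _ _ udb Fdb); apply: eq_intg => x _; rewrite mulrBl.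
have hc : continuous (fun x => (u \o @clamp R) x - F x).
  move=> x; apply: cvgB; first exact: within_clamp.
  exact: prim_clamp_continuous Ff Fc x.
have cst := orthogonal_test_cst hc (bmeasB ub Fb) H.
split; [exact: ub|exact: fb|move=> x x01].
have i0 : 0 <= (0 : R) <= 1 by rewrite lexx ler01.
have := cst x x01; rewrite -(cst 0 i0) F0 subr0 => /eqP; rewrite subr_eq => /eqP ->.
by rewrite (FE x x01) F0 add0r.
Qed.

(** * Reciprocals and Gronwall's inequality *)

Lemma prim_le (R : realType) (F f : R -> R) (x y : R) : prim F f ->
  (forall t, x <= t <= y -> 0 <= f t) -> 0 <= x -> x <= y -> y <= 1 -> F x <= F y.
Proof.
by move=> Ff f0 x0 xy y1; rewrite -subr_ge0 (primE Ff) //; exact: intg_ge0.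
Qed.

Lemma prim_lower_bound (R : realType) (F f : R -> R) : prim F f ->
  (forall x, 0 <= x <= 1 -> 0 < F x) ->
  exists2 c, 0 < c & forall x, 0 <= x <= 1 -> c <= F x.
Proof.
move=> /prim_continuous Fc F0; have [a a01 aM] := EVT_min ler01 Fc.
by exists (F a); [apply: F0|move=> x x01; apply: aM]; move: a01 => //; rewrite in_itv.
Qed.

(** As for products, [1 / F] has the expected increment up to second order
    because [F] is Lipschitz and bounded away from [0]. *)
Lemma primV (R : realType) (F f : R -> R) (c : R) : prim F f -> 0 < c ->
  (forall x, c <= F x) -> prim (fun x => (F x)^-1) (fun x => - f x / F x ^+ 2).
Proof.
move=> Ff c0 Fc; have [Fb fb _] := Ff.
have [M M0 FM] := prim_lipschitz Ff.
have [A A0 FA] := bmeas_bound Fb; have [L L0 fL] := bmeas_bound fb.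
have F0 x : 0 < F x by exact: lt_le_trans (Fc x).
have Fi x : 0 <= (F x)^-1 <= c^-1 by rewrite invr_ge0 (ltW (F0 x)) lef_pV2 ?posrE ?F0 ?Fc.
have Vb : bmeas (fun x => (F x)^-1).
  apply: (@bmeasW _ _ c^-1); last by move=> x; have /andP[H1 H2] := Fi x; rewrite ger0_norm.
  have -> : (fun x => (F x)^-1) = (fun t => (Num.max c t)^-1) \o F.
    by apply/funext => x /=; rewrite (max_idPr (Fc x)).
  apply: measurableT_comp (Fb.1); apply: continuous_measurable_fun => x.
  apply: cvgV; first by rewrite gt_eqF // lt_max c0.
  apply: (@lipschitz_continuous _ _ 1) => {}x y; rewrite mul1r.
  rewrite ler_norml; have : - `|x - y| <= x - y <= `|x - y| by rewrite -ler_norml.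
  by have [?|?] := leP c x; have [?|?] := leP c y; lra.
have Wb : bmeas (fun x => - f x / F x ^+ 2).
  have -> : (fun x => - f x / F x ^+ 2) = (fun x => - f x * ((F x)^-1 * (F x)^-1)).
    by apply/funext => x; rewrite expr2 invfM //.
  by apply: bmeasM; [exact: bmeasN|exact: bmeasM].
apply: (@primW _ _ _ (L * (2 * A * M * (c^-1) ^+ 4))) => // x y x0 xy y1.
have -> : (F y)^-1 - (F x)^-1 = - ((F x)^-1 * (F y)^-1) * (F y - F x).
  by field; rewrite !gt_eqF.
rewrite (primE Ff) // -intgZ // -intgB //; last first.
  by apply: bmeasM => //; exact: bmeas_cst.
have -> : L * (2 * A * M * c^-1 ^+ 4) * (y - x) ^+ 2 =
  L * (2 * A * M * c^-1 ^+ 4 * (y - x)) * (y - x) by ring.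
apply: intg_norm_le => //.
  by apply: bmeasB => //; apply: bmeasM => //; exact: bmeas_cst.
move=> t /andP[xt ty].
have -> : - ((F x)^-1 * (F y)^-1) * f t - - f t / F t ^+ 2 =
   f t * ((F x * (F y - F t) + F t * (F x - F t)) *
     ((F t)^-1 ^+ 2 * ((F x)^-1 * (F y)^-1))).
  by field; rewrite !gt_eqF.
rewrite normrM; apply: ler_pM => //.
have -> : 2 * A * M * c^-1 ^+ 4 * (y - x) = (2 * A * M * (y - x)) * c^-1 ^+ 4 by ring.
rewrite normrM; apply: ler_pM => //.
  have H1 := FM t y (le_trans x0 xt) ty y1.
  have H2 := FM x t x0 xt (le_trans ty y1); rewrite distrC in H2.
  apply: le_trans (ler_normD _ _) _; rewrite !normrM.
  have -> : 2 * A * M * (y - x) = A * (M * (y - x)) + A * (M * (y - x)) by ring.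
  apply: lerD; apply: ler_pM => //.
    by apply: le_trans H1 _; apply: ler_wpM2l => //; lra.
  by apply: le_trans H2 _; apply: ler_wpM2l => //; lra.
have /andP[? ?] := Fi x; have /andP[? ?] := Fi y; have /andP[? ?] := Fi t.
have ci : 0 <= c^-1 by rewrite invr_ge0 ltW.
rewrite ger0_norm; last by rewrite !mulr_ge0 // exprn_ge0.
have -> : c^-1 ^+ 4 = c^-1 ^+ 2 * (c^-1 * c^-1) by ring.
apply: ler_pM; rewrite ?exprn_ge0 ?mulr_ge0 //; first by rewrite lerXn2r // nnegrE.
exact: ler_pM.
Qed.

Lemma is_derive_expR_scale (R : realType) (k s : R) :
  is_derive s 1 (fun t : R => expR (k * t)) (k * expR (k * s)).
Proof.
have H : is_derive s 1 (fun t : R => k * t) k.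
  have := is_deriveZ k (is_derive_id s (1 : R)); rewrite /GRing.scale /= mulr1; exact.
by have := is_derive1_comp (is_derive_expR (k * s)) H; rewrite /comp mulrC.
Qed.

Lemma continuous_expR_scale (R : realType) (k : R) : continuous (fun t : R => expR (k * t)).
Proof.
by move=> s; apply/differentiable_continuous/derivable1_diffP/(@ex_derive _ _ _ _ _ _ _ (is_derive_expR_scale k s)).
Qed.

Lemma prim_expR_scale (R : realType) (k : R) :
  prim (fun x : R => expR (k * clamp x)) (fun x => k * expR (k * clamp x)).
Proof.
apply: (@prim_C1 R (fun t => expR (k * t)) (fun t => k * expR (k * t))).
  by move=> s; apply: cvgM; [exact: cvg_cst|exact: continuous_expR_scale].
exact: is_derive_expR_scale.
Qed.

(** [e * exp (- K t)] decreases and [e * exp (K t)] increases, so a zero of [e]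
    propagates in both directions. *)
Lemma prim_gronwall (R : realType) (e e' : R -> R) (K x : R) : prim e e' ->
  (forall t, 0 <= e t) -> (forall t, `|e' t| <= K * e t) ->
  0 <= x <= 1 -> e x = 0 -> forall t, 0 <= t <= 1 -> e t = 0.
Proof.
move=> ee e0 eK /andP[x0 x1] ex t /andP[t0 t1].
have P k := primM ee (prim_expR_scale k).
have H (k : R) s : 0 <= s <= 1 -> e s * expR (k * clamp s) <= 0 -> e s = 0.
  move=> _; rewrite pmulr_lle0 ?expR_gt0 // => es.
  by apply/eqP; rewrite eq_le es e0.
have [tx|/ltW xt] := leP t x.
- apply: (H K); first by rewrite t0.
  have : e t * expR (K * clamp t) <= e x * expR (K * clamp x).
    apply: (prim_le (P K)) => // s _ /=.
    have := eK s; rewrite ler_norml => /andP[H1 _].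
    have := expR_gt0 (K * clamp s); nra.
  by rewrite ex mul0r.
- apply: (H (- K)); first by rewrite t0.
  have PN := primZ (-1) (P (- K)).
  have /= := prim_le PN (x := x) (y := t).
  rewrite !mulN1r ex mul0r oppr0 oppr_ge0; apply => // s _.
  have := eK s; rewrite ler_norml => /andP[_ H2].
  have := expR_gt0 (- K * clamp s); nra.
Qed.

(** * Complex-valued primitives *)

Lemma ReM (R : realType) (z w : R[i]) : Re (z * w) = Re z * Re w - Im z * Im w.
Proof. by case: z w => [a b] [c d]. Qed.

Lemma ImM (R : realType) (z w : R[i]) : Im (z * w) = Re z * Im w + Im z * Re w.
Proof. by case: z w => [a b] [c d]. Qed.

Lemma ReD (R : realType) (z w : R[i]) : Re (z + w) = Re z + Re w.
Proof. by case: z w => [a b] [c d]. Qed.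

Lemma ImD (R : realType) (z w : R[i]) : Im (z + w) = Im z + Im w.
Proof. by case: z w => [a b] [c d]. Qed.

Lemma ReN (R : realType) (z : R[i]) : Re (- z) = - Re z.
Proof. by case: z. Qed.

Lemma ImN (R : realType) (z : R[i]) : Im (- z) = - Im z.
Proof. by case: z. Qed.

Lemma ReV (R : realType) (z : R[i]) : Re z^-1 = Re z / (Re z ^+ 2 + Im z ^+ 2).
Proof. by case: z. Qed.

Lemma ImV (R : realType) (z : R[i]) : Im z^-1 = - Im z / (Re z ^+ 2 + Im z ^+ 2).
Proof. by case: z => a b /=; rewrite mulNr. Qed.

Lemma complexP (R : realType) (z w : R[i]) : Re z = Re w -> Im z = Im w -> z = w.
Proof. by case: z w => [a b] [c d] /= -> ->. Qed.

Definition ReImE := (ReM, ImM, ReD, ImD, ReN, ImN).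

(** The l^1 norm is used rather than the modulus: it takes real values, it is
    submultiplicative, and it passes under the componentwise integral with
    constant [1]. *)
Definition norm1 (R : realType) (z : R[i]) : R := `|Re z| + `|Im z|.

Lemma norm1_ge0 (R : realType) (z : R[i]) : 0 <= norm1 z.
Proof. by rewrite addr_ge0. Qed.

Lemma norm1_eq0 (R : realType) (z : R[i]) : norm1 z = 0 -> z = 0.
Proof.
case: z => a b; rewrite /norm1 /= => /eqP; rewrite paddr_eq0 // !normr_eq0.
by move=> /andP[/eqP-> /eqP->].
Qed.

Lemma norm10 (R : realType) : norm1 (0 : R[i]) = 0.
Proof. by rewrite /norm1 /= normr0 addr0. Qed.

Lemma norm11 (R : realType) : norm1 (1 : R[i]) = 1.
Proof. by rewrite /norm1 /= normr1 normr0 addr0. Qed.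

Lemma norm1_real (R : realType) (x : R) : norm1 x%:C = `|x|.
Proof. by rewrite /norm1 /= normr0 addr0. Qed.

Lemma norm1N (R : realType) (z : R[i]) : norm1 (- z) = norm1 z.
Proof. by rewrite /norm1 !ReImE !normrN. Qed.

Lemma norm1D (R : realType) (z w : R[i]) : norm1 (z + w) <= norm1 z + norm1 w.
Proof.
rewrite /norm1 !ReImE; have := ler_normD (Re z) (Re w); have := ler_normD (Im z) (Im w).
lra.
Qed.

Lemma norm1B (R : realType) (z w : R[i]) : norm1 (z - w) <= norm1 z + norm1 w.
Proof. by rewrite -(norm1N w); exact: norm1D. Qed.

Lemma norm1M (R : realType) (z w : R[i]) : norm1 (z * w) <= norm1 z * norm1 w.
Proof.
rewrite /norm1 !ReImE; have := ler_normD (Re z * Re w) (- (Im z * Im w)).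
have := ler_normD (Re z * Im w) (Im z * Re w); rewrite normrN !normrM; lra.
Qed.

Lemma norm1M_le (R : realType) (z w : R[i]) (a b : R) :
  norm1 z <= a -> norm1 w <= b -> norm1 (z * w) <= a * b.
Proof.
move=> za wb; apply: le_trans (norm1M _ _) _; apply: ler_pM => //; exact: norm1_ge0.
Qed.

Lemma norm1_scale (R : realType) (r : R) (z : R[i]) : norm1 (r%:C * z) = `|r| * norm1 z.
Proof. by rewrite /norm1 !ReImE /= !mul0r subr0 addr0 !normrM mulrDr. Qed.

Lemma norm1C (R : realType) (z w : R[i]) : norm1 (z - w) = norm1 (w - z).
Proof. by rewrite -norm1N opprB. Qed.

Definition cbmeas (R : realType) (f : R -> R[i]) : Prop :=
  bmeas (fun x => Re (f x)) /\ bmeas (fun x => Im (f x)).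

Definition cintg (R : realType) (a b : R) (f : R -> R[i]) : R[i] :=
  (intg a b (fun x => Re (f x))) +i* (intg a b (fun x => Im (f x))).

Definition cprim (R : realType) (F f : R -> R[i]) : Prop :=
  prim (fun x => Re (F x)) (fun x => Re (f x)) /\
  prim (fun x => Im (F x)) (fun x => Im (f x)).

Lemma eq_bmeas (R : realType) (f g : R -> R) : (forall x, f x = g x) ->
  bmeas f -> bmeas g.
Proof. by move=> /funext ->. Qed.

Lemma eq_prim_both (R : realType) (F f G g : R -> R) : (forall x, F x = G x) ->
  (forall x, f x = g x) -> prim F f -> prim G g.
Proof. by move=> /funext -> /funext ->. Qed.

Lemma cbmeas_cst (R : realType) (c : R[i]) : cbmeas (fun _ : R => c).
Proof. by split; exact: bmeas_cst. Qed.

Lemma cbmeasD (R : realType) (f g : R -> R[i]) : cbmeas f -> cbmeas g ->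
  cbmeas (fun x => f x + g x).
Proof.
move=> [f1 f2] [g1 g2]; split.
  by apply: eq_bmeas (bmeasD f1 g1) => x; rewrite !ReImE.
by apply: eq_bmeas (bmeasD f2 g2) => x; rewrite !ReImE.
Qed.

Lemma cbmeasN (R : realType) (f : R -> R[i]) : cbmeas f -> cbmeas (fun x => - f x).
Proof.
move=> [f1 f2]; split.
  by apply: eq_bmeas (bmeasN f1) => x; rewrite !ReImE.
by apply: eq_bmeas (bmeasN f2) => x; rewrite !ReImE.
Qed.

Lemma cbmeasB (R : realType) (f g : R -> R[i]) : cbmeas f -> cbmeas g ->
  cbmeas (fun x => f x - g x).
Proof. by move=> fb gb; exact: cbmeasD fb (cbmeasN gb). Qed.

Lemma cbmeasM (R : realType) (f g : R -> R[i]) : cbmeas f -> cbmeas g ->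
  cbmeas (fun x => f x * g x).
Proof.
move=> [f1 f2] [g1 g2]; split.
  by apply: eq_bmeas (bmeasB (bmeasM f1 g1) (bmeasM f2 g2)) => x; rewrite !ReImE.
by apply: eq_bmeas (bmeasD (bmeasM f1 g2) (bmeasM f2 g1)) => x; rewrite !ReImE.
Qed.

Lemma cbmeas_real (R : realType) (f : R -> R) : bmeas f -> cbmeas (fun x => (f x)%:C).
Proof. by move=> fb; split => //; exact: bmeas_cst. Qed.

Lemma cbmeas_bound (R : realType) (f : R -> R[i]) : cbmeas f ->
  exists2 M, 0 <= M & forall x, norm1 (f x) <= M.
Proof.
move=> [/bmeas_bound[M M0 fM] /bmeas_bound[L L0 fL]].
by exists (M + L); [exact: addr_ge0|move=> x; exact: lerD].
Qed.

Lemma cintgxx (R : realType) (a : R) (f : R -> R[i]) : cintg a a f = 0.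
Proof. by rewrite /cintg !intgxx. Qed.

Lemma cintgD (R : realType) (a b : R) (f g : R -> R[i]) : cbmeas f -> cbmeas g ->
  cintg a b (fun x => f x + g x) = cintg a b f + cintg a b g.
Proof.
move=> [f1 f2] [g1 g2]; apply: complexP; rewrite !ReImE /= -intgD //;
  by apply: eq_intg => x _; rewrite !ReImE.
Qed.

Lemma eq_cintg (R : realType) (a b : R) (f g : R -> R[i]) :
  (forall x, a <= x <= b -> f x = g x) -> cintg a b f = cintg a b g.
Proof. by move=> fg; rewrite /cintg; congr (_ +i* _); apply: eq_intg => x /fg ->. Qed.

Lemma cintgZ (R : realType) (a b : R) (c : R[i]) (f : R -> R[i]) : cbmeas f ->
  cintg a b (fun x => c * f x) = c * cintg a b f.
Proof.
move=> [f1 f2]; have Zb k h : bmeas h -> bmeas (fun x : R => k * h x).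
  by apply: bmeasM; exact: bmeas_cst.
apply: complexP; rewrite !ReImE /= -!intgZ //.
  by rewrite -intgB; [apply: eq_intg => x _; rewrite !ReImE|exact: Zb..].
by rewrite -intgD; [apply: eq_intg => x _; rewrite !ReImE|exact: Zb..].
Qed.

Lemma cintgB (R : realType) (a b : R) (f g : R -> R[i]) : cbmeas f -> cbmeas g ->
  cintg a b (fun x => f x - g x) = cintg a b f - cintg a b g.
Proof.
move=> fb gb; rewrite cintgD //; last exact: cbmeasN.
congr (_ + _); rewrite -mulN1r -cintgZ //; apply: eq_cintg => x _.
by rewrite mulN1r.
Qed.

Lemma cintg_norm_le (R : realType) (a b M : R) (f : R -> R[i]) : a <= b ->
  cbmeas f -> (forall x, a <= x <= b -> norm1 (f x) <= M) ->
  norm1 (cintg a b f) <= M * (b - a).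
Proof.
move=> ab [f1 f2] fM; rewrite /norm1 /=.
have nb h : bmeas h -> bmeas (fun x : R => `|h x|).
  move=> [mh [L hL]]; split; first exact: measurableT_comp.
  by exists L => x; rewrite normr_id.
have n_le h : bmeas h -> `|intg a b h| <= intg a b (fun x => `|h x|).
  move=> hb; rewrite ler_norml -intgN; last exact: nb.
  apply/andP; split; apply: intg_le => //; try exact: bmeasN (nb _ hb); try exact: nb.
    by move=> x _; rewrite lerNl -normrN ler_norm.
  by move=> x _; rewrite ler_norm.
apply: le_trans (lerD (n_le _ f1) (n_le _ f2)) _.
rewrite -intgD; [|exact: nb..].
rewrite -intg_cst //; apply: intg_le => //; last exact: bmeas_cst.
by apply: bmeasD; exact: nb.
Qed.

Lemma cintg_chasles (R : realType) (a b c : R) (f : R -> R[i]) : cbmeas f ->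
  a <= b -> b <= c -> cintg a c f = cintg a b f + cintg b c f.
Proof.
by move=> [f1 f2] ab bc; apply: complexP; rewrite !ReImE /=; exact: intg_chasles.
Qed.

Lemma cprimE (R : realType) (F f : R -> R[i]) (x y : R) : cprim F f ->
  0 <= x -> x <= y -> y <= 1 -> F y - F x = cintg x y f.
Proof.
by move=> [p1 p2] x0 xy y1; apply: complexP; rewrite !ReImE /=;
  [exact: (primE p1)|exact: (primE p2)].
Qed.

Lemma cprim_cbmeas (R : realType) (F f : R -> R[i]) : cprim F f -> cbmeas F /\ cbmeas f.
Proof. by move=> [[? ? _] [? ? _]]; split; split. Qed.

Lemma cprim_cst (R : realType) (c : R[i]) : cprim (fun _ : R => c) (fun=> 0).
Proof. by split; exact: prim_cst. Qed.

Lemma cprimD (R : realType) (F f G g : R -> R[i]) : cprim F f -> cprim G g ->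
  cprim (fun x => F x + G x) (fun x => f x + g x).
Proof.
move=> [p1 p2] [q1 q2]; split.
  by apply: eq_prim_both (primD p1 q1) => x; rewrite !ReImE.
by apply: eq_prim_both (primD p2 q2) => x; rewrite !ReImE.
Qed.

Lemma cprimM (R : realType) (F f G g : R -> R[i]) : cprim F f -> cprim G g ->
  cprim (fun x => F x * G x) (fun x => f x * G x + F x * g x).
Proof.
move=> [p1 p2] [q1 q2]; split.
  apply: eq_prim_both (primD (primM p1 q1) (primZ (-1) (primM p2 q2))) => x; rewrite !ReImE; ring.
apply: eq_prim_both (primD (primM p1 q2) (primM p2 q1)) => x; rewrite !ReImE; ring.
Qed.

Lemma eq_cprim (R : realType) (F f g : R -> R[i]) : (forall x, f x = g x) ->
  cprim F f -> cprim F g.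
Proof. by move=> /funext ->. Qed.

Lemma eq_cprim_both (R : realType) (F f G g : R -> R[i]) : (forall x, F x = G x) ->
  (forall x, f x = g x) -> cprim F f -> cprim G g.
Proof. by move=> /funext -> /funext ->. Qed.

Lemma cprimZ (R : realType) (c : R[i]) (F f : R -> R[i]) : cprim F f ->
  cprim (fun x => c * F x) (fun x => c * f x).
Proof.
move=> Ff; apply: eq_cprim (cprimM (cprim_cst c) Ff) => x.
by rewrite mul0r add0r.
Qed.

Lemma cprim_cintg (R : realType) (c : R[i]) (f : R -> R[i]) : cbmeas f ->
  cprim (fun x => c + cintg 0 (clamp x) f) f.
Proof.
move=> [f1 f2]; split.
  by apply: eq_prim_both (prim_intg (Re c) f1) => x //; rewrite !ReImE.
by apply: eq_prim_both (prim_intg (Im c) f2) => x //; rewrite !ReImE.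
Qed.

Lemma cbmeas_lipschitz (R : realType) (f : R -> R[i]) (L C : R) :
  (forall x y, norm1 (f x - f y) <= L * `|x - y|) -> (forall x, norm1 (f x) <= C) ->
  cbmeas f.
Proof.
move=> fL fC; split.
- apply: (@bmeasW _ _ C).
    apply: continuous_measurable_fun; apply: (@lipschitz_continuous _ _ L) => x y.
    apply: le_trans (fL x y); rewrite /norm1 !ReImE.
    by have := normr_ge0 (Im (f x) - Im (f y)); lra.
  by move=> x; apply: le_trans (fC x); rewrite /norm1 lerDl.
- apply: (@bmeasW _ _ C).
    apply: continuous_measurable_fun; apply: (@lipschitz_continuous _ _ L) => x y.
    apply: le_trans (fL x y); rewrite /norm1 !ReImE.
    by have := normr_ge0 (Re (f x) - Re (f y)); lra.
  by move=> x; apply: le_trans (fC x); rewrite /norm1 lerDr.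
Qed.

Lemma cintg_clamp_lipschitz (R : realType) (f : R -> R[i]) (L : R) : cbmeas f ->
  (forall x, norm1 (f x) <= L) ->
  forall x y, norm1 (cintg 0 (clamp x) f - cintg 0 (clamp y) f) <= L * `|x - y|.
Proof.
move=> fb fL; have L0 : 0 <= L by exact: le_trans (norm1_ge0 _) (fL 0).
have H x y : clamp x <= clamp y ->
    norm1 (cintg 0 (clamp x) f - cintg 0 (clamp y) f) <= L * `|x - y|.
  move=> xy; rewrite (cintg_chasles fb (clamp_ge0 x) xy) opprD addrA subrr sub0r norm1N.
  apply: le_trans (cintg_norm_le xy fb (fun t _ => fL t)) _; apply: ler_wpM2l => //.
  rewrite distrC; apply: le_trans (clamp_lipschitz _ _); exact: ler_norm.
move=> x y; have [xy|/ltW yx] := leP (clamp x) (clamp y); first exact: H.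
by rewrite norm1C distrC; exact: H.
Qed.

Lemma cintg_clamp_norm (R : realType) (f : R -> R[i]) (L : R) : cbmeas f ->
  (forall x, norm1 (f x) <= L) -> forall x, norm1 (cintg 0 (clamp x) f) <= L.
Proof.
move=> fb fL x; have L0 : 0 <= L by exact: le_trans (norm1_ge0 _) (fL 0).
apply: le_trans (cintg_norm_le (clamp_ge0 x) fb (fun t _ => fL t)) _.
by rewrite subr0 ler_piMr // clamp_le1.
Qed.

Lemma cintg01_norm (R : realType) (f : R -> R[i]) (L : R) : cbmeas f ->
  (forall x, norm1 (f x) <= L) -> norm1 (cintg 0 1 f) <= L.
Proof.
move=> fb fL; have := cintg_clamp_norm fb fL 1.
by rewrite clampE // lexx ler01.
Qed.

Definition sqmod (R : realType) (z : R[i]) : R := Re z ^+ 2 + Im z ^+ 2.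

Lemma sqmod_ge0 (R : realType) (z : R[i]) : 0 <= sqmod z.
Proof. by rewrite addr_ge0 ?sqr_ge0. Qed.

Lemma sqmod_gt0 (R : realType) (z : R[i]) : z != 0 -> 0 < sqmod z.
Proof.
case: z => a b; rewrite eq_complex /= negb_and /sqmod /= => /orP[?|?].
  by rewrite ltr_wpDr ?sqr_ge0 // exprn_even_gt0.
by rewrite ltr_wpDl ?sqr_ge0 // exprn_even_gt0.
Qed.

Lemma norm1V_le (R : realType) (z : R[i]) : z != 0 -> norm1 z^-1 <= 2 / norm1 z.
Proof.
move=> z0; have s0 := sqmod_gt0 z0.
have n0 : 0 < norm1 z.
  by rewrite lt_neqAle norm1_ge0 andbT eq_sym; apply: contra_neq z0; exact: norm1_eq0.
rewrite ler_pdivlMr //.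
have -> : norm1 z^-1 = norm1 z / sqmod z.
  case: z z0 s0 n0 => a b _ s0 _; rewrite /norm1 /sqmod /= normrN !normrM -mulrDl.
  by congr (_ * _); rewrite ger0_norm // ltW // invr_gt0.
rewrite mulrAC ler_pdivrMr // /norm1 /sqmod.
have n2 (v : R) : v ^+ 2 = `|v| ^+ 2 by rewrite real_normK // num_real.
rewrite (n2 (Re z)) (n2 (Im z)).
by have := sqr_ge0 (`|Re z| - `|Im z|); lra.
Qed.

Lemma bmeas_sqmod (R : realType) (y : R -> R[i]) : cbmeas y -> bmeas (fun x => sqmod (y x)).
Proof.
move=> [y1 y2]; apply: eq_bmeas (bmeasD (bmeasM y1 y1) (bmeasM y2 y2)) => x.
by rewrite /sqmod !expr2.
Qed.

Lemma prim_sqmod (R : realType) (F f : R -> R[i]) : cprim F f ->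
  prim (fun x => sqmod (F x)) (fun x => 2 * (Re (F x) * Re (f x) + Im (F x) * Im (f x))).
Proof.
move=> [p1 p2]; apply: eq_prim_both (primD (primM p1 p1) (primM p2 p2)) => x.
  by rewrite /sqmod !expr2.
ring.
Qed.

(** [1 / F] is the conjugate of [F] divided by the real function [|F| ^ 2]. *)
Lemma cprimV (R : realType) (F f : R -> R[i]) : cprim F f ->
  (forall x, F (clamp x) = F x) -> (forall x, F x != 0) ->
  cprim (fun x => (F x)^-1) (fun x => - f x / F x ^+ 2).
Proof.
move=> Ff Fc F0; have p := prim_sqmod Ff.
have [c c0 cF] := prim_lower_bound p (fun x _ => sqmod_gt0 (F0 x)).
have cF' x : c <= sqmod (F x) by rewrite -Fc; apply: cF; exact: clamp01.
have q := primV p c0 cF'; have [p1 p2] := Ff.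
have s0 x : Re (F x) ^+ 2 + Im (F x) ^+ 2 != 0 by rewrite gt_eqF // sqmod_gt0.
split.
- apply: eq_prim_both (primM p1 q) => x; first by rewrite ReV.
  rewrite (expr2 (F x)) [(F x * F x)^-1]invfM !ReImE !ReV !ImV /sqmod; field; exact: s0.
- apply: eq_prim_both (primM (primZ (-1) p2) q) => x; first by rewrite ImV mulN1r.
  rewrite (expr2 (F x)) [(F x * F x)^-1]invfM !ReImE !ReV !ImV /sqmod; field; exact: s0.
Qed.

(** * Solutions of the differential equation *)

(** The integrated form of [y'' + kappa ^ 2 B y = 0]. *)
Definition is_solution (R : realType) (kappa : R[i]) (B : R -> R) (y dy : R -> R[i]) : Prop :=
  cprim y dy /\ cprim dy (fun x => - (kappa ^+ 2 * (B x)%:C * y x)).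

Lemma solution_quasi_eigenvalue (R : realType) (kappa : R[i]) (B : R -> R)
    (y dy : R -> R[i]) : kappa != 0 -> is_solution kappa B y dy ->
  dy 0 = 0 -> y 1 - 'i%C * dy 1 / kappa = 0 ->
  (exists2 x, 0 <= x <= 1 & y x != 0) -> quasi_eigenvalues B kappa.
Proof.
move=> k0 [ydy dyddy] dy0 bc yn0; split=> //.
exists y, dy, (fun x => - (kappa ^+ 2 * (B x)%:C * y x)); split => //.
- have [p1 p2] := ydy; have [q1 q2] := dyddy; split; split.
  + exact: (prim_continuous p1).
  + exact: (prim_continuous p2).
  + exact: (prim_continuous q1).
  + exact: (prim_continuous q2).
  + exact: (prim_sobolev p1).
  + exact: (prim_sobolev p2).
  + exact: (prim_sobolev q1).
  + exact: (prim_sobolev q2).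
- by apply: aeW => x _; rewrite addNr.
Qed.

Lemma quasi_eigenvalue_solution (R : realType) (kappa : R[i]) (B B' : R -> R) :
  quasi_eigenvalues B kappa -> bmeas B' ->
  {ae lebesgue_measure, forall x : R, 0 < x < 1 -> B x = B' x} ->
  kappa != 0 /\ exists y dy : R -> R[i],
   [/\ is_solution kappa B' y dy, exists2 x, 0 <= x <= 1 & y x != 0,
     dy 0 = 0, y 1 - 'i%C * dy 1 / kappa = 0 &
     forall x, y (clamp x) = y x /\ dy (clamp x) = dy x].
Proof.
move=> [k0 [y [dy [ddy [[yc dyc [w1 w2] [w3 w4]] [x x01 yx] eqn dy0 bc]]]]] Bb BB'.
split => //; have cc (t : R) : clamp (clamp t) = clamp t by rewrite clampE // clamp01.
have c01 (u : R -> R) : {ae lebesgue_measure, forall x : R, 0 < x < 1 -> u x = u (clamp x)}.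
  by apply: aeW => t /andP[t0 t1]; rewrite clampE // !ltW.
have [yc1 yc2] := yc; have [dyc1 dyc2] := dyc.
have p : cprim (y \o @clamp R) (dy \o @clamp R).
  by split; [apply: (sobolev_prim yc1 w1 (bmeas_clamp dyc1))|apply: (sobolev_prim yc2 w2 (bmeas_clamp dyc2))].
have [yb dyb] := cprim_cbmeas p.
have fb : cbmeas (fun t => - (kappa ^+ 2 * (B' t)%:C * y (clamp t))).
  apply/cbmeasN/cbmeasM => //; apply: cbmeasM; first exact: cbmeas_cst.
  exact: cbmeas_real.
have E : {ae lebesgue_measure, forall t : R, 0 < t < 1 ->
    ddy t = - (kappa ^+ 2 * (B' t)%:C * y (clamp t))}.
  apply: (ae_imp2 eqn BB') => t H1 H2 t01.
  have /andP[t0 t1] := t01; rewrite -H2 // clampE ?(ltW t0) ?(ltW t1) //.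
  by apply/eqP; rewrite -addr_eq0 H1.
have q : cprim (dy \o @clamp R) (fun t => - (kappa ^+ 2 * (B' t)%:C * y (clamp t))).
  have [fb1 fb2] := fb.
  by split; [apply: (sobolev_prim dyc1 w3 fb1)|apply: (sobolev_prim dyc2 w4 fb2)];
    apply: (ae_imp E) => t H /H ->.
exists (y \o @clamp R), (dy \o @clamp R); split.
- by split.
- by exists x => //=; rewrite clampE.
- by rewrite /= clampE // lexx ler01.
- by rewrite /= clampE // lexx ler01.
- by move=> t /=; rewrite cc.
Qed.

(** The energy [|y| ^ 2 + |y'| ^ 2] satisfies Gronwall's inequality in both
    directions, so vanishing Cauchy data at any point force [y = 0]. *)
Lemma solution_unique (R : realType) (kappa : R[i]) (B : R -> R)
    (y dy : R -> R[i]) (x : R) : bmeas B -> is_solution kappa B y dy ->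
  0 <= x <= 1 -> y x = 0 -> dy x = 0 -> forall t, 0 <= t <= 1 -> y t = 0.
Proof.
move=> Bb [p q] x01 yx dyx t t01.
have [M M0 BM] := bmeas_bound Bb.
have E := primD (prim_sqmod p) (prim_sqmod q).
pose r := Re (kappa ^+ 2); pose s := Im (kappa ^+ 2).
pose L := (`|r| + `|s|) * M.
have H u : `|Re (kappa ^+ 2 * (B u)%:C * y u)| <= L * (`|Re (y u)| + `|Im (y u)|) /\
           `|Im (kappa ^+ 2 * (B u)%:C * y u)| <= L * (`|Re (y u)| + `|Im (y u)|).
  have k : norm1 (kappa ^+ 2 * (B u)%:C * y u) <= L * norm1 (y u).
    apply: le_trans (norm1M _ _) _; apply: ler_wpM2r; first exact: norm1_ge0.
    apply: le_trans (norm1M _ _) _; rewrite norm1_real /L; apply: ler_wpM2l => //.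
    exact: norm1_ge0.
  by move: k; rewrite /norm1; have := normr_ge0 (Re (kappa ^+ 2 * (B u)%:C * y u));
    have := normr_ge0 (Im (kappa ^+ 2 * (B u)%:C * y u)); lra.
have L0 : 0 <= L by rewrite mulr_ge0 // addr_ge0.
have key u : `|2 * (Re (y u) * Re (dy u) + Im (y u) * Im (dy u)) +
   2 * (Re (dy u) * Re (- (kappa ^+ 2 * (B u)%:C * y u)) +
        Im (dy u) * Im (- (kappa ^+ 2 * (B u)%:C * y u)))| <=
   (1 + 4 * L) * (sqmod (y u) + sqmod (dy u)).
  have [] := H u; rewrite !ReN !ImN /sqmod.
  move: (Re (kappa ^+ 2 * _ * _)) (Im (kappa ^+ 2 * _ * _)) => R1 R2.
  move: (Re (y u)) (Im (y u)) (Re (dy u)) (Im (dy u)) => a b a' b' h1 h2.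
  have n2 (v : R) : v ^+ 2 = `|v| ^+ 2 by rewrite real_normK // num_real.
  have k1 : `|2 * (a * a' + b * b') + 2 * (a' * - R1 + b' * - R2)| <=
     2 * (`|a| * `|a'| + `|b| * `|b'|) + 2 * (`|a'| * `|R1| + `|b'| * `|R2|).
    rewrite -(normrN R1) -(normrN R2) -!normrM.
    have := ler_normD (2 * (a * a' + b * b')) (2 * (a' * - R1 + b' * - R2)).
    have := ler_normD (a * a') (b * b'); have := ler_normD (a' * - R1) (b' * - R2).
    rewrite !(normrM 2) (ger0_norm (ler0n _ _)); lra.
  apply: le_trans k1 _; rewrite (n2 a) (n2 b) (n2 a') (n2 b').
  move: (normr_ge0 a) (normr_ge0 b) (normr_ge0 a') (normr_ge0 b') (normr_ge0 R1) (normr_ge0 R2) h1 h2.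
  move: `|a| `|b| `|a'| `|b'| `|R1| `|R2| => {}a {}b {}a' {}b' {}R1 {}R2 a0 b0 a0' b0' r1 r2 h1 h2.
  have s1 : a' * R1 <= a' * (L * (a + b)) by apply: ler_wpM2l.
  have s2 : b' * R2 <= b' * (L * (a + b)) by apply: ler_wpM2l.
  have s3 : 2 * (a' * (a + b) + b' * (a + b)) <= 4 * (a ^+ 2 + b ^+ 2 + (a' ^+ 2 + b' ^+ 2)).
    by have := sqr_ge0 (a - a'); have := sqr_ge0 (b - b'); have := sqr_ge0 (a - b');
      have := sqr_ge0 (b - a'); have := sqr_ge0 a; nra.
  have s4 := ler_wpM2l L0 s3.
  have := sqr_ge0 (a - a'); have := sqr_ge0 (b - b'); lra.
have pos u : 0 <= sqmod (y u) + sqmod (dy u) by rewrite addr_ge0 ?sqmod_ge0.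
have := prim_gronwall E pos key x01; rewrite yx dyx {1 2}/sqmod /= !expr0n /= !addr0.
move=> /(_ erefl _ t01) e0; apply/eqP; apply: contraT => yt.
by have := sqmod_gt0 yt; have := sqmod_ge0 (dy t); lra.
Qed.

(** * Momentum and decay rate *)

Lemma outgoing_conditionE (R : realType) (kappa y dy : R[i]) : kappa != 0 ->
  (y - 'i%C * dy / kappa = 0) <-> (dy = - ('i%C * kappa * y)).
Proof.
move=> k0; have ii : 'i%C * 'i%C = -1 :> R[i] by rewrite -expr2 sqr_i.
split => [/eqP|->].
  rewrite subr_eq0 => /eqP ->.
  have -> : - ('i%C * kappa * ('i%C * dy / kappa)) = - ('i%C * 'i%C) * dy by field.
  by rewrite ii opprK mul1r.
have -> : y - 'i%C * - ('i%C * kappa * y) / kappa = y + ('i%C * 'i%C) * y by field.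
by rewrite ii mulN1r subrr.
Qed.

(** In the derivative of [Im (conj y * y')] the term [|y'| ^ 2] is real and
    drops out, and [y''] contributes [- Im (kappa ^ 2) B |y| ^ 2]. *)
Lemma prim_momentum (R : realType) (kappa : R[i]) (B : R -> R) (y dy : R -> R[i]) :
  is_solution kappa B y dy ->
  prim (fun x => Re (y x) * Im (dy x) - Im (y x) * Re (dy x))
    (fun x => - Im (kappa ^+ 2) * (B x * sqmod (y x))).
Proof.
move=> [[p1 p2] [q1 q2]].
apply: eq_prim_both (primD (primM p1 q2) (primZ (-1) (primM p2 q1))) => x.
  by rewrite mulN1r.
move: (kappa ^+ 2) => k; rewrite !ReImE /sqmod /=; ring.
Qed.

Lemma momentumE (R : realType) (kappa : R[i]) (B : R -> R) (y dy : R -> R[i]) (x : R) :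
  bmeas B -> is_solution kappa B y dy -> dy 0 = 0 -> 0 <= x <= 1 ->
  Re (y x) * Im (dy x) - Im (y x) * Re (dy x) =
  - Im (kappa ^+ 2) * intg 0 x (fun t => B t * sqmod (y t)).
Proof.
move=> Bb sol dy0 x01; have [_ _ /(_ x x01) ->] := prim_momentum sol.
have [yb _] := cprim_cbmeas (proj1 sol).
rewrite dy0 /= !mulr0 subrr add0r intgZ //.
by apply: bmeasM => //; exact: bmeas_sqmod.
Qed.

(** Where [y] vanishes the momentum vanishes too, so [B |y| ^ 2 = 0] to the left
    of that point.  There [y'' = 0] and [y' = 0], so [y] is constant up to its
    zero and has zero Cauchy data at [0]. *)
Lemma solution_nonvanishing (R : realType) (kappa : R[i]) (B : R -> R)
    (y dy : R -> R[i]) (x : R) :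
  bmeas B -> (forall t, 0 <= B t) -> is_solution kappa B y dy -> dy 0 = 0 ->
  Im (kappa ^+ 2) != 0 -> 0 <= x <= 1 -> y x = 0 ->
  forall t, 0 <= t <= 1 -> y t = 0.
Proof.
move=> Bb B0 sol dy0 k0 /[dup] x01 /andP[x0 x1] yx t t01.
have [yb dyb] := cprim_cbmeas (proj1 sol); have [_ fb] := cprim_cbmeas (proj2 sol).
have Bsb : bmeas (fun t => B t * sqmod (y t)).
  by apply: bmeasM => //; exact: bmeas_sqmod.
have := momentumE Bb sol dy0 x01.
rewrite yx /= !mul0r subrr => /esym/eqP; rewrite mulf_eq0 oppr_eq0 (negbTE k0) /=.
move=> /eqP I0.
have {I0} ae0 : {ae lebesgue_measure, forall s : R, 0 < s < x -> B s * sqmod (y s) = 0}.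
  by apply: intg_ge0_eq0 => // s _; rewrite mulr_ge0 // sqmod_ge0.
have dyE s : 0 <= s <= x -> dy s = 0.
  move=> /andP[s0 sx].
  have := cprimE (proj2 sol) (lexx 0) s0 (le_trans sx x1).
  rewrite dy0 subr0 => ->.
  have Isub (f : R -> R) : bmeas f -> {ae lebesgue_measure, forall t : R, 0 < t < x -> f t = 0} ->
      intg 0 s f = 0.
    move=> fb' f0.
    have chib : bmeas (fun t => if t < x then 0 else f t).
      have [L L0 fL] := bmeas_bound fb'.
      apply: (@bmeasW _ _ L); last by move=> u; case: ifP => // _; rewrite normr0.
      apply: measurable_fun_ifT => //; last exact: fb'.1.
      by apply: measurable_fun_ltr => //; exact: measurable_cst.
    rewrite (@intg_ae_eq _ 0 s f (fun t => if t < x then 0 else f t)) //.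
    - have [sx'|xs] := ltP s x.
        transitivity (intg 0 s (fun _ : R => 0)); last by rewrite intg_cst // mul0r.
        by apply: eq_intg => u /andP[_ us]; rewrite (le_lt_trans us sx').
      rewrite intg_open //.
      transitivity (\int[lebesgue_measure]_(t in (`]0, s[ : set R)) (fun _ : R => 0) t).
        apply: eq_Rintegral => u; rewrite inE /= in_itv /= => /andP[_ us].
        by rewrite (lt_le_trans us sx).
      by rewrite -intg_open ?intg_cst ?mul0r //; exact: bmeas_cst.
    - exact: le_trans sx x1.
    - by apply: (ae_imp f0) => u fu /andP[u0 _]; case: ifP => // ux; rewrite fu // u0.
  have ae1 : {ae lebesgue_measure, forall s : R, 0 < s < x ->
      - (kappa ^+ 2 * (B s)%:C * y s) = 0}.
    apply: (ae_imp ae0) => u H /H /eqP; rewrite mulf_eq0 => /orP[/eqP ->|].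
      by rewrite mulr0 mul0r oppr0.
    move=> /eqP yu; suff -> : y u = 0 by rewrite mulr0 oppr0.
    by apply/eqP; apply: contraT => /sqmod_gt0; rewrite yu ltxx.
  have [fb1 fb2] := fb.
  by rewrite /cintg !Isub //; apply: (ae_imp ae1) => u H /H ->.
have y0E : y 0 = 0.
  have := cprimE (proj1 sol) (lexx 0) x0 x1; rewrite yx.
  rewrite (@eq_cintg _ 0 x _ (fun=> 0)); last by move=> u u01; rewrite dyE.
  by rewrite /cintg /= !intg_cst // !mul0r sub0r => /eqP; rewrite oppr_eq0 => /eqP.
by apply: (solution_unique Bb sol _ y0E dy0) => //; rewrite lexx ler01.
Qed.

(** At [x = 1] the outgoing condition makes the momentum equal to
    [- alpha |y 1| ^ 2]; comparison with [- 2 alpha beta] times the integral of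
    [B |y| ^ 2] gives the sign of [beta]. *)
Lemma decay_rate_gt0 (R : realType) (alpha beta : R) (B : R -> R)
    (y dy : R -> R[i]) :
  bmeas B -> (forall t, 0 <= B t) -> is_solution (alpha +i* beta) B y dy ->
  dy 0 = 0 -> dy 1 = - ('i%C * (alpha +i* beta) * y 1) -> alpha != 0 ->
  (exists2 x, 0 <= x <= 1 & y x != 0) ->
  0 < beta /\ forall x, 0 <= x <= 1 -> y x != 0.
Proof.
move=> Bb B0 sol dy0 dy1 a0 [x0 x001 yx0].
have i11 : 0 <= (1 : R) <= 1 by rewrite ler01 lexx.
have y1 : y 1 != 0.
  apply: contra_neq yx0 => y1; apply: (solution_unique Bb sol i11 y1 _ x001).
  by rewrite dy1 y1 mulr0 oppr0.
have E := momentumE Bb sol dy0 i11.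
have I0 : 0 <= intg 0 1 (fun t => B t * sqmod (y t)).
  by apply: intg_ge0 => t _; rewrite mulr_ge0 // sqmod_ge0.
have b0 : 0 < beta.
  have s1 := sqmod_gt0 y1; move: E.
  have -> : Re (y 1) * Im (dy 1) - Im (y 1) * Re (dy 1) = - alpha * sqmod (y 1).
    rewrite dy1 !ReImE /sqmod /=; ring.
  have -> : Im ((alpha +i* beta) ^+ 2) = 2 * alpha * beta by rewrite expr2 !ReImE /=; ring.
  move=> E.
  have E2 : sqmod (y 1) = 2 * beta * intg 0 1 (fun t => B t * sqmod (y t)).
    by apply: (mulfI (x := - alpha)); [rewrite oppr_eq0|rewrite E; ring].
  rewrite ltNge; apply/negP => b0; move: s1; rewrite E2 ltNge; apply/negP/negPn.
  by rewrite mulr_le0_ge0 // pmulr_rle0.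
split=> // x x01; apply: contra_neq yx0 => yx.
apply: (solution_nonvanishing Bb B0 sol dy0 _ x01 yx x001).
have -> : Im ((alpha +i* beta) ^+ 2) = 2 * alpha * beta by rewrite expr2 !ReImE /=; ring.
by rewrite !mulf_neq0 // gt_eqF.
Qed.

(** * A contraction principle *)

Lemma nested_limit (R : realType) (a b : nat -> R) :
  (forall n m, a n <= b m) -> exists r, forall n, a n <= r <= b n.
Proof.
move=> ab; exists (sup (range a)) => n.
have ha : has_sup (range a).
  by split; [exists (a 0%N), 0%N|exists (b 0%N) => _ [m _ <-]].
apply/andP; split; first by apply: sup_upper_bound => //; exists n.
by apply: ge_sup; [case: ha|move=> _ [m _ <-]].
Qed.

(** Banach's principle for the sup distance.  Functions need not be bounded:
    a bound on the first displacement makes all later distances finite. *)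
Lemma contraction_fixpoint (R : realType) (T : Type) (t0 : T) (S : (T -> R[i]) -> Prop)
    (Phi : (T -> R[i]) -> T -> R[i]) (u0 : T -> R[i]) (M : R) :
  (forall (u : nat -> T -> R[i]) v, (forall n, S (u n)) ->
     (forall e, 0 < e -> exists n, forall t, norm1 (u n t - v t) <= e) -> S v) ->
  (forall u, S u -> S (Phi u)) -> S u0 ->
  (forall t, norm1 (Phi u0 t - u0 t) <= M) ->
  (forall u v d, S u -> S v -> (forall t, norm1 (u t - v t) <= d) ->
     forall t, norm1 (Phi u t - Phi v t) <= d / 2) ->
  exists2 u, S u & forall t, Phi u t = u t.
Proof.
move=> Scl SPhi Su0 PhiM contr.
pose u n := iter n Phi u0.
have Su n : S (u n) by elim: n => //= n IH; exact: SPhi.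
have p2 n : 0 < 2 ^+ n :> R by rewrite exprn_gt0.
(* the displacements halve at each step, so [Re (u n t)] and [Im (u n t)]
   have nested intervals of radius [2 * M / 2 ^ n] around them *)
have step n t : norm1 (u n.+1 t - u n t) <= M / 2 ^+ n.
  elim: n t => [|n IH] t; first by rewrite expr0 divr1; exact: PhiM.
  have := contr _ _ _ (Su n.+1) (Su n) IH t.
  by rewrite exprS invfM mulrCA mulrC mulrA.
have M0 : 0 <= M by exact: le_trans (norm1_ge0 _) (PhiM t0).
have far n m t : norm1 (u (n + m)%N t - u n t) <= 2 * M / 2 ^+ n - 2 * M / 2 ^+ (n + m).
  elim: m => [|m IH]; first by rewrite addn0 !subrr norm10.
  rewrite addnS.
  have -> : u (n + m).+1 t - u n t = (u (n + m).+1 t - u (n + m)%N t) + (u (n + m)%N t - u n t).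
    by rewrite addrA subrK.
  apply: le_trans (norm1D _ _) _.
  have := step (n + m)%N t; have -> : 2 * M / 2 ^+ (n + m).+1 = M / 2 ^+ (n + m).
    by rewrite exprS; field; rewrite gt_eqF.
  move: IH; have -> : 2 * M / 2 ^+ (n + m) = M / 2 ^+ (n + m) * 2 by ring.
  move: (2 * M / _) (M / _) => A W h1 h2; apply: le_trans (lerD h2 h1) _; lra.
have close n m t : norm1 (u m t - u n t) <= 2 * M / 2 ^+ n + 2 * M / 2 ^+ m.
  have q k : 0 <= 2 * M / 2 ^+ k by rewrite divr_ge0 ?(ltW (p2 k)) // mulr_ge0 // M0.
  have [nm|/ltnW mn] := leqP n m.
    have := far n (m - n)%N t; rewrite subnKC //; have := q m; lra.
  have := far m (n - m)%N t; rewrite subnKC // -norm1N opprB; have := q n; lra.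
have lim1 (f : R[i] -> R) t : (forall z w, `|f z - f w| <= norm1 (z - w)) ->
    exists r, forall n, `|f (u n t) - r| <= 2 * M / 2 ^+ n.
  move=> fN; have [|r Hr] := @nested_limit R (fun n => f (u n t) - 2 * M / 2 ^+ n)
    (fun n => f (u n t) + 2 * M / 2 ^+ n).
    move=> n m; have := le_trans (fN (u n t) (u m t)) (close m n t).
    by rewrite ler_norml => /andP[]; lra.
  by exists r => n; have /andP[] := Hr n; rewrite ler_norml; lra.
have ReN1 (z w : R[i]) : `|Re z - Re w| <= norm1 (z - w).
  by rewrite /norm1 !ReImE; have := normr_ge0 (Im z - Im w); lra.
have ImN1 (z w : R[i]) : `|Im z - Im w| <= norm1 (z - w).
  by rewrite /norm1 !ReImE; have := normr_ge0 (Re z - Re w); lra.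
have [v Hv] : exists v : T -> R[i], forall t n, norm1 (u n t - v t) <= 4 * M / 2 ^+ n.
  have H t : exists z : R[i], forall n, norm1 (u n t - z) <= 4 * M / 2 ^+ n.
    have [r Hr] := lim1 _ t ReN1; have [s Hs] := lim1 _ t ImN1.
    exists (r +i* s) => n; have := Hr n; have := Hs n; rewrite /norm1 !ReImE /=.
    have -> : 4 * M / 2 ^+ n = 2 * M / 2 ^+ n + 2 * M / 2 ^+ n by ring.
    lra.
  by exists (fun t => projT1 (cid (H t))) => t; exact: projT2 (cid (H t)).
have small e : 0 < e -> exists n, 4 * M / 2 ^+ n <= e.
  move=> e0; exists (Num.truncn (4 * M / e)).+1.
  rewrite ler_pdivrMr // -ler_pdivrMl // mulrC.
  apply: le_trans (ltW (truncnS_gt _)) _.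
  by rewrite -natrX ler_nat ltnW // ltn_expl.
have Sv : S v.
  apply: (Scl u) => // e /small[n Hn]; exists n => t; exact: le_trans (Hv t n) Hn.
exists v => // t; apply/eqP; rewrite -subr_eq0; apply/eqP/norm1_eq0/eqP.
rewrite eq_le norm1_ge0 andbT; apply/ler_addgt0Pr => e e0; rewrite add0r.
have [n Hn] := small (e / 2) ltac:(by rewrite divr_gt0).
have vu s : norm1 (v s - u n s) <= e / 2.
  by rewrite -norm1N opprB; exact: le_trans (Hv s n) Hn.
have h1 := contr _ _ _ Sv (Su n) vu t.
have h2 : norm1 (u n.+1 t - v t) <= e / 2.
  apply: le_trans (Hv t n.+1) _; apply: le_trans Hn.
  have q : 0 <= 4 * M / 2 ^+ n by rewrite divr_ge0 ?(ltW (p2 n)) // mulr_ge0 // M0.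
  rewrite exprS invfM; move: q; lra.
have -> : Phi v t - v t = (Phi v t - Phi (u n) t) + (u n.+1 t - v t) by rewrite addrA subrK.
apply: le_trans (norm1D _ _) _; lra.
Qed.

(** * Perturbation of quasi-eigenvalues *)

(** Here [y2 = y ^ 2] and [w2 = 1 / y ^ 2], [p] is the quotient of the perturbed
    eigenfunction by [y], and [z] parametrises the variation [V z] of [B].  The
    first equation is the differential equation for [p]; the second one
    expresses the boundary condition, solved for [z] by means of the first
    variation.  The right-hand sides are iterated on the pair [(p, M z)] in the
    sup distance: a large [M] makes the effect of [z] on [p] contractive, and
    then [p] close to [1] and small coefficients make the effect of [p] on [z]
    contractive. *)
Lemma perturbed_system (R : realType) (y2 w2 : R -> R[i]) (B : R -> R)
    (V : R[i] -> R -> R) (Y Bm v K e : R) :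
  cbmeas y2 -> cbmeas w2 -> bmeas B -> (forall z, bmeas (V z)) ->
  1 <= Y -> (forall x, norm1 (y2 x) <= Y) -> (forall x, norm1 (w2 x) <= Y) ->
  0 <= Bm -> (forall x, `|B x| <= Bm) -> 1 <= v ->
  (forall z w x, `|V z x - V w x| <= v * norm1 (z - w)) ->
  (forall x, V 0 x = 0) -> 1 <= K -> 0 < e <= 1 ->
  exists2 eps : R, 0 < eps & forall c1 c2 c3 c4 : R[i], norm1 c1 <= eps ->
    norm1 c2 <= K -> norm1 c3 <= eps -> norm1 c4 <= eps ->
  exists (p : R -> R[i]) (z : R[i]),
  [/\ cbmeas p, norm1 z <= e,
    forall x, p x = 1 - cintg 0 (clamp x) (fun s => w2 s *
       cintg 0 (clamp s) (fun t => y2 t * (c1 * (B t)%:C + c2 * (V z t)%:C) * p t)) &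
    z = c3 * p 1 + c4 * cintg 0 1 (fun t => y2 t * (B t)%:C * p t)
      - cintg 0 1 (fun t => y2 t * (V z t)%:C * (p t - 1))].
Proof.
move=> y2b w2b Bb Vb Y1 y2Y w2Y Bm0 BBm v1 Vlip V0 K1 /andP[e0 e1].
have Y0 : 0 < Y by exact: lt_le_trans Y1.
have v0 : 0 < v by exact: lt_le_trans v1.
have K0 : 0 < K by exact: lt_le_trans K1.
(* [rho] bounds the distance of [p] to [1], its Lipschitz constant and [M z];
   [M] makes [Y ^ 2 * K * v / M = 1 / 16]; [eps = rho / D] then makes each term
   with a small coefficient at most a fixed fraction of [rho] *)
pose rho := Num.min e (12 * Y * v)^-1.
have r0 : 0 < rho by rewrite lt_min e0 invr_gt0 !mulr_gt0.
have re : rho <= e by rewrite ge_min lexx.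
have r12 : 12 * Y * v * rho <= 1.
  have : rho <= (12 * Y * v)^-1 by rewrite ge_min lexx orbT.
  by rewrite -(ler_pM2l (x := 12 * Y * v)) ?mulr_gt0 // divff // gt_eqF // !mulr_gt0.
pose M := 16 * Y ^+ 2 * K * v.
have M0 : 0 < M by rewrite !mulr_gt0 // exprn_gt0.
have M1 : 1 <= M.
  have Y2 : 1 <= Y ^+ 2 by rewrite exprn_ege1.
  have h1 : 1 <= Y ^+ 2 * K by rewrite -[1]mulr1 ler_pM.
  have h2 : 1 <= Y ^+ 2 * K * v by rewrite -[1]mulr1 ler_pM.
  have -> : M = 16 * (Y ^+ 2 * K * v) by rewrite /M; ring.
  lra.
pose D := 8 * M * (2 + 2 * Y * Bm) + 8 * Y ^+ 2 * Bm + 1.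
have YB0 : 0 <= Y * Bm by rewrite mulr_ge0 // ltW.
have Y2B0 : 0 <= Y ^+ 2 * Bm by rewrite mulr_ge0 // exprn_ge0 // ltW.
have D0 : 0 < D.
  have h : 0 <= M * (2 + 2 * Y * Bm) by rewrite mulr_ge0 ?ltW //; lra.
  by rewrite /D; lra.
pose eps := rho / D.
have eps0 : 0 < eps by rewrite divr_gt0.
have De : D * eps = rho by rewrite /eps mulrCA divff ?mulr1 // gt_eqF.
have YB1 : 0 < 1 + Y * Bm by lra.
have E0 : 0 <= M * (1 + Y * Bm) * eps by apply: mulr_ge0; [apply: mulr_ge0|]; exact: ltW.
have E0' : 0 <= Y ^+ 2 * Bm * eps by apply: mulr_ge0 => //; exact: ltW.
have DeE : 16 * (M * (1 + Y * Bm) * eps) + 8 * (Y ^+ 2 * Bm * eps) + eps = rho.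
  by rewrite -De /D; ring.
have E1 : 8 * (Y ^+ 2 * Bm * eps) <= rho by lra.
have E2 : 16 * (M * (1 + Y * Bm) * eps) <= rho by lra.
exists eps => // c1 c2 c3 c4 c1e c2K c3e c4e.
pose G := eps * Bm + K * (v * (rho / M)).
have HK : Y ^+ 2 * (K * (v / M)) = 1 / 16.
  by rewrite /M; field; rewrite ?gt_eqF ?(mulr_gt0, exprn_gt0).
have HG : Y ^+ 2 * G <= rho / 4.
  have -> : Y ^+ 2 * G = Y ^+ 2 * Bm * eps + Y ^+ 2 * (K * (v / M)) * rho by rewrite /G; ring.
  by rewrite HK; lra.
clear DeE De; clearbody eps M rho.
have q0 : 0 <= rho / M by rewrite divr_ge0 // ltW.
have G0 : 0 <= G.
  have h1 : 0 <= eps * Bm by rewrite mulr_ge0 // ltW.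
  have h2 : 0 <= v * (rho / M) by rewrite mulr_ge0 // ltW.
  have h3 : 0 <= K * (v * (rho / M)) by rewrite mulr_ge0 // ltW.
  exact: addr_ge0.
have r1 : rho <= 1 by exact: le_trans re e1.
pose z (u : option R -> R[i]) : R[i] := (M^-1)%:C * u None.
pose p (u : option R -> R[i]) (x : R) : R[i] := u (Some x).
pose g u t : R[i] := c1 * (B t)%:C + c2 * (V (z u) t)%:C.
pose J u x := cintg 0 (clamp x) (fun t => y2 t * g u t * p u t).
pose Z u := c3 * p u 1 + c4 * cintg 0 1 (fun t => y2 t * (B t)%:C * p u t)
      - cintg 0 1 (fun t => y2 t * (V (z u) t)%:C * (p u t - 1)).
pose Phi u (o : option R) : R[i] :=
  if o is Some x then 1 - cintg 0 (clamp x) (fun s => w2 s * J u s) else M%:C * Z u.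
(* one function on [option R] codes the pair: [Some x] carries [p x] and
   [None] carries [M z] *)
pose S (u : option R -> R[i]) := [/\ norm1 (u None) <= rho,
  forall x, norm1 (p u x - 1) <= rho &
  forall x x', norm1 (p u x - p u x') <= rho * `|x - x'|].
have zE u u' d : norm1 (u None - u' None) <= d -> norm1 (z u - z u') <= d / M.
  move=> ud; rewrite /z -mulrBr norm1_scale gtr0_norm ?invr_gt0 // mulrC.
  by rewrite ler_pM2r // invr_gt0.
have Vz u x : norm1 (u None) <= rho -> norm1 (V (z u) x)%:C <= v * (rho / M).
  move=> ur; rewrite norm1_real; have := Vlip (z u) 0 x; rewrite V0 !subr0 => /le_trans; apply.
  apply: ler_wpM2l; first exact: ltW.
  by rewrite /z norm1_scale gtr0_norm ?invr_gt0 // mulrC ler_pM2r // invr_gt0.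
have Sp u x : S u -> norm1 (p u x) <= 2.
  move=> [_ /(_ x) h _]; have -> : p u x = (p u x - 1) + 1 by rewrite subrK.
  apply: le_trans (norm1D _ _) _; rewrite norm11; clear -h r1; lra.
have pb u : S u -> cbmeas (p u).
  by move=> Su; have [_ _ h] := Su; apply: cbmeas_lipschitz h (fun x => Sp u x Su).
have BC := cbmeas_real Bb; have VC w := cbmeas_real (Vb w).
have gb u : cbmeas (g u).
  by apply: cbmeasD; apply: cbmeasM => //; exact: cbmeas_cst.
have gG u x : S u -> norm1 (g u x) <= G.
  move=> [ur _ _]; apply: le_trans (norm1D _ _) _; apply: lerD; apply: norm1M_le => //.
    by rewrite norm1_real.
  exact: Vz.
have ib u : S u -> cbmeas (fun t => y2 t * g u t * p u t).
  by move=> Su; exact: (cbmeasM (cbmeasM y2b (gb u)) (pb u Su)).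
have JG u x : S u -> norm1 (J u x) <= Y * G * 2.
  move=> Su; apply: cintg_clamp_norm; first exact: ib.
  by move=> t; apply: norm1M_le; [apply: norm1M_le => //; exact: gG|exact: Sp].
have Jb u : S u -> cbmeas (J u).
  move=> Su; apply: (@cbmeas_lipschitz _ _ (Y * G * 2) (Y * G * 2)); last by move=> x; exact: JG.
  apply: cintg_clamp_lipschitz; first exact: ib.
  by move=> t; apply: norm1M_le; [apply: norm1M_le => //; exact: gG|exact: Sp].
have qb u : S u -> cbmeas (fun s => w2 s * J u s).
  by move=> Su; exact: (cbmeasM w2b (Jb u Su)).
have qr u x : S u -> norm1 (w2 x * J u x) <= rho.
  move=> Su; apply: le_trans (norm1M_le (w2Y x) (JG u x Su)) _.
  have -> : Y * (Y * G * 2) = 2 * (Y ^+ 2 * G) by ring.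
  clear -HG r0; lra.
have yVb u u' : S u' -> cbmeas (fun t => y2 t * (V (z u) t)%:C * (p u' t - 1)).
  move=> Su; exact: (cbmeasM (cbmeasM y2b (VC (z u))) (cbmeasB (pb u' Su) (cbmeas_cst 1))).
have yBb u : S u -> cbmeas (fun t => y2 t * (B t)%:C * p u t).
  by move=> Su; exact: (cbmeasM (cbmeasM y2b BC) (pb u Su)).
have yB x : norm1 (y2 x * (B x)%:C) <= Y * Bm.
  by apply: norm1M_le => //; rewrite norm1_real.
have SPhi u : S u -> S (Phi u).
  move=> Su; have [ur pr plip] := Su; split.
  - rewrite /Phi norm1_scale gtr0_norm //.
    have h : norm1 (Z u) <= eps * 2 + eps * (Y * Bm * 2) + Y * (v * (rho / M)) * rho.
      apply: le_trans (norm1B _ _) _; apply: lerD; first apply: le_trans (norm1D _ _) _.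
        apply: lerD; apply: norm1M_le => //; first exact: Sp.
        apply: cintg01_norm; first exact: yBb.
        by move=> x; apply: norm1M_le => //; exact: Sp.
      apply: cintg01_norm; first exact: yVb.
      by move=> x; apply: norm1M_le => //; apply: norm1M_le => //; exact: Vz.
    apply: le_trans (ler_wpM2l (ltW M0) h) _.
    have -> : M * (eps * 2 + eps * (Y * Bm * 2) + Y * (v * (rho / M)) * rho) =
       2 * (M * (1 + Y * Bm) * eps) + (12 * Y * v * rho) * rho / 12.
      by field; rewrite gt_eqF.
    have : 12 * Y * v * rho * rho <= 1 * rho by rewrite ler_pM2r.
    clear -E2 r0; lra.
  - move=> x; rewrite /p /Phi addrAC subrr sub0r norm1N.
    by apply: cintg_clamp_norm; [exact: qb|move=> t; exact: qr].
  - move=> x x'; rewrite /p /Phi.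
    have -> (a b : R[i]) : 1 - a - (1 - b) = - (a - b) by ring.
    rewrite norm1N; apply: cintg_clamp_lipschitz; first exact: qb.
    by move=> t; exact: qr.
have contr u u' d : S u -> S u' -> (forall o, norm1 (u o - u' o) <= d) ->
    forall o, norm1 (Phi u o - Phi u' o) <= d / 2.
  move=> Su Su' ud.
  have [ur pr plip] := Su; have [ur' pr' plip'] := Su'.
  have d0 : 0 <= d by exact: le_trans (norm1_ge0 _) (ud None).
  have Vd x : norm1 ((V (z u) x)%:C - (V (z u') x)%:C) <= v * (d / M).
    rewrite -rmorphB /= norm1_real; apply: le_trans (Vlip _ _ _) _.
    by apply: ler_wpM2l; [exact: ltW|apply: zE; exact: ud].
  have pd x : norm1 (p u x - p u' x) <= d by exact: ud.
  case=> [x|] /=.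
  - have id t : norm1 (y2 t * g u t * p u t - y2 t * g u' t * p u' t) <=
        Y * (G * d + K * (v * (d / M)) * 2).
      have -> : y2 t * g u t * p u t - y2 t * g u' t * p u' t =
         y2 t * (g u t * (p u t - p u' t) + c2 * ((V (z u) t)%:C - (V (z u') t)%:C) * p u' t).
        by rewrite /g; ring.
      apply: norm1M_le => //; apply: le_trans (norm1D _ _) _; apply: lerD.
        by apply: norm1M_le => //; exact: gG.
      by apply: norm1M_le; [exact: norm1M_le|exact: Sp].
    have Jd s : norm1 (J u s - J u' s) <= Y * (G * d + K * (v * (d / M)) * 2).
      rewrite /J -cintgB; [|exact: ib..].
      exact: (cintg_clamp_norm (cbmeasB (ib u Su) (ib u' Su')) id).
    have -> (a b : R[i]) : 1 - a - (1 - b) = - (a - b) by ring.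
    rewrite norm1N -cintgB; [|exact: qb..].
    apply: le_trans (_ : Y * (Y * (G * d + K * (v * (d / M)) * 2)) <= _).
      apply: cintg_clamp_norm; first by apply: cbmeasB; exact: qb.
      by move=> s; rewrite -mulrBr; apply: norm1M_le.
    have -> : Y * (Y * (G * d + K * (v * (d / M)) * 2)) =
      Y ^+ 2 * G * d + 2 * (Y ^+ 2 * (K * (v / M))) * d by ring.
    rewrite HK; have := ler_wpM2r d0 HG; have : rho * d <= 1 * d by apply: ler_wpM2r.
    clear -d0; lra.
  - rewrite -mulrBr norm1_scale gtr0_norm //.
    have -> : Z u - Z u' = c3 * (p u 1 - p u' 1) +
        c4 * cintg 0 1 (fun t => y2 t * (B t)%:C * (p u t - p u' t))
        - cintg 0 1 (fun t => y2 t * (((V (z u) t)%:C - (V (z u') t)%:C) * (p u t - 1)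
            + (V (z u') t)%:C * (p u t - p u' t))).
      have -> : cintg 0 1 (fun t => y2 t * (B t)%:C * (p u t - p u' t)) =
          cintg 0 1 (fun t => y2 t * (B t)%:C * p u t) - cintg 0 1 (fun t => y2 t * (B t)%:C * p u' t).
        by rewrite -cintgB; [apply: eq_cintg => t _; ring|exact: yBb..].
      have -> : cintg 0 1 (fun t => y2 t * (((V (z u) t)%:C - (V (z u') t)%:C) * (p u t - 1)
            + (V (z u') t)%:C * (p u t - p u' t))) =
          cintg 0 1 (fun t => y2 t * (V (z u) t)%:C * (p u t - 1)) -
          cintg 0 1 (fun t => y2 t * (V (z u') t)%:C * (p u' t - 1)).
        by rewrite -cintgB; [apply: eq_cintg => t _; ring|exact: yVb..].
      rewrite /Z; ring.
    have h : norm1 (c3 * (p u 1 - p u' 1) +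
        c4 * cintg 0 1 (fun t => y2 t * (B t)%:C * (p u t - p u' t))
        - cintg 0 1 (fun t => y2 t * (((V (z u) t)%:C - (V (z u') t)%:C) * (p u t - 1)
            + (V (z u') t)%:C * (p u t - p u' t)))) <=
        eps * d + eps * (Y * Bm * d) + Y * (v * (d / M) * rho + v * (rho / M) * d).
      apply: le_trans (norm1B _ _) _; apply: lerD; first apply: le_trans (norm1D _ _) _.
        apply: lerD; apply: norm1M_le => //.
        apply: cintg01_norm; last by move=> x; exact: norm1M_le.
        exact: (cbmeasM (cbmeasM y2b BC) (cbmeasB (pb u Su) (pb u' Su'))).
      apply: cintg01_norm.
        have h1 := cbmeasM (cbmeasB (VC (z u)) (VC (z u'))) (cbmeasB (pb u Su) (cbmeas_cst 1)).
        have h2 := cbmeasM (VC (z u')) (cbmeasB (pb u Su) (pb u' Su')).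
        exact: (cbmeasM y2b (cbmeasD h1 h2)).
      move=> x; apply: norm1M_le => //; apply: le_trans (norm1D _ _) _; apply: lerD.
        exact: norm1M_le.
      by apply: norm1M_le => //; exact: Vz.
    apply: le_trans (ler_wpM2l (ltW M0) h) _.
    have -> : M * (eps * d + eps * (Y * Bm * d) + Y * (v * (d / M) * rho + v * (rho / M) * d)) =
       (M * (1 + Y * Bm) * eps) * d + (12 * Y * v * rho) * d / 6.
      by field; rewrite gt_eqF.
    have h1 := ler_wpM2r d0 r12.
    have h2 := ler_wpM2r d0 E2.
    have h3 : rho * d <= 1 * d by apply: ler_wpM2r.
    clear -h1 h2 h3 d0; lra.
have Scl (u : nat -> option R -> R[i]) w : (forall n, S (u n)) ->
     (forall e, 0 < e -> exists n, forall t, norm1 (u n t - w t) <= e) -> S w.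
  move=> Su uw; split.
  - apply/ler_addgt0Pr => r rp; have [n Hn] := uw r rp.
    have -> : w None = u n None - (u n None - w None) by rewrite opprB addrC subrK.
    apply: le_trans (norm1B _ _) _; apply: lerD => //; by case: (Su n).
  - move=> x; apply/ler_addgt0Pr => r rp; have [n Hn] := uw r rp.
    have -> : p w x - 1 = (p (u n) x - 1) - (u n (Some x) - w (Some x)).
      by rewrite /p; ring.
    apply: le_trans (norm1B _ _) _; apply: lerD => //; by case: (Su n).
  - move=> x x'; apply/ler_addgt0Pr => r rp.
    have [n Hn] := uw (r / 2) ltac:(by rewrite divr_gt0).
    have -> : p w x - p w x' = (p (u n) x - p (u n) x') -
       ((u n (Some x) - w (Some x)) - (u n (Some x') - w (Some x'))).
      by rewrite /p; ring.
    apply: le_trans (norm1B _ _) _; apply: lerD; first by case: (Su n).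
    apply: le_trans (norm1B _ _) _; have := Hn (Some x); have := Hn (Some x'); clear -rp; lra.
pose u0 (o : option R) : R[i] := if o is Some _ then 1 else 0.
have Su0 : S u0.
  split=> [|x|x x']; rewrite /p /= ?subrr norm10; [exact: ltW|exact: ltW|].
  by apply: mulr_ge0 => //; exact: ltW.
have [u Su Pu] : exists2 u, S u & forall t, Phi u t = u t.
  apply: (@contraction_fixpoint _ _ None _ _ u0 (rho + rho)) => // o.
  have [h1 h2 _] := SPhi _ Su0; have [k1 k2 _] := Su0.
  apply: le_trans (_ : norm1 (Phi u0 o - (if o is Some _ then 1 else 0)) <= _) => //.
  have rr : rho <= rho + rho by rewrite lerDl ltW.
  case: o => [x|]; last by rewrite subr0; exact: le_trans h1 rr.
  exact: le_trans (h2 x) rr.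
exists (p u), (z u); split.
- exact: pb.
- have [ur _ _] := Su; rewrite /z norm1_scale gtr0_norm ?invr_gt0 //.
  apply: le_trans re; apply: le_trans ur; rewrite ler_piMl ?norm1_ge0 //.
  by rewrite invf_le1.
- by move=> x; rewrite {1}/p -Pu.
- by rewrite {1}/z -Pu /= mulrA -rmorphM /= mulVf ?gt_eqF // mul1r.
Qed.

(** Reduction of order: [y p] solves the equation at [kappa + k] for [B + Vz]
    when [(y ^ 2 p')' = - y ^ 2 g p], where [g] is the increment of
    [kappa ^ 2 B].  The quantity [J = - y ^ 2 p'] must then take the
    value [i k y(1) ^ 2 p(1)] at [1] for [y p] to be outgoing. *)
Lemma solution_perturbation (R : realType) (kappa k z : R[i]) (B : R -> R)
    (y dy p : R -> R[i]) (Vz : R -> R) :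
  bmeas B -> bmeas Vz -> cbmeas p -> is_solution kappa B y dy -> dy 0 = 0 ->
  dy 1 = - ('i%C * kappa * y 1) ->
  (forall x, y (clamp x) = y x) -> (forall x, y x != 0) -> kappa + k != 0 ->
  cintg 0 1 (fun t => y t ^+ 2 * (Vz t)%:C) = z ->
  (forall x, p x = 1 - cintg 0 (clamp x) (fun s => (y s)^-1 ^+ 2 *
     cintg 0 (clamp s) (fun t => y t ^+ 2 * (((kappa + k) ^+ 2 - kappa ^+ 2) * (B t)%:C
        + (kappa + k) ^+ 2 * (Vz t)%:C) * p t))) ->
  (kappa + k) ^+ 2 * z = 'i%C * k * y 1 ^+ 2 * p 1
     - ((kappa + k) ^+ 2 - kappa ^+ 2) * cintg 0 1 (fun t => y t ^+ 2 * (B t)%:C * p t)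
     - (kappa + k) ^+ 2 * cintg 0 1 (fun t => y t ^+ 2 * (Vz t)%:C * (p t - 1)) ->
  quasi_eigenvalues (fun x => B x + Vz x) (kappa + k).
Proof.
move=> Bb Vb pb sol dy0 dy1 yc y0 k0 zE pE zeq.
set K2 := (kappa + k) ^+ 2 in pE zeq; set c1 := K2 - kappa ^+ 2 in pE zeq.
have [Hy Hdy] := sol; have [yb dyb] := cprim_cbmeas Hy.
have BC := cbmeas_real Bb; have VC := cbmeas_real Vb.
have Hyi := cprimV Hy yc y0; have [yib _] := cprim_cbmeas Hyi.
have y2b : cbmeas (fun t => y t ^+ 2) by exact: (cbmeasM yb yb).
have w2b : cbmeas (fun t => (y t)^-1 ^+ 2) by exact: (cbmeasM yib yib).
pose f t := y t ^+ 2 * (c1 * (B t)%:C + K2 * (Vz t)%:C) * p t.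
have fb : cbmeas f.
  have cb c V : cbmeas V -> cbmeas (fun t : R => c * V t : R[i]).
    by apply: cbmeasM; exact: cbmeas_cst.
  exact: (cbmeasM (cbmeasM y2b (cbmeasD (cb c1 _ BC) (cb K2 _ VC))) pb).
pose J s := cintg 0 (clamp s) f.
have HJ : cprim J f.
  have := cprim_cintg 0 fb; congr cprim; apply/funext => s; exact: add0r.
have [Jb _] := cprim_cbmeas HJ.
have wJb := cbmeasM w2b Jb.
have qb : cbmeas (fun s => - ((y s)^-1 ^+ 2 * J s)) by exact: cbmeasN.
have Hp : cprim p (fun s => - ((y s)^-1 ^+ 2 * J s)).
  have := cprim_cintg 1 qb; congr cprim; apply/funext => s; rewrite pE; congr (_ + _).
  rewrite -mulN1r -(cintgZ _ _ _ wJb).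
  by apply: eq_cintg => t _; rewrite mulN1r.
have cl0 : clamp 0 = 0 :> R by rewrite clampE // lexx ler01.
have cl1 : clamp 1 = 1 :> R by rewrite clampE // lexx ler01.
have J0 : J 0 = 0 by rewrite /J cl0 cintgxx.
have J1 : J 1 = 'i%C * k * y 1 ^+ 2 * p 1.
  have yBb : cbmeas (fun t => y t ^+ 2 * (B t)%:C * p t).
    exact: (cbmeasM (cbmeasM y2b BC) pb).
  have yVb : cbmeas (fun t => y t ^+ 2 * (Vz t)%:C) by exact: (cbmeasM y2b VC).
  have yVpb : cbmeas (fun t => y t ^+ 2 * (Vz t)%:C * (p t - 1)).
    exact: (cbmeasM yVb (cbmeasB pb (cbmeas_cst 1))).
  have cb c h : cbmeas h -> cbmeas (fun t : R => c * h t : R[i]).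
    by apply: cbmeasM; exact: cbmeas_cst.
  rewrite /J cl1; transitivity (c1 * cintg 0 1 (fun t => y t ^+ 2 * (B t)%:C * p t) +
      (K2 * cintg 0 1 (fun t => y t ^+ 2 * (Vz t)%:C) +
       K2 * cintg 0 1 (fun t => y t ^+ 2 * (Vz t)%:C * (p t - 1)))); last first.
    rewrite zE zeq; ring.
  rewrite -(cintgZ _ _ c1 yBb) -(cintgZ _ _ K2 yVb) -(cintgZ _ _ K2 yVpb).
  rewrite -(cintgD 0 1 (cb K2 _ yVb) (cb K2 _ yVpb)).
  rewrite -(cintgD 0 1 (cb c1 _ yBb) (cbmeasD (cb K2 _ yVb) (cb K2 _ yVpb))).
  by apply: eq_cintg => t _; rewrite /f; ring.
apply: (@solution_quasi_eigenvalue _ _ _ (fun x => y x * p x)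
   (fun x => dy x * p x - (y x)^-1 * J x)); first exact: k0.
- split.
    by apply: eq_cprim (cprimM Hy Hp) => x; field; exact: y0.
  apply: eq_cprim_both (cprimD (cprimM Hdy Hp) (cprimZ (-1) (cprimM Hyi HJ))) => x.
    by rewrite mulN1r.
  rewrite /f /c1 /K2 rmorphD /=; field; exact: y0.
- by rewrite dy0 J0 mul0r mulr0 subrr.
- apply/(outgoing_conditionE _ _ k0); rewrite J1 dy1; field; exact: y0.
- by exists 0; rewrite ?lexx ?ler01 // pE cl0 cintgxx subr0 mulr1.
Qed.

(** The family [V] is a Lipschitz right inverse of the first variation
    [V |-> int y ^ 2 V]; given one, the boundary condition can be met at every
    frequency near [kappa] with a small variation. *)
Lemma quasi_eigenvalue_perturbation (R : realType) (kappa : R[i]) (B : R -> R)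
    (y dy : R -> R[i]) (V : R[i] -> R -> R) (v e : R) :
  kappa != 0 -> bmeas B -> is_solution kappa B y dy -> dy 0 = 0 ->
  dy 1 = - ('i%C * kappa * y 1) ->
  (forall x, y (clamp x) = y x) -> (forall x, y x != 0) ->
  (forall z, bmeas (V z)) ->
  (forall z w x, `|V z x - V w x| <= v * norm1 (z - w)) ->
  (forall x, V 0 x = 0) ->
  (forall z, cintg 0 1 (fun t => y t ^+ 2 * (V z t)%:C) = z) -> 0 < e <= 1 ->
  exists2 eta : R, 0 < eta & forall k, norm1 k <= eta ->
    exists2 z, norm1 z <= e & quasi_eigenvalues (fun x => B x + V z x) (kappa + k).
Proof.
move=> k0 Bb sol dy0 dy1 yc y0 Vb Vlip V0 Vz e01.
have [Hy Hdy] := sol; have [yb dyb] := cprim_cbmeas Hy.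
have [yib _] := cprim_cbmeas (cprimV Hy yc y0).
have y2b : cbmeas (fun t => y t ^+ 2) by exact: (cbmeasM yb yb).
have w2b : cbmeas (fun t => (y t)^-1 ^+ 2) by exact: (cbmeasM yib yib).
have [Y1 Y10 y2Y1] := cbmeas_bound y2b; have [Y2 Y20 w2Y2] := cbmeas_bound w2b.
have [Bm Bm0 BBm] := bmeas_bound Bb.
pose n := norm1 kappa.
have n0 : 0 < n.
  by rewrite lt_neqAle norm1_ge0 andbT eq_sym; apply: contra_neq k0; exact: norm1_eq0.
pose Y := Y1 + Y2 + 1; pose v' := `|v| + 1; pose K := (n + 1) ^+ 2.
have [] := @perturbed_system R _ _ B V Y Bm v' K e y2b w2b Bb Vb _ _ _ Bm0 BBm _ _ V0 _ e01.
- by rewrite /Y; lra.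
- by move=> x; apply: le_trans (y2Y1 x) _; rewrite /Y; lra.
- by move=> x; apply: le_trans (w2Y2 x) _; rewrite /Y; lra.
- by rewrite /v' lerDr.
- move=> z w x; apply: le_trans (Vlip z w x) _; apply: ler_wpM2r; first exact: norm1_ge0.
  by rewrite /v'; have := ler_norm v; lra.
- by rewrite /K exprn_ege1 // lerDr ltW.
move=> eps eps0 H.
pose L := 4 / n; have L0 : 0 < L by rewrite divr_gt0.
pose D := L ^+ 2 * Y + L ^+ 2 * (2 * n + 1) + (2 * n + 1).
have Y0 : 0 < Y by rewrite /Y; lra.
have L2 : 0 < L ^+ 2 by rewrite exprn_gt0.
have LY : 0 < L ^+ 2 * Y by exact: mulr_gt0.
have n21 : 0 < 2 * n + 1 by lra.
have Ln : 0 < L ^+ 2 * (2 * n + 1) by exact: mulr_gt0.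
have D0 : 0 < D by rewrite /D; lra.
pose eta := Num.min (Num.min 1 (n / 2)) (eps / D).
have eta1 : eta <= 1 by rewrite !ge_min lexx.
have etan : eta <= n / 2 by rewrite !ge_min lexx orbT.
have etaD : eta * D <= eps.
  have : eta <= eps / D by rewrite ge_min lexx orbT.
  by rewrite ler_pdivlMr.
have eta0 : 0 < eta by rewrite !lt_min ltr01 !divr_gt0.
exists eta => // k keta.
have kn : n / 2 <= norm1 (kappa + k).
  have := norm1B (kappa + k) k; rewrite addrK -/n; lra.
have kk0 : kappa + k != 0.
  by apply/eqP => E; move: kn; rewrite E norm10; lra.
have kVL : norm1 (kappa + k)^-1 <= L.
  apply: le_trans (norm1V_le kk0) _; rewrite /L.
  have kp : 0 < norm1 (kappa + k) by lra.
  rewrite ler_pdivrMr // mulrAC ler_pdivlMr //; lra.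
have ksum : norm1 (kappa + k) <= n + 1 by apply: le_trans (norm1D _ _) _; rewrite -/n; lra.
have ksum2 : norm1 (2 * kappa + k) <= 2 * n + 1.
  have -> : 2 * kappa + k = kappa + (kappa + k) by ring.
  by apply: le_trans (norm1D _ _) _; rewrite -/n; lra.
have ki : norm1 ('i%C : R[i]) <= 1 by rewrite /norm1 /= normr0 normr1 add0r.
have kV2 : norm1 ((kappa + k)^-1 ^+ 2) <= L ^+ 2 by rewrite !expr2; exact: norm1M_le.
have [||||p [z [pb ze pE zE]]] := H ((kappa + k) ^+ 2 - kappa ^+ 2) ((kappa + k) ^+ 2)
   ((kappa + k)^-1 ^+ 2 * ('i%C * k * y 1 ^+ 2))
   (- ((kappa + k)^-1 ^+ 2 * (k * (2 * kappa + k)))).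
- have -> : (kappa + k) ^+ 2 - kappa ^+ 2 = k * (2 * kappa + k) by ring.
  apply: le_trans (norm1M_le keta ksum2) _; apply: le_trans etaD.
  by apply: ler_wpM2l; [exact: ltW|rewrite /D; lra].
- by rewrite /K !expr2; exact: norm1M_le.
- have h : norm1 (y 1 ^+ 2) <= Y by apply: le_trans (y2Y1 1) _; rewrite /Y; lra.
  apply: le_trans (norm1M_le kV2 (norm1M_le (norm1M_le ki keta) h)) _.
  have -> : L ^+ 2 * (1 * eta * Y) = eta * (L ^+ 2 * Y) by ring.
  apply: le_trans etaD; apply: ler_wpM2l; [exact: ltW|rewrite /D; lra].
- rewrite norm1N; apply: le_trans (norm1M_le kV2 (norm1M_le keta ksum2)) _.
  have -> : L ^+ 2 * (eta * (2 * n + 1)) = eta * (L ^+ 2 * (2 * n + 1)) by ring.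
  apply: le_trans etaD; apply: ler_wpM2l; [exact: ltW|rewrite /D; lra].
exists z => //.
apply: (@solution_perturbation _ kappa k z B y dy p (V z)) => //.
rewrite {1}zE.
move: (cintg _ _ _) (cintg _ _ _) => I1 I2; field; exact: kk0.
Qed.

(** * Convex cones in the plane *)

(** If the cone misses the open first quadrant, adding a point of the second
    quadrant to a multiple of one of the fourth shows that the slopes [y / -x]
    of the former are bounded by the slopes [- y / x] of the latter; the
    infimum of the latter is the coefficient of a separating line. *)
Lemma quadrant_or_separated (R : realType) (C : R -> R -> Prop) :
  (forall x y x' y', C x y -> C x' y' -> C (x + x') (y + y')) ->
  (forall c x y, 0 < c -> C x y -> C (c * x) (c * y)) ->
  (exists x y, [/\ C x y, 0 < x & 0 < y]) \/
  (exists a b, (a, b) != (0, 0) /\ forall x y, C x y -> a * x + b * y <= 0).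
Proof.
move=> CD CZ; case: (pselect (exists x y, [/\ C x y, 0 < x & 0 < y])) => [|nq]; first by left.
right.
have nC x y : C x y -> 0 < x -> y <= 0.
  by move=> Cxy x0; rewrite leNgt; apply/negP => y0; apply: nq; exists x, y.
case: (pselect (exists x y, C x y /\ 0 < x)) => [[x1 [y1 [C1 x10]]]|nx]; last first.
  exists 1, 0; split; first by rewrite xpair_eqE oner_eq0.
  move=> x y Cxy; rewrite mul1r mul0r addr0 leNgt; apply/negP => x0; apply: nx.
  by exists x, y.
pose T := [set t : R | exists x y, [/\ C x y, 0 < x & t = - y / x]].
have T0 t : T t -> 0 <= t.
  by move=> [x [y [Cxy x0 ->]]]; rewrite divr_ge0 ?(ltW x0) // oppr_ge0 (nC x).
have hT : has_inf T.
  by split; [exists (- y1 / x1), x1, y1|exists 0 => t /T0].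
exists (inf T), 1; split; first by rewrite xpair_eqE oner_eq0 andbF.
move=> x y Cxy; rewrite mul1r.
have [x0|x0] := ltP 0 x.
  have : inf T <= - y / x by apply: ge_inf; [case: hT|exists x, y].
  rewrite ler_pdivlMr //; lra.
have [y0|y0] := leP y 0.
  have : 0 <= inf T by apply: lb_le_inf; [case: hT|move=> t /T0].
  nra.
(* otherwise [r] strictly between the two slopes puts [(x2, y2) + r (x, y)] in
   the first quadrant *)
have key x2 y2 : C x2 y2 -> 0 < x2 -> x2 * y <= x * y2.
  move=> C2 x20; rewrite leNgt; apply/negP => lt2.
  have y20 := nC _ _ C2 x20.
  have [r [r0 rx ry]] : exists r, [/\ 0 < r, 0 < x2 + r * x & 0 < y2 + r * y].
    have [x00|x00] := eqVneq x 0.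
      exists ((1 - y2) / y); split; first by rewrite divr_gt0 //; lra.
        by rewrite x00 mulr0 addr0.
      rewrite divfK ?gt_eqF //; lra.
    have xn : x < 0 by rewrite lt_neqAle x00.
    exists ((- y2 / y + x2 / - x) / 2); split.
    - rewrite divr_gt0 // ltr_wpDl ?divr_gt0 ?oppr_gt0 //.
      by rewrite divr_ge0 ?(ltW y0) // oppr_ge0.
    - have -> : x2 + (- y2 / y + x2 / - x) / 2 * x = (x2 * y - x * y2) / y / 2.
        by field; rewrite ?oppr_eq0 x00 gt_eqF.
      by rewrite !divr_gt0 // subr_gt0.
    - have -> : y2 + (- y2 / y + x2 / - x) / 2 * y = (x2 * y - x * y2) / (- x) / 2.
        by field; rewrite ?oppr_eq0 x00 gt_eqF.
      by rewrite !divr_gt0 ?subr_gt0 ?oppr_gt0.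
  by apply: nq; exists (x2 + r * x), (y2 + r * y); split => //; apply: CD => //; exact: CZ.
have x00 : x < 0.
  rewrite lt_neqAle x0 andbT; apply/eqP => xE.
  have := key _ _ C1 x10; rewrite xE mul0r; have := mulr_gt0 x10 y0; lra.
have : y / - x <= inf T.
  apply: lb_le_inf; first by case: hT.
  move=> t [x2 [y2 [C2 x20 ->]]].
  rewrite ler_pdivrMr ?oppr_gt0 // mulrAC ler_pdivlMr //.
  by have := key _ _ C2 x20; lra.
rewrite ler_pdivrMr ?oppr_gt0 //; lra.
Qed.

(** A cone lying in no half-plane meets every open quadrant, by reflection of
    the preceding lemma.  Points of two adjacent quadrants have a positive
    combination on the half-axis between them. *)
Lemma full_cone_or_halfplane (R : realType) (C : R[i] -> Prop) :
  (forall z w, C z -> C w -> C (z + w)) ->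
  (forall (c : R) z, 0 < c -> C z -> C (c%:C * z)) ->
  [/\ C 1, C (-1), C 'i%C & C (- 'i%C)] \/
  (exists a b : R, (a, b) != (0, 0) /\ forall z, C z -> 0 <= a * Re z + b * Im z).
Proof.
move=> CD CZ.
case: (pselect (exists a b : R, (a, b) != (0, 0) /\ forall z, C z -> 0 <= a * Re z + b * Im z)).
  by right.
move=> nH; left.
have Q (s t : R) : s ^+ 2 = 1 -> t ^+ 2 = 1 ->
    exists2 z, C z & 0 < s * Re z /\ 0 < t * Im z.
  move=> s1 t1.
  have [||[x [y [Cxy x0 y0]]]|[a [b [ab0 H]]]] :=
    @quadrant_or_separated R (fun x y => C ((s * x) +i* (t * y))).
  - move=> x y x' y' h h'; have := CD _ _ h h'.
    by congr C; apply: complexP; rewrite !ReImE /=; ring.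
  - move=> c x y c0 h; have := CZ _ _ c0 h.
    by congr C; apply: complexP; rewrite !ReImE /=; ring.
  - exists ((s * x) +i* (t * y)) => //=.
    by rewrite !mulrA -!expr2 s1 t1 !mul1r.
  - exfalso; apply: nH; exists (- (s * a)), (- (t * b)); split.
      apply: contra_neq ab0 => -[/eqP + /eqP]; rewrite !oppr_eq0 !mulf_eq0.
      have -> : (s == 0) = false by apply/eqP => s0; move: s1; rewrite s0 expr0n /=; lra.
      have -> : (t == 0) = false by apply/eqP => s0; move: t1; rewrite s0 expr0n /=; lra.
      by move=> /= /eqP -> /eqP ->.
    move=> z Cz; have := H (s * Re z) (t * Im z).
    rewrite !mulrA -!expr2 s1 t1 !mul1r; case: z Cz => x y Cz /= /(_ Cz); lra.
have one : (1 : R) ^+ 2 = 1 by rewrite expr1n.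
have mone : (-1 : R) ^+ 2 = 1 by rewrite sqrrN expr1n.
(* the weights cancel the imaginary parts of a point above and a point below
   the half-axis *)
have real_dir (s : R) : s ^+ 2 = 1 -> C s%:C.
  move=> s1; have [z Cz [z1 z2]] := Q s 1 s1 one; have [w Cw [w1 w2]] := Q s (-1) s1 mone.
  rewrite mul1r in z2; rewrite mulN1r in w2.
  have c0 : 0 < s * (- Im w * Re z + Im z * Re w).
    by have := mulr_gt0 w2 z1; have := mulr_gt0 z2 w1; lra.
  have := CZ _ _ (_ : 0 < (s * (- Im w * Re z + Im z * Re w))^-1)
     (CD _ _ (CZ _ _ w2 Cz) (CZ _ _ z2 Cw)).
  rewrite invr_gt0 => /(_ c0); congr C; apply: complexP; rewrite !ReImE /=; last by ring.
  apply: (mulIf (lt0r_neq0 c0)).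
  rewrite !mul0r !subr0 mulrAC mulVf ?gt_eqF // mul1r.
  by rewrite mulrA -expr2 s1 mul1r.
have imag_dir (s : R) : s ^+ 2 = 1 -> C (0 +i* s).
  move=> s1; have [z Cz [z1 z2]] := Q 1 s one s1; have [w Cw [w1 w2]] := Q (-1) s mone s1.
  rewrite mul1r in z1; rewrite mulN1r in w1.
  have c0 : 0 < s * (- Re w * Im z + Re z * Im w).
    by have := mulr_gt0 w1 z2; have := mulr_gt0 z1 w2; lra.
  have := CZ _ _ (_ : 0 < (s * (- Re w * Im z + Re z * Im w))^-1)
     (CD _ _ (CZ _ _ w1 Cz) (CZ _ _ z1 Cw)).
  rewrite invr_gt0 => /(_ c0); congr C; apply: complexP; rewrite !ReImE /=; first by ring.
  apply: (mulIf (lt0r_neq0 c0)).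
  rewrite !mul0r !addr0 mulrAC mulVf ?gt_eqF // mul1r.
  by rewrite mulrA -expr2 s1 mul1r.
split.
- exact: real_dir.
- by have := real_dir _ mone; rewrite rmorphN.
- exact: imag_dir.
- by have := imag_dir _ mone; congr C; apply: complexP; rewrite /= ?oppr0.
Qed.

(** * First-order optimality *)

Lemma Ad_bmeas (R : realType) (b1 b2 : R) (B : R -> R) : bmeas B ->
  (forall x, b1 <= B x <= b2) -> Ad b1 b2 B.
Proof.
by move=> Bb B12; split; [exact: bmeas_ess_bounded|apply: aeW => x _; exact: B12].
Qed.

Definition admissible_variation (R : realType) (b1 b2 : R) (B V : R -> R) : Prop :=
  bmeas V /\ exists2 d : R, 0 < d & forall x, b1 <= B x + d * V x <= b2.

Lemma admissible_le (R : realType) (b1 b2 : R) (B V : R -> R) (d d' : R) :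
  (forall x, b1 <= B x <= b2) -> 0 < d' -> d' <= d ->
  (forall x, b1 <= B x + d * V x <= b2) -> forall x, b1 <= B x + d' * V x <= b2.
Proof.
move=> B12 d0 dd H x; have /andP[h1 h2] := B12 x; have /andP[k1 k2] := H x.
have dp : 0 < d by exact: lt_le_trans dd.
have r0 : 0 <= d' / d by rewrite divr_ge0 // ltW.
have r1 : d' / d <= 1 by rewrite ler_pdivrMr // mul1r.
have -> : B x + d' * V x = (1 - d' / d) * B x + d' / d * (B x + d * V x).
  by field; rewrite gt_eqF.
move: (d' / d) r0 r1 (B x + d * V x) k1 k2 h1 h2 => r r0 r1 C k1 k2 h1 h2.
by apply/andP; split; nra.
Qed.

Lemma admissible_variationD (R : realType) (b1 b2 : R) (B V W : R -> R) :
  (forall x, b1 <= B x <= b2) -> admissible_variation b1 b2 B V ->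
  admissible_variation b1 b2 B W -> admissible_variation b1 b2 B (fun x => V x + W x).
Proof.
move=> B12 [Vb [d d0 Vd]] [Wb [e e0 We]]; split; first exact: bmeasD.
exists (Num.min d e / 2); first by rewrite divr_gt0 // lt_min d0.
have m0 : 0 < Num.min d e by rewrite lt_min d0.
have md : Num.min d e <= d by rewrite ge_min lexx.
have me : Num.min d e <= e by rewrite ge_min lexx orbT.
move=> x.
have /andP[h1 h2] := @admissible_le _ _ _ _ _ _ (Num.min d e) B12 m0 md Vd x.
have /andP[k1 k2] := @admissible_le _ _ _ _ _ _ (Num.min d e) B12 m0 me We x.
by apply/andP; split; lra.
Qed.

Lemma admissible_variationZ (R : realType) (b1 b2 c : R) (B V : R -> R) :
  0 < c -> admissible_variation b1 b2 B V ->
  admissible_variation b1 b2 B (fun x => c * V x).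
Proof.
move=> c0 [Vb [d d0 Vd]]; split; first by apply: bmeasM => //; exact: bmeas_cst.
exists (d / c); first exact: divr_gt0.
by move=> x; rewrite mulrA divfK ?gt_eqF.
Qed.

(** If the cone of first variations contained [1], [-1], [i] and [- i], realised
    by [V1], [V2], [V3] and [V4], then the combination of these with the positive
    and negative parts of [Re z] and [Im z] as coefficients would be an
    admissible variation with first variation exactly [z].  Lowering the
    frequency by [i eta] would then be possible. *)
Lemma halfplane_of_optimal (R : realType) (b1 b2 alpha beta : R) (B : R -> R)
    (y dy : R -> R[i]) :
  bmeas B -> (forall x, b1 <= B x <= b2) -> alpha +i* beta != 0 ->
  is_solution (alpha +i* beta) B y dy -> dy 0 = 0 ->
  dy 1 = - ('i%C * (alpha +i* beta) * y 1) ->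
  (forall x, y (clamp x) = y x) -> (forall x, y x != 0) ->
  (forall k, quasi_eigenvalues_Ad b1 b2 k -> Re k = alpha -> beta <= Im k) ->
  exists a b : R, (a, b) != (0, 0) /\ forall V, admissible_variation b1 b2 B V ->
    0 <= intg 0 1 (fun t => (a * Re (y t ^+ 2) + b * Im (y t ^+ 2)) * V t).
Proof.
move=> Bb B12 k0 sol dy0 dy1 yc y0 opt.
have [yb _] := cprim_cbmeas (proj1 sol).
have y2b : cbmeas (fun t => y t ^+ 2) by exact: (cbmeasM yb yb).
pose w V := cintg 0 1 (fun t => y t ^+ 2 * (V t)%:C).
have yVb V : bmeas V -> cbmeas (fun t => y t ^+ 2 * (V t)%:C).
  by move=> Vb; apply: cbmeasM => //; exact: cbmeas_real.
pose C z := exists2 V, admissible_variation b1 b2 B V & z = w V.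
have [||[C1 C2 C3 C4]|[a [b [ab H]]]] := @full_cone_or_halfplane R C.
- move=> z z' [V Va ->] [W Wa ->]; exists (fun x => V x + W x).
    exact: admissible_variationD.
  rewrite /w -cintgD; [|exact: yVb (proj1 Va)|exact: yVb (proj1 Wa)].
  by apply: eq_cintg => t _; rewrite rmorphD /= mulrDr.
- move=> c z c0 [V Va ->]; exists (fun x => c * V x).
    exact: admissible_variationZ.
  rewrite /w -cintgZ; last exact: yVb (proj1 Va).
  by apply: eq_cintg => t _; rewrite rmorphM /=; ring.
- exfalso.
  case: C1 C2 C3 C4 => V1 [V1b [d1 d10 V1d]] w1 [V2 [V2b [d2 d20 V2d]] w2]
    [V3 [V3b [d3 d30 V3d]] w3] [V4 [V4b [d4 d40 V4d]] w4].
  pose d := Num.min (Num.min d1 d2) (Num.min (Num.min d3 d4) 1).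
  have d0 : 0 < d by rewrite !lt_min d10 d20 d30 d40 ltr01.
  have /and3P[] : [&& d <= Num.min d1 d2, d <= Num.min d3 d4 & d <= 1].
    by rewrite /d !le_min; apply/and3P; split; rewrite ?ge_min ?lexx ?orbT.
  rewrite !le_min => /andP[dd1 dd2] /andP[dd3 dd4] dle1.
  have D1 := admissible_le B12 d0 dd1 V1d; have D2 := admissible_le B12 d0 dd2 V2d.
  have D3 := admissible_le B12 d0 dd3 V3d; have D4 := admissible_le B12 d0 dd4 V4d.
  (* [B + d Vj] is admissible for the common [d], hence so is [B + V z] as soon as
     [norm1 z <= d], being a convex combination of these and [B] *)
  pose V (z : R[i]) (x : R) := Num.max 0 (Re z) * V1 x + Num.max 0 (- Re z) * V2 x +
     (Num.max 0 (Im z) * V3 x + Num.max 0 (- Im z) * V4 x).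
  have cVb c W : bmeas W -> bmeas (fun x : R => c * W x).
    by apply: bmeasM; exact: bmeas_cst.
  have Vb z : bmeas (V z) by apply: bmeasD; apply: bmeasD; exact: cVb.
  have [v1 v10 V1v] := bmeas_bound V1b; have [v2 v20 V2v] := bmeas_bound V2b.
  have [v3 v30 V3v] := bmeas_bound V3b; have [v4 v40 V4v] := bmeas_bound V4b.
  pose v := v1 + v2 + v3 + v4.
  have vle : [/\ v1 <= v, v2 <= v, v3 <= v & v4 <= v].
    by rewrite /v; clear -v10 v20 v30 v40; split; lra.
  have Vlip z z' x : `|V z x - V z' x| <= v * norm1 (z - z').
    case: vle => vl1 vl2 vl3 vl4; rewrite /V /norm1 !ReImE.
    have H1 := maxr0_lipschitz (Re z) (Re z'); have H2 := maxr0_lipschitz (Im z) (Im z').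
    move: (Num.max 0 (Re z)) (Num.max 0 (- Re z)) (Num.max 0 (Im z)) (Num.max 0 (- Im z)) H1 H2.
    move: (Num.max 0 (Re z')) (Num.max 0 (- Re z')) (Num.max 0 (Im z')) (Num.max 0 (- Im z')).
    move=> p q r s p' q' r' s' H1 H2.
    have -> : p' * V1 x + q' * V2 x + (r' * V3 x + s' * V4 x) -
       (p * V1 x + q * V2 x + (r * V3 x + s * V4 x)) =
       ((p' - p) * V1 x + (q' - q) * V2 x) + ((r' - r) * V3 x + (s' - s) * V4 x) by ring.
    have G (c W u : R) : `|W| <= u -> u <= v -> `|c * W| <= v * `|c|.
      move=> Wu uv; rewrite normrM mulrC; apply: ler_wpM2r => //; exact: le_trans uv.
    apply: le_trans (ler_normD _ _) _; rewrite mulrDr; apply: lerD.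
      apply: le_trans (ler_normD _ _) _.
      apply: le_trans (lerD (G _ _ _ (V1v x) vl1) (G _ _ _ (V2v x) vl2)) _.
      by rewrite -mulrDr; apply: ler_wpM2l => //; exact: le_trans vl1.
    apply: le_trans (ler_normD _ _) _.
    apply: le_trans (lerD (G _ _ _ (V3v x) vl3) (G _ _ _ (V4v x) vl4)) _.
    by rewrite -mulrDr; apply: ler_wpM2l => //; exact: le_trans vl1.
  have V0 x : V 0 x = 0 by rewrite /V /= oppr0 maxxx !mul0r !addr0.
  have Vz z : cintg 0 1 (fun t => y t ^+ 2 * (V z t)%:C) = z.
    pose m1 := (Num.max 0 (Re z))%:C; pose m2 := (Num.max 0 (- Re z))%:C.
    pose m3 := (Num.max 0 (Im z))%:C; pose m4 := (Num.max 0 (- Im z))%:C.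
    have cb c W : bmeas W -> cbmeas (fun t : R => c * (y t ^+ 2 * (W t)%:C)).
      by move=> Wb; apply: cbmeasM; [exact: cbmeas_cst|exact: yVb].
    transitivity ((m1 * w V1 + m2 * w V2) + (m3 * w V3 + m4 * w V4)).
      rewrite /w -!cintgZ; [|exact: yVb..].
      rewrite -(cintgD _ _ (cb m1 _ V1b) (cb m2 _ V2b)).
      rewrite -(cintgD _ _ (cb m3 _ V3b) (cb m4 _ V4b)).
      rewrite -cintgD; [|by apply: cbmeasD; exact: cb..].
      by apply: eq_cintg => t _; rewrite /V /m1 /m2 /m3 /m4 !rmorphD !rmorphM /=; ring.
    rewrite -w1 -w2 -w3 -w4 /m1 /m2 /m3 /m4.
    have h1 := maxr0_sub (Re z); have h2 := maxr0_sub (Im z).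
    by apply: complexP; rewrite !ReImE /=; [rewrite -[RHS]h1|rewrite -[RHS]h2]; ring.
  have d01 : 0 < d <= 1 by rewrite d0.
  have [eta eta0 He] := quasi_eigenvalue_perturbation k0 Bb sol dy0 dy1 yc y0 Vb Vlip V0 Vz d01.
  have keta : norm1 (0 -i* eta) <= eta.
    by rewrite /norm1 /= normr0 add0r normrN gtr0_norm.
  have [z zd zq] := He _ keta.
  have : beta <= Im ((alpha +i* beta) + (0 -i* eta)).
    apply: opt; last by rewrite /= addr0.
    exists (fun x => B x + V z x) => //; apply: Ad_bmeas; first exact: bmeasD.
    move=> x; have /andP[h1 h2] := B12 x.
    have /andP[g1 g1'] := D1 x; have /andP[g2 g2'] := D2 x.
    have /andP[g3 g3'] := D3 x; have /andP[g4 g4'] := D4 x.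
    move: zd; rewrite /norm1 /V.
    rewrite -!maxr0_add.
    have p0 (t : R) : 0 <= Num.max 0 t by rewrite le_max lexx.
    move: (p0 (Re z)) (p0 (- Re z)) (p0 (Im z)) (p0 (- Im z)).
    move: (Num.max 0 (Re z)) (Num.max 0 (- Re z)) (Num.max 0 (Im z)) (Num.max 0 (- Im z)).
    move=> p q r s p0' q0' r0' s0' zd; clear p0.
    rewrite -(ler_pM2l d0) -[in X in _ && X](ler_pM2l d0).
    apply/andP; split.
    - have e1 := ler_wpM2l p0' g1; have e2 := ler_wpM2l q0' g2.
      have e3 := ler_wpM2l r0' g3; have e4 := ler_wpM2l s0' g4.
      have e5 : (p + q + (r + s)) * (B x - b1) <= d * (B x - b1).
        by apply: ler_wpM2r => //; rewrite subr_ge0.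
      clear -e1 e2 e3 e4 e5; lra.
    - have e1 := ler_wpM2l p0' g1'; have e2 := ler_wpM2l q0' g2'.
      have e3 := ler_wpM2l r0' g3'; have e4 := ler_wpM2l s0' g4'.
      have e5 : (p + q + (r + s)) * (b2 - B x) <= d * (b2 - B x).
        by apply: ler_wpM2r => //; rewrite subr_ge0.
      clear -e1 e2 e3 e4 e5; lra.
  by rewrite /=; clear -eta0; lra.
- exists a, b; split=> // V Va.
  have Vb := proj1 Va; have [y1 y2] := y2b.
  have := H (w V) (ex_intro2 _ _ V Va erefl).
  rewrite /w /= -!intgZ; last first.
  - by apply: eq_bmeas (bmeasM y1 Vb) => x; rewrite !ReImE /= mulr0 subr0.
  - by apply: eq_bmeas (bmeasM y2 Vb) => x; rewrite !ReImE /= mulr0 add0r.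
  rewrite -intgD.
  + congr (_ <= _); apply: eq_intg => t _; case: (y t ^+ 2) => p q /=; ring.
  + apply: bmeasM; first exact: bmeas_cst.
    by apply: eq_bmeas (bmeasM y1 Vb) => x; rewrite !ReImE /= mulr0 subr0.
  + apply: bmeasM; first exact: bmeas_cst.
    by apply: eq_bmeas (bmeasM y2 Vb) => x; rewrite !ReImE /= mulr0 add0r.
Qed.

(** Test with the variation that moves [B] to [b1] where [h > 0] and to [b2]
    where [h < 0]: then [h V <= 0] everywhere while its integral is nonnegative,
    so [h V] vanishes almost everywhere. *)
Lemma bang_bang (R : realType) (b1 b2 : R) (B h : R -> R) :
  b1 <= b2 -> bmeas B -> (forall x, b1 <= B x <= b2) -> bmeas h ->
  (forall V, admissible_variation b1 b2 B V -> 0 <= intg 0 1 (fun t => h t * V t)) ->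
  {ae lebesgue_measure, forall x : R, 0 < x < 1 ->
    (0 < h x -> B x = b1) /\ (h x < 0 -> B x = b2)}.
Proof.
move=> b12 Bb B12 hb H; have [mB _] := Bb; have [mh _] := hb.
pose B1 x := if 0 < h x then b1 else if h x < 0 then b2 else B x.
have B1b : bmeas B1.
  apply: (@bmeasW _ _ (`|b1| + `|b2|)).
    apply: measurable_fun_ifT => //; first by apply: measurable_fun_ltr => //; exact: measurable_cst.
    apply: measurable_fun_ifT => //; first by apply: measurable_fun_ltr => //; exact: measurable_cst.
  move=> x; have /andP[h1 h2] := B12 x.
  have : b1 <= B1 x <= b2 by rewrite /B1; case: ifP => _; [|case: ifP => _]; rewrite ?lexx ?b12 // h1.
  rewrite ler_norml => /andP[k1 k2]; have := ler_norm (- b1); have := ler_norm b2.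
  by rewrite normrN; have := normr_ge0 b1; have := normr_ge0 b2; lra.
pose V x := B1 x - B x.
have Vb : bmeas V by exact: bmeasB.
have Va : admissible_variation b1 b2 B V.
  split => //; exists 1 => // x; rewrite mul1r /V addrC subrK; have /andP[h1 h2] := B12 x.
  by rewrite /B1; case: ifP => _; [|case: ifP => _]; rewrite ?lexx ?b12 // h1.
have hV x : h x * V x <= 0.
  have /andP[h1 h2] := B12 x; rewrite /V /B1.
  case: ifP => [hp|_]; first by rewrite pmulr_rle0 // subr_le0.
  by case: ifP => [hn|_]; [rewrite nmulr_rle0 // subr_ge0|rewrite subrr mulr0].
have I0 : intg 0 1 (fun t => - (h t * V t)) = 0.
  apply/eqP; rewrite eq_le; apply/andP; split; last first.
    by apply: intg_ge0 => x _; rewrite oppr_ge0.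
  by rewrite intgN ?oppr_le0 ?H //; exact: bmeasM.
have := intg_ge0_eq0 _ _ I0 => /(_ (bmeasN (bmeasM hb Vb))) A.
have {A} A := A (fun x _ => ltac:(rewrite oppr_ge0; exact: hV)).
apply: (ae_imp A) => x Ax /Ax /eqP; rewrite oppr_eq0 mulf_eq0 /V /B1 => h0.
split => hx; move: h0; rewrite ?hx ?(gt_eqF hx) ?(lt_eqF hx) ?(lt_gtF hx) /=.
  by rewrite subr_eq0 => /eqP.
by rewrite subr_eq0 => /eqP.
Qed.

(** * Switching points *)

Lemma continuous_neq0_near (R : realType) (f : R -> R) (x : R) : continuous f ->
  f x != 0 -> exists2 e, 0 < e & forall t, `|x - t| < e -> f t != 0.
Proof.
move=> fc fx; have fx0 : 0 < `|f x| by rewrite normr_gt0.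
have [e e0 He] := continuous_eps (fc x) fx0.
exists e => // t /He; apply: contraTneq => ->; by rewrite subr0 ltxx.
Qed.

(** For a curve [q + i r] that avoids the origin near [x], zeros of [q] are zeros
    of [q / r], and Rolle's theorem puts a critical point of [q / r] between any
    two of them.  This covers points [x] at which the rotation of the curve
    stops, such as the left end of the support of [B]. *)
Lemma crossings_separated (R : realType) (q r q' r' q'' r'' : R -> R) (x : R) :
  prim q q' -> prim q' q'' -> prim r r' -> prim r' r'' ->
  (forall t, q (clamp t) = q t) -> (forall t, r (clamp t) = r t) ->
  (q x != 0) || (r x != 0) ->
  exists2 e, 0 < e & forall s t, 0 <= s -> s < t -> t <= 1 ->
    `|x - s| < e -> `|x - t| < e -> q s = 0 -> q t = 0 ->
    exists2 u, s < u < t & q' u * r u - q u * r' u = 0.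
Proof.
move=> pq pq' pr pr' qc rc /orP[qx|rx].
  have [e e0 He] := continuous_neq0_near (prim_clamp_continuous pq qc) qx.
  by exists e => // s t _ _ _ xs _ qs; move: (He s xs); rewrite qs eqxx.
have rcont := prim_clamp_continuous pr rc; have qcont := prim_clamp_continuous pq qc.
have [e e0 He] := continuous_neq0_near rcont rx.
exists e => // s t s0 st t1 xs xt qs qt.
have rn u : s <= u <= t -> r u != 0.
  move=> /andP[su ut]; apply: He; move: xs xt; rewrite !ltr_norml => /andP[? ?] /andP[? ?].
  by apply/andP; split; lra.
have D u : u \in `]s, t[ -> is_derive u 1 (fun v => q v * (r v)^-1)
    (q u * (- (r u)^-2 * r' u) + (r u)^-1 * q' u).
  rewrite in_itv /= => /andP[su ut].
  have u01 : 0 < u < 1 by apply/andP; split; lra.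
  have dq := prim_is_derive pq pq' u01; have dr := prim_is_derive pr pr' u01.
  have ru : r u != 0 by apply: rn; rewrite !ltW.
  have := is_deriveM dq (is_deriveV ru dr).
  by rewrite /GRing.scale /=.
have Dd u : u \in `]s, t[ -> derivable (fun v => q v * (r v)^-1) u 1.
  by move=> us; exact: (@ex_derive _ _ _ _ _ _ _ (D u us)).
have wc : {within `[s, t], continuous (fun v => q v * (r v)^-1)}.
  apply: continuous_in_subspaceT => u; rewrite inE /= in_itv /= => su.
  by apply: cvgM; [exact: qcont|apply: cvgV; [exact: rn|exact: rcont]].
have st_eq : q s * (r s)^-1 = q t * (r t)^-1 by rewrite qs qt !mul0r.
have [c cst c0] := Rolle st Dd wc st_eq.
have E : q c * (- (r c)^-2 * r' c) + (r c)^-1 * q' c = 0.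
  by rewrite -(@derive_val _ _ _ _ _ _ _ (D c cst)) (@derive_val _ _ _ _ _ _ _ c0).
have /andP[sc ct] : s < c < t by move: cst; rewrite in_itv.
exists c; first by rewrite sc.
have rc0 : r c != 0 by apply: rn; rewrite !ltW.
apply: (mulIf (x := (r c)^-2)); first by rewrite invr_eq0 expf_neq0.
by rewrite mul0r -[RHS]E; field.
Qed.

(** The supremum of the end points reachable from [0] by finitely many good
    pieces is reached thanks to the condition on its left, and cannot be
    smaller than [1] because of the condition on its right. *)
Lemma interval_partition (R : realType) (P : R -> R -> Prop) :
  (forall a b a' b', P a b -> a <= a' -> b' <= b -> P a' b') ->
  (forall x, 0 <= x < 1 -> exists2 e, 0 < e & P x (x + e)) ->
  (forall x, 0 < x <= 1 -> exists2 e, 0 < e & P (x - e) x) ->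
  exists (n : nat) (x : nat -> R), [/\ x 0%N = 0, x n.+1 = 1,
    forall j, (j <= n)%N -> x j < x j.+1 & forall j, (j <= n)%N -> P (x j) (x j.+1)].
Proof.
move=> Pmono Pr Pl.
pose T t := exists (n : nat) (x : nat -> R), [/\ x 0%N = 0, x n.+1 = t,
    forall j, (j <= n)%N -> x j < x j.+1 & forall j, (j <= n)%N -> P (x j) (x j.+1)].
have Text t t' : T t -> t < t' -> P t t' -> T t'.
  move=> [n [x [x0 xn xi xP]]] tt' Ptt'.
  exists n.+1, (fun j => if (j <= n.+1)%N then x j else t'); split => //.
  - by rewrite ltnn.
  - move=> j jn; case: (eqVneq j n.+1) => [->|jne]; first by rewrite leqnn ltnn xn.
    have jn' : (j <= n)%N by rewrite -ltnS ltn_neqAle jne.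
    by rewrite jn ltnS jn'; apply: xi.
  - move=> j jn; case: (eqVneq j n.+1) => [->|jne]; first by rewrite leqnn ltnn xn.
    have jn' : (j <= n)%N by rewrite -ltnS ltn_neqAle jne.
    by rewrite jn ltnS jn'; apply: xP.
pose A := [set t : R | t <= 1 /\ T t].
have [e e0 Pe] : exists2 e : R, 0 < e & P 0 (0 + e) by apply: Pr; rewrite lexx ltr01.
have A0 : A (Num.min 1 e).
  split; first by rewrite ge_min lexx.
  exists 0%N, (fun j => if j is 0%N then 0 else Num.min 1 e); split => // -[] // _.
    by rewrite lt_min ltr01.
  by apply: (Pmono _ _ _ _ Pe) => //; rewrite add0r ge_min lexx orbT.
have hA : has_sup A by split; [exists (Num.min 1 e)|exists 1 => t []].
have s1 : sup A <= 1 by apply: ge_sup; [case: hA|move=> t []].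
have s0 : 0 < sup A.
  apply: lt_le_trans (_ : Num.min 1 e <= _); first by rewrite lt_min ltr01.
  by apply: sup_upper_bound.
have Ts : T (sup A).
  have [d d0 Pd] : exists2 d, 0 < d & P (sup A - d) (sup A) by apply: Pl; rewrite s0.
  have [t [t1 Tt] dt] := sup_adherent d0 hA.
  have ts : t <= sup A by apply: sup_upper_bound.
  move: ts; rewrite le_eqVlt => /predU1P[<- //|ts].
  by apply: (Text t) => //; apply: (Pmono _ _ _ _ Pd) => //; exact: ltW.
move: s1; rewrite le_eqVlt => /predU1P[<- //|s1].
have [d d0 Pd] : exists2 d, 0 < d & P (sup A) (sup A + d) by apply: Pr; rewrite s1 ltW.
have : A (Num.min 1 (sup A + d)).
  split; first by rewrite ge_min lexx.
  apply: (Text (sup A)) => //; first by rewrite lt_min s1 ltrDl.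
  by apply: (Pmono _ _ _ _ Pd) => //; rewrite ge_min lexx orbT.
move=> /(sup_upper_bound hA); rewrite leNgt => /negP; case.
by rewrite lt_min s1 ltrDl.
Qed.

Lemma partition_locate (R : realType) (x : nat -> R) (n : nat) (t : R) :
  x 0%N < t < x n.+1 -> (forall j, t != x j) -> exists2 j, (j <= n)%N & x j < t < x j.+1.
Proof.
elim: n => [|n IH] /andP[t0 tn] tx; first by exists 0%N; rewrite ?t0.
have [tn1|nt1] := ltP t (x n.+1).
  have [j jn jt] : exists2 j, (j <= n)%N & x j < t < x j.+1 by apply: IH; rewrite ?t0.
  by exists j => //; exact: leqW.
by exists n.+1 => //; rewrite tn andbT lt_neqAle nt1 andbT eq_sym tx.
Qed.

Lemma piecewise_of_local (R : realType) (B B' : R -> R) :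
  (forall x, 0 <= x < 1 -> exists2 e, 0 < e & exists c,
     (forall t, 0 < t < 1 -> x < t < x + e -> B' t = c) /\
     {ae lebesgue_measure, forall t : R, 0 < t < 1 -> x < t < x + e -> B t = B' t}) ->
  (forall x, 0 < x <= 1 -> exists2 e, 0 < e & exists c,
     (forall t, 0 < t < 1 -> x - e < t < x -> B' t = c) /\
     {ae lebesgue_measure, forall t : R, 0 < t < 1 -> x - e < t < x -> B t = B' t}) ->
  {ae lebesgue_measure, forall t : R, 0 < t < 1 -> B t = B' t} /\ piecewise_constant01 B'.
Proof.
move=> Hr Hl.
pose P a b := exists c, (forall t, 0 < t < 1 -> a < t < b -> B' t = c) /\
     {ae lebesgue_measure, forall t : R, 0 < t < 1 -> a < t < b -> B t = B' t}.
have [||| n [x [x0 xn xi xP]]] := @interval_partition R P.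
- move=> a b a' b' [c [H1 H2]] aa bb; exists c; split.
    move=> t t01 /andP[at' tb]; apply: H1 => //.
    by rewrite (le_lt_trans aa at') (lt_le_trans tb bb).
  apply: (ae_imp H2) => t H t01 /andP[at' tb]; apply: H => //.
  by rewrite (le_lt_trans aa at') (lt_le_trans tb bb).
- exact: Hr.
- exact: Hl.
have xmono j k : (j <= k)%N -> (k <= n.+1)%N -> x j <= x k.
  move=> jk; elim: k jk => [|k IH]; first by rewrite leqn0 => /eqP ->.
  rewrite leq_eqVlt => /predU1P[->//|jk] kn; apply: le_trans (IH jk (ltnW kn)) _.
  by apply: ltW; apply: xi.
have in01 j t : (j <= n)%N -> x j < t < x j.+1 -> 0 < t < 1.
  move=> jn /andP[h1 h2]; rewrite -x0 -xn.
  by rewrite (le_lt_trans (xmono 0%N j _ _) h1) ?(lt_le_trans h2 (xmono _ _ _ _)) // ltnW.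
split; last first.
  exists n, x; split => // j jn; have [c [H1 _]] := xP j jn.
  by exists c => t jt; apply: H1 => //; exact: in01 jt.
have A1 : {ae lebesgue_measure, forall t : R, forall j : nat, t != x j}.
  have : forall j : nat, {ae lebesgue_measure, forall t : R, t != x j}.
    move=> j; exists [set x j]; split; [exact: measurable_set1|exact: lebesgue_measure_set1|].
    by move=> t /= /negP; rewrite negbK => /eqP.
  by move=> H; apply/ae_foralln.
have A2 : {ae lebesgue_measure, forall t : R, forall j : nat, (j <= n)%N ->
    0 < t < 1 -> x j < t < x j.+1 -> B t = B' t}.
  have : forall j : nat, {ae lebesgue_measure, forall t : R, (j <= n)%N ->
      0 < t < 1 -> x j < t < x j.+1 -> B t = B' t}.
    move=> j; case: (leqP j n) => jn; last by apply: aeW.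
    by have [c [_ H]] := xP j jn; apply: (ae_imp H) => t Ht _.
  by move=> H; apply/ae_foralln.
apply: (ae_imp2 A1 A2) => t H1 H2 t01.
have [|j jn jt] := @partition_locate _ x n t _ H1; first by rewrite x0 xn.
exact: H2 jt.
Qed.

Lemma constant_sign (R : realType) (q : R -> R) (a b : R) : continuous q ->
  (forall t, a < t < b -> q t != 0) ->
  (forall t, a < t < b -> 0 < q t) \/ (forall t, a < t < b -> q t < 0).
Proof.
move=> qc q0; case: (pselect (exists2 t, a < t < b & q t < 0)) => [[t tab qt]|nt]; last first.
  left => t tab; rewrite lt_neqAle eq_sym q0 //= leNgt; apply/negP => qt; apply: nt.
  by exists t.
right => s sab; rewrite lt_neqAle q0 //= leNgt; apply/negP => qs.
have H u v : u <= v -> a < u < b -> a < v < b ->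
    Num.min (q u) (q v) <= 0 <= Num.max (q u) (q v) -> False.
  move=> uv /andP[au ub] /andP[av vb] uv0.
  have [c] := IVT uv (continuous_subspaceT qc) uv0.
  rewrite in_itv /= => /andP[uc cv] qc0.
  have : q c != 0 by apply: q0; rewrite (lt_le_trans au uc) (le_lt_trans cv vb).
  by rewrite qc0 eqxx.
have [st|/ltW ts] := leP s t.
  by apply: (H s t) => //; rewrite ge_min le_max (ltW qt) (ltW qs) orbT.
by apply: (H t s) => //; rewrite ge_min le_max (ltW qt) (ltW qs) orbT.
Qed.

Lemma dist_lt_left (R : realType) (x s e d : R) :
  x - e < s -> s < x -> e <= d -> `|x - s| < d.
Proof. by move=> ? ? ?; rewrite ltr_norml; apply/andP; split; lra. Qed.

Lemma dist_lt_right (R : realType) (x s e d : R) :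
  x < s -> s < x + e -> e <= d -> `|x - s| < d.
Proof. by move=> ? ? ?; rewrite ltr_norml; apply/andP; split; lra. Qed.

Lemma dist_lt_gt0 (R : realType) (x s : R) : `|x - s| < x -> 0 < s.
Proof. by rewrite ltr_norml => /andP[? ?]; lra. Qed.

Lemma lt_add_le1 (R : realType) (x s e : R) : s < x + e -> e <= 1 - x -> s <= 1.
Proof. by lra. Qed.

Lemma lt_sub_ge0 (R : realType) (x s e : R) : x - e < s -> e <= x -> 0 <= s.
Proof. by lra. Qed.

(** * Optimal structures for a nonzero frequency *)

(** Let [N x] be the integral of [B |y| ^ 2] over [[0, x]].  Two zeros of the
    switching function near a common point where [N > 0] would enclose a point
    where the momentum, hence [N], vanishes.  So on each side of any point
    either [N = 0], which forces [B = 0 = b1], or the switching function has a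
    constant sign. *)
Lemma switching_structure (R : realType) (b1 b2 alpha beta : R) (B : R -> R)
    (y dy : R -> R[i]) : 0 <= b1 -> b1 <= b2 ->
  bmeas B -> (forall x, b1 <= B x <= b2) -> alpha != 0 ->
  is_solution (alpha +i* beta) B y dy -> dy 0 = 0 ->
  dy 1 = - ('i%C * (alpha +i* beta) * y 1) ->
  (forall x, y (clamp x) = y x) -> (exists2 x, 0 <= x <= 1 & y x != 0) ->
  (forall k, quasi_eigenvalues_Ad b1 b2 k -> Re k = alpha -> beta <= Im k) ->
  exists B' : R -> R, [/\
    {ae lebesgue_measure, forall x : R, 0 < x < 1 -> B x = B' x},
    piecewise_constant01 B' & forall x, B' x = b1 \/ B' x = b2].
Proof.
move=> b10 b12 Bb B12 a0 sol dy0 dy1 yc yn0 opt.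
have B0 t : 0 <= B t by have /andP[h _] := B12 t; exact: le_trans h.
have [beta0 y01] := decay_rate_gt0 Bb B0 sol dy0 dy1 a0 yn0.
have y0 x : y x != 0 by rewrite -yc; apply: y01; exact: clamp01.
have k0 : alpha +i* beta != 0 by rewrite eq_complex /= negb_and a0.
have [a [b [ab Hhalf]]] := halfplane_of_optimal Bb B12 k0 sol dy0 dy1 yc y0 opt.
have [Hy Hdy] := sol; have [yb dyb] := cprim_cbmeas Hy.
have [HZ1 HZ2] := cprimM Hy Hy.
have [HZ1' HZ2'] := cprimD (cprimM Hdy Hy) (cprimM Hy Hdy).
have pq := primD (primZ a HZ1) (primZ b HZ2).
have pq' := primD (primZ a HZ1') (primZ b HZ2').
have pr := primD (primZ a HZ2) (primZ (- b) HZ1).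
have pr' := primD (primZ a HZ2') (primZ (- b) HZ1').
pose q t := a * Re (y t * y t) + b * Im (y t * y t).
pose r t := a * Im (y t * y t) + - b * Re (y t * y t).
have qc t : q (clamp t) = q t by rewrite /q yc.
have rc t : r (clamp t) = r t by rewrite /r yc.
have qcont : continuous q by exact: prim_clamp_continuous pq qc.
have ab2 : 0 < a ^+ 2 + b ^+ 2.
  by have := @sqmod_gt0 R (a +i* b); apply; rewrite eq_complex /= -xpair_eqE.
have qr0 t : (q t != 0) || (r t != 0).
  rewrite -negb_and; apply/negP => /andP[/eqP q0 /eqP r0].
  have : q t ^+ 2 + r t ^+ 2 = (a ^+ 2 + b ^+ 2) * sqmod (y t) ^+ 2.
    by rewrite /q /r /sqmod !ReImE; ring.
  rewrite q0 r0 !expr0n /= addr0 => /esym/eqP.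
  by rewrite mulf_eq0 expf_eq0 /= !gt_eqF // sqmod_gt0.
pose n t := B t * sqmod (y t).
have nb : bmeas n by apply: bmeasM => //; exact: bmeas_sqmod.
have n0 t : 0 <= n t by rewrite mulr_ge0 // sqmod_ge0.
pose N x := 0 + intg 0 (clamp x) n.
have HN : prim N n := prim_intg 0 nb.
have cc (t : R) : clamp (clamp t) = clamp t by rewrite clampE // clamp01.
have NE t : 0 <= t <= 1 -> N t = intg 0 t n by move=> t01; rewrite /N add0r clampE.
have Ncont : continuous N by apply: (prim_clamp_continuous HN) => t; rewrite /N cc.
have Nmono s t : 0 <= s -> s <= t -> t <= 1 -> N s <= N t.
  by move=> s0 st t1; apply: (prim_le HN).
have N0 t : 0 <= N t by rewrite /N add0r; apply: intg_ge0.
(* with [Z = y ^ 2] rotated by [(a, b)], the expression [q' r - q r'] is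
   [- 2 (a ^ 2 + b ^ 2) |y| ^ 2] times the momentum *)
have cross x : exists2 e, 0 < e & forall s t, 0 <= s -> s < t -> t <= 1 ->
    `|x - s| < e -> `|x - t| < e -> q s = 0 -> q t = 0 -> exists2 u, s < u < t & N u = 0.
  have [e e0 He] := crossings_separated pq pq' pr pr' qc rc (qr0 x).
  exists e => // s t s0 st t1 xs xt qs qt.
  have [u su E] := He s t s0 st t1 xs xt qs qt; exists u => //.
  have u01 : 0 <= u <= 1.
    by have /andP[su1 ut] := su; rewrite (le_trans s0 (ltW su1)) (le_trans (ltW ut)).
  have W := momentumE Bb sol dy0 u01; rewrite -/n -(NE u u01) in W.
  have k2 : Im ((alpha +i* beta) ^+ 2) = 2 * alpha * beta by rewrite expr2 !ReImE /=; ring.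
  rewrite k2 in W.
  have : - 2 * (a ^+ 2 + b ^+ 2) * sqmod (y u) * (Re (y u) * Im (dy u) - Im (y u) * Re (dy u)) = 0.
    by rewrite -E /sqmod !ReImE; ring.
  rewrite W => /eqP; rewrite !mulf_eq0 !oppr_eq0 !mulf_eq0 (negbTE a0) (gt_eqF beta0).
  by rewrite (gt_eqF ab2) (gt_eqF (sqmod_gt0 (y0 u))) !pnatr_eq0 /= => /eqP.
have hb : bmeas q by case: pq.
have bb : {ae lebesgue_measure, forall x : R, 0 < x < 1 ->
    (0 < q x -> B x = b1) /\ (q x < 0 -> B x = b2)}.
  by apply: (bang_bang b12 Bb B12 hb) => V Va; exact: Hhalf.
pose B' t := if (0 < N t) && (q t < 0) then b2 else b1.
(* where [N] vanishes so does [B], and then [b1 = 0] *)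
have dead s : 0 <= s <= 1 -> N s = 0 ->
    (forall t, 0 < t < s -> N t = 0) /\
    {ae lebesgue_measure, forall t : R, 0 < t < s -> B t = b1}.
  move=> /[dup] s01 /andP[s0 s1] Ns; split.
    move=> t /andP[t0 ts]; apply/eqP; rewrite eq_le N0 andbT -Ns.
    by apply: Nmono => //; exact: ltW.
  have : {ae lebesgue_measure, forall t : R, 0 < t < s -> n t = 0}.
    by apply: intg_ge0_eq0 => //; rewrite -NE.
  move=> H; apply: (ae_imp H) => t Ht /Ht /eqP.
  rewrite mulf_eq0 (gt_eqF (sqmod_gt0 (y0 t))) orbF => /eqP Bt.
  have /andP[h _] := B12 t; rewrite Bt in h *.
  by apply/eqP; rewrite eq_le b10 h.
have live c d : (forall t, 0 < t < 1 -> c < t < d -> 0 < N t /\ q t != 0) ->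
    exists v, (forall t, 0 < t < 1 -> c < t < d -> B' t = v) /\
     {ae lebesgue_measure, forall t : R, 0 < t < 1 -> c < t < d -> B t = B' t}.
  move=> H.
  have mE t : (Num.max 0 c < t < Num.min 1 d) = (0 < t < 1) && (c < t < d).
    by rewrite gt_max lt_min; case: (0 < t); case: (c < t); case: (t < 1); case: (t < d).
  have qn t : Num.max 0 c < t < Num.min 1 d -> q t != 0.
    by rewrite mE => /andP[t01 tcd]; have [] := H t t01 tcd.
  have [qp|qp] := constant_sign qcont qn.
  - have E t : 0 < t < 1 -> c < t < d -> B' t = b1.
      move=> t01 tcd; have := qp t; rewrite mE t01 tcd => /(_ isT) qt.
      by rewrite /B' (lt_gtF qt) andbF.
    exists b1; split => //; apply: (ae_imp bb) => t Ht t01 tcd; rewrite E //.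
    by have [h _] := Ht t01; apply: h; apply: qp; rewrite mE t01 tcd.
  - have E t : 0 < t < 1 -> c < t < d -> B' t = b2.
      move=> t01 tcd; have := qp t; rewrite mE t01 tcd => /(_ isT) qt.
      by rewrite /B' qt; have [-> _] := H t t01 tcd.
    exists b2; split => //; apply: (ae_imp bb) => t Ht t01 tcd; rewrite E //.
    by have [_ h] := Ht t01; apply: h; apply: qp; rewrite mE t01 tcd.
have deadP s c : 0 <= s <= 1 -> N s = 0 ->
    exists v, (forall t, 0 < t < 1 -> c < t < s -> B' t = v) /\
     {ae lebesgue_measure, forall t : R, 0 < t < 1 -> c < t < s -> B t = B' t}.
  move=> s01 Ns; have [H1 H2] := dead s s01 Ns.
  have E t : 0 < t < 1 -> c < t < s -> B' t = b1.
    move=> /andP[t0 _] /andP[_ ts]; rewrite /B' H1 ?ltxx // t0 ts //.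
  exists b1; split => //; apply: (ae_imp H2) => t Ht t01 ts; rewrite E //; apply: Ht.
  by move: t01 ts => /andP[-> _] /andP[_ ->].
have Npos t : N t != 0 -> 0 < N t by rewrite lt_neqAle eq_sym N0 andbT.
have Nup s t : 0 <= s -> s <= t -> t <= 1 -> 0 < N s -> 0 < N t.
  by move=> s0 st t1 /lt_le_trans; apply; exact: Nmono.
exists B'; have [||H1 H2] := @piecewise_of_local R B B'.
- move=> x /andP[x0 x1]; have [e0 e00 He] := cross x.
  pose e := Num.min e0 (1 - x).
  have e_gt0 : 0 < e by rewrite lt_min e00 subr_gt0.
  have ee0 : e <= e0 by rewrite ge_min lexx.
  have e1x : e <= 1 - x by rewrite ge_min lexx orbT.
  case: (pselect (exists2 s, x < s < x + e & N s = 0)) => [[s /andP[xs se] Ns]|nN].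
    exists (s - x); first by rewrite subr_gt0.
    rewrite addrCA subrr addr0; apply: deadP => //.
    by rewrite (le_trans x0 (ltW xs)) (lt_add_le1 se).
  have NP t : x < t < x + e -> 0 < N t.
    by move=> xt; apply: Npos; apply/eqP => Nt; apply: nN; exists t.
  case: (pselect (exists2 s, x < s < x + e & q s = 0)) => [[s /andP[xs se] qs]|nq].
    exists (s - x); first by rewrite subr_gt0.
    rewrite addrCA subrr addr0; apply: live => t _ /andP[xt ts].
    split; first by apply: NP; rewrite xt (lt_trans ts).
    apply/eqP => qt.
    have t_ge0 : 0 <= t by exact: ltW (le_lt_trans x0 xt).
    have s_le1 : s <= 1 by exact: lt_add_le1 se e1x.
    have xs_lt : `|x - s| < e0 by exact: dist_lt_right xs se ee0.
    have xt_lt : `|x - t| < e0 by exact: dist_lt_right xt (lt_trans ts se) ee0.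
    have [u /andP[tu us]] := He t s t_ge0 ts s_le1 xt_lt xs_lt qt qs.
    by apply/eqP; rewrite gt_eqF // NP // (lt_trans xt tu) (lt_trans us).
  exists e => //; apply: live => t _ xt; split; first exact: NP.
  by apply/eqP => qt; apply: nq; exists t.
- move=> x /[dup] x01' /andP[x0 x1].
  have x01 : 0 <= x <= 1 by rewrite x1 ltW.
  have [Nx|/Npos Nx] := eqVneq (N x) 0; first by exists x => //; exact: deadP.
  have [e0 e00 He] := cross x.
  have [e1 e10 He1] := continuous_eps (Ncont x) Nx.
  have NP t : `|x - t| < e1 -> 0 < N t.
    by move=> /He1; exact: dist_lt_gt0.
  pose e := Num.min (Num.min e0 e1) x.
  have e_gt0 : 0 < e by rewrite !lt_min e00 e10.
  have ee0 : e <= e0 by rewrite !ge_min lexx.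
  have ee1 : e <= e1 by rewrite !ge_min lexx orbT.
  have ex : e <= x by rewrite !ge_min lexx orbT.
  case: (pselect (exists2 s, x - e < s < x & q s = 0)) => [[s /andP[xs se] qs]|nq].
    exists (x - s); first by rewrite subr_gt0.
    rewrite subKr; apply: live => t _ /andP[st tx].
    split; first by apply: NP; exact: dist_lt_left (lt_trans xs st) tx ee1.
    apply/eqP => qt.
    have s_ge0 : 0 <= s by exact: lt_sub_ge0 xs ex.
    have t_le1 : t <= 1 by exact: le_trans (ltW tx) x1.
    have xs_lt : `|x - s| < e0 by exact: dist_lt_left xs se ee0.
    have xt_lt : `|x - t| < e0 by exact: dist_lt_left (lt_trans xs st) tx ee0.
    have [u /andP[su ut]] := He s t s_ge0 st t_le1 xs_lt xt_lt qs qt.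
    apply/eqP; rewrite gt_eqF // NP //.
    exact: (dist_lt_left (lt_trans xs su) (lt_trans ut tx) ee1).
  exists e => //; apply: live => t _ xt; split.
    by move: xt => /andP[xt tx]; apply: NP; exact: dist_lt_left xt tx ee1.
  by apply/eqP => qt; apply: nq; exists t.
- by split => // x; rewrite /B'; case: ifP; [right|left].
Qed.

(** * Optimal structures for the frequency zero *)

Definition cosh (R : realType) (x : R) : R := (expR x + expR (- x)) / 2.
Definition sinh (R : realType) (x : R) : R := (expR x - expR (- x)) / 2.

Lemma prim_cosh (R : realType) (k : R) :
  prim (fun x : R => cosh (k * clamp x)) (fun x => k * sinh (k * clamp x)).
Proof.
apply: eq_prim_both (primZ (2^-1) (primD (prim_expR_scale k) (prim_expR_scale (- k)))) => x;
  rewrite /cosh /sinh !mulNr; ring.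
Qed.

Lemma prim_sinh (R : realType) (k : R) :
  prim (fun x : R => k * sinh (k * clamp x)) (fun x => k ^+ 2 * cosh (k * clamp x)).
Proof.
apply: eq_prim_both (primZ (k / 2) (primD (prim_expR_scale k) (primZ (-1) (prim_expR_scale (- k))))) => x;
  rewrite /cosh /sinh !mulNr; ring.
Qed.

Lemma cosh_gt0 (R : realType) (x : R) : 0 < cosh x.
Proof. by rewrite divr_gt0 // addr_gt0 // expR_gt0. Qed.

Lemma cosh0 (R : realType) : cosh (0 : R) = 1.
Proof. by rewrite /cosh oppr0 expR0; field. Qed.

Lemma sinh0 (R : realType) : sinh (0 : R) = 0.
Proof. by rewrite /sinh oppr0 expR0 subrr mul0r. Qed.

(** The eigenfunction is [cosh (s * sqrt b * x)]; the outgoing condition at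
    [i s] is [sqrt b * sinh (s * sqrt b) = cosh (s * sqrt b)], whose left side is
    the smaller one at [s = 0]. *)
Lemma constant_structure_quasi_eigenvalue (R : realType) (b beta : R) : 0 < b -> 0 < beta ->
  cosh (beta * Num.sqrt b) < Num.sqrt b * sinh (beta * Num.sqrt b) ->
  exists2 beta', 0 < beta' < beta & quasi_eigenvalues (fun=> b) (0 +i* beta').
Proof.
move=> b0 beta0 lt1; set m := Num.sqrt b in lt1 *.
have m0 : 0 < m by rewrite sqrtr_gt0.
have m2 : m ^+ 2 = b by rewrite sqr_sqrtr // ltW.
pose F s := m * sinh (m * s) - cosh (m * s).
have Fc : continuous F.
  have E1 := @continuous_expR_scale R m; have E2 := @continuous_expR_scale R (- m).
  have -> : F = (fun s => (m - 1) / 2 * expR (m * s) - (m + 1) / 2 * expR (- m * s)).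
    by apply/funext => s; rewrite /F /cosh /sinh mulNr; ring.
  by move=> s; apply: cvgB; apply: cvgM; [exact: cvg_cst|exact: E1|exact: cvg_cst|exact: E2].
have F0 : F 0 = -1 by rewrite /F mulr0 sinh0 cosh0 mulr0 sub0r.
have Fb : 0 < F beta by rewrite /F subr_gt0 (mulrC m beta).
have [|s] := @IVT R F 0 beta 0 (ltW beta0) (continuous_subspaceT Fc).
  by rewrite ge_min le_max F0 (ltW Fb) lerN10 orbT.
rewrite in_itv /= => /andP[s0 sb] Fs.
have sn0 : s != 0 by apply/eqP => sE; move: Fs; rewrite sE F0; lra.
have sp : 0 < s by rewrite lt_neqAle eq_sym sn0.
have sb' : s < beta.
  by rewrite lt_neqAle sb andbT; apply/eqP => sE; move: Fb; rewrite -sE Fs ltxx.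
exists s; first by rewrite sp.
pose k := m * s.
have k0 : 0 +i* s != 0 :> R[i] by rewrite eq_complex /= negb_and sn0 orbT.
have cl0 : clamp 0 = 0 :> R by rewrite clampE // lexx ler01.
have cl1 : clamp 1 = 1 :> R by rewrite clampE // lexx ler01.
apply: (@solution_quasi_eigenvalue _ _ _ (fun x => (cosh (k * clamp x))%:C)
  (fun x => (k * sinh (k * clamp x))%:C)) => //.
- have kap : (0 +i* s) ^+ 2 = (- s ^+ 2)%:C :> R[i].
    by apply: complexP; rewrite expr2 !ReImE /=; ring.
  rewrite /is_solution kap; split; split.
  + exact: prim_cosh.
  + exact: prim_cst.
  + apply: eq_prim_both (prim_sinh k) => x //.
    by rewrite !ReImE /= /k -m2; ring.
  + by apply: eq_prim_both (prim_cst 0) => x //; rewrite !ReImE /=; ring.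
- by rewrite cl0 mulr0 sinh0 mulr0.
- apply/outgoing_conditionE => //; rewrite cl1 mulr1.
  have Es : m * sinh k = cosh k by apply/eqP; rewrite -subr_eq0 -/(F s) Fs.
  by apply: complexP; rewrite !ReImE /= -?Es /k; ring.
- exists 0; first by rewrite lexx ler01.
  by rewrite eq_complex /= negb_and gt_eqF // cosh_gt0.
Qed.

(** The real part [A] of [y], normalised by [conj (y 0)], is positive because
    [(A A')' >= 0].  The Wronskian of [A] and [c = cosh (beta * sqrt b2 * x)]
    has the derivative [beta ^ 2 (b2 - B) c A >= 0].  Unless [B = b2], it is
    positive at [1], which is the inequality required by the preceding
    lemma. *)
Lemma stationary_structure (R : realType) (b1 b2 beta : R) (B : R -> R)
    (y dy : R -> R[i]) : 0 <= b1 -> b1 <= b2 -> 0 < b2 ->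
  bmeas B -> (forall x, b1 <= B x <= b2) -> beta != 0 ->
  is_solution (0 +i* beta) B y dy -> dy 0 = 0 ->
  dy 1 = - ('i%C * (0 +i* beta) * y 1) ->
  (forall x, y (clamp x) = y x) -> (exists2 x, 0 <= x <= 1 & y x != 0) ->
  (forall k, quasi_eigenvalues_Ad b1 b2 k -> Re k = 0 -> beta <= Im k) ->
  {ae lebesgue_measure, forall x : R, 0 < x < 1 -> B x = b2}.
Proof.
move=> b10 b12 b20 Bb B12 bn0 sol dy0 dy1 yc [x0 x001 yx0] opt.
have [Hy Hdy] := sol; have i0 : 0 <= (0 : R) <= 1 by rewrite lexx ler01.
have y00 : y 0 != 0.
  by apply: contra_neq yx0 => y0; apply: (solution_unique Bb sol i0 y0 dy0 x001).
have B0 t : 0 <= B t by have /andP[h _] := B12 t; exact: le_trans h.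
(* multiplication by [conj (y 0)] makes the real part positive at [0] *)
pose w := (y 0)^*%C.
pose A t := Re (w * y t); pose A' t := Re (w * dy t).
have pA : prim A A' by have [] := cprimZ w Hy.
have pA' : prim A' (fun t => beta ^+ 2 * (B t * A t)).
  have [p _] := cprimZ w Hdy; apply: eq_prim_both p => // t.
  by rewrite expr2 /A !ReImE /=; ring.
have A0 : 0 < A 0.
  have := sqmod_gt0 y00; congr (_ < _); rewrite /A /w /sqmod; case: (y 0) => p q /=; ring.
have A'0 : A' 0 = 0 by rewrite /A' dy0 mulr0.
have A'1 : A' 1 = beta * A 1 by rewrite /A' /A dy1 !ReImE /=; ring.
(* [A A'] increases from [0], so [A ^ 2] increases and [A] never vanishes *)
have AA x : 0 <= x <= 1 -> 0 <= A x * A' x.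
  move=> /andP[x0' x1]; have <- : A 0 * A' 0 = 0 by rewrite A'0 mulr0.
  apply: (prim_le (primM pA pA')) => // t _.
  have -> : A' t * A' t + A t * (beta ^+ 2 * (B t * A t)) =
    A' t ^+ 2 + beta ^+ 2 * B t * A t ^+ 2 by ring.
  apply: addr_ge0; first exact: sqr_ge0.
  by apply: mulr_ge0; [apply: mulr_ge0 => //; exact: sqr_ge0|exact: sqr_ge0].
have AAge x : 0 <= x <= 1 -> A 0 * A 0 <= A x * A x.
  move=> /andP[x0' x1]; apply: (prim_le (primM pA pA)) => // t /andP[t0 tx].
  have := AA t; rewrite t0 (le_trans tx x1) => /(_ isT); rewrite mulrC; lra.
have Ac x : A (clamp x) = A x by rewrite /A yc.
have An x : A x != 0.
  rewrite -Ac; apply/eqP => Ax; have := AAge _ (clamp01 x); rewrite Ax mul0r.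
  by rewrite leNgt mulr_gt0.
have Ap x : 0 < A x.
  have [H|H] := @constant_sign R A (-1) 2 (prim_clamp_continuous pA Ac) (fun t _ => An t).
    by rewrite -Ac; apply: H; have /andP[? ?] := clamp01 x; apply/andP; split; lra.
  have : A 0 < 0 by apply: H; apply/andP; split; lra.
  by rewrite ltNge (ltW A0).
have i1 : 0 <= (1 : R) <= 1 by rewrite lexx ler01.
have beta0 : 0 < beta.
  rewrite lt_neqAle eq_sym bn0 /=; have := AA 1 i1.
  by rewrite pmulr_rge0 // A'1 pmulr_lge0.
pose m := Num.sqrt b2; have m0 : 0 < m by rewrite sqrtr_gt0.
have m2 : m ^+ 2 = b2 by rewrite sqr_sqrtr // ltW.
pose k := beta * m.
pose c t := cosh (k * clamp t).
have c0 t : 0 < c t by exact: cosh_gt0.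
have pW := primD (primM (prim_sinh k) pA) (primZ (-1) (primM (prim_cosh k) pA')).
pose W' t := beta ^+ 2 * ((b2 - B t) * (c t * A t)).
have {}pW : prim (fun x => k * sinh (k * clamp x) * A x + -1 * (c x * A' x)) W'.
  by apply: eq_prim_both pW => // t; rewrite /W' /k /c -m2; ring.
have W'0 t : 0 <= W' t.
  have /andP[_ h] := B12 t.
  by rewrite /W' mulr_ge0 ?sqr_ge0 // mulr_ge0 ?subr_ge0 // ltW // mulr_gt0.
have [_ W'b /(_ 1 i1)] := pW.
have cl0 : clamp 0 = 0 :> R by rewrite clampE.
have cl1 : clamp 1 = 1 :> R by rewrite clampE.
rewrite /c cl0 cl1 mulr0 sinh0 A'0 A'1 !mulr0 mul0r addr0 add0r mulr1 => W1.
have [I0|I0] := eqVneq (intg 0 1 W') 0.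
  have H := intg_ge0_eq0 W'b (fun t _ => W'0 t) I0.
  apply: (ae_imp H) => t Ht /Ht /eqP.
  have K0 : 0 < beta ^+ 2 * (c t * A t) by rewrite mulr_gt0 ?exprn_gt0 // mulr_gt0.
  have -> : W' t = beta ^+ 2 * (c t * A t) * (b2 - B t) by rewrite /W'; ring.
  by rewrite mulf_eq0 (gt_eqF K0) /= subr_eq0 => /eqP.
exfalso.
have Ip : 0 < intg 0 1 W' by rewrite lt_neqAle eq_sym I0; apply: intg_ge0.
have lt1 : cosh k < m * sinh k.
  have h : 0 < beta * A 1 by exact: mulr_gt0.
  rewrite -(ltr_pM2l h) -subr_gt0; move: Ip; rewrite -W1 /k; congr (_ < _); ring.
have [s /andP[s0 sb] sq] := constant_structure_quasi_eigenvalue b20 beta0 lt1.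
have : beta <= Im (0 +i* s).
  apply: opt => //; exists (fun=> b2) => //; apply: Ad_bmeas; first exact: bmeas_cst.
  by move=> _; rewrite b12 lexx.
by rewrite /= leNgt sb.
Qed.

(** * Structure of optimal resonators *)

Lemma bounded_representative (R : realType) (b1 b2 : R) (B : R -> R) : b1 <= b2 ->
  Ad b1 b2 B -> exists B0 : R -> R, [/\ bmeas B0, forall x, b1 <= B0 x <= b2 &
    {ae lebesgue_measure, forall x : R, 0 < x < 1 -> B x = B0 x}].
Proof.
move=> b12 [[mB _] B12].
pose B1 := (B \_ (`]0, 1[ : set R)).
exists (fun x => Num.min b2 (Num.max b1 (B1 x))).
have rng x : b1 <= Num.min b2 (Num.max b1 (B1 x)) <= b2.
  by rewrite le_min ge_min le_max b12 lexx /= lexx.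
split => //.
- apply: (@bmeasW _ _ (`|b1| + `|b2|)).
    apply: measurable_minr; first exact: measurable_cst.
    apply: measurable_maxr; first exact: measurable_cst.
    exact: (proj1 (measurable_restrictT B (measurable_itv _)) mB).
  move=> x; have /andP[k1 k2] := rng x; rewrite ler_norml.
  have := ler_norm (- b1); have := ler_norm b2.
  by rewrite normrN; have := normr_ge0 b1; have := normr_ge0 b2; lra.
- apply: (ae_imp B12) => x H x01; have /andP[h1 h2] := H x01.
  rewrite /B1 patchE mem_set; last by rewrite /= in_itv.
  by rewrite (max_idPr h1) (min_idPr h2).
Qed.

Unset Implicit Arguments.

Theorem theorem2p4 (R : realType) (b1 b2 : R)
    (b1_ge0 : 0 <= b1) (b1_le_b2 : b1 <= b2) (b2_gt0 : 0 < b2)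
    (alpha : R) (B : R -> R)
    (B_Ad : Ad b1 b2 B) (B_opt : optimal b1 b2 alpha B) :
  exists B' : R -> R,
    [/\ {ae lebesgue_measure, forall x : R, 0 < x < 1 -> B x = B' x},
        piecewise_constant01 B' &
        forall x : R, 0 <= x <= 1 -> B' x = b1 \/ B' x = b2].
Proof.
have [B0 [B0b B012 BB0]] := bounded_representative b1_le_b2 B_Ad.
have [beta [inf_beta qB]] := B_opt.
have opt k : quasi_eigenvalues_Ad b1 b2 k -> Re k = alpha -> beta <= Im k.
  move=> kAd ka; rewrite -lee_fin -inf_beta; apply: ereal_inf_lbound.
  by exists k.
have [k0 [y [dy [sol yn0 dy0 bc yc]]]] := quasi_eigenvalue_solution qB B0b BB0.
have dy1 := proj1 (outgoing_conditionE _ _ k0) bc.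
have yc1 x := proj1 (yc x).
have [a0|a0] := eqVneq alpha 0.
- subst alpha; exists (fun=> b2); split.
  + have bn0 : beta != 0 by move: k0; rewrite eq_complex /= negb_and eqxx.
    have H := stationary_structure b1_ge0 b1_le_b2 b2_gt0 B0b B012 bn0 sol dy0 dy1 yc1 yn0 opt.
    by apply: (ae_imp2 BB0 H) => x h1 h2 x01; rewrite h1 // h2.
  + exists 0%N, (fun j => if j is 0%N then 0 else 1); split => // -[] // _.
    by exists b2.
  + by move=> x _; right.
- have [B' [H1 H2 H3]] := switching_structure b1_ge0 b1_le_b2 B0b B012 a0 sol dy0 dy1 yc1 yn0 opt.
  exists B'; split => //.
  by apply: (ae_imp2 BB0 H1) => x h1 h2 x01; rewrite h1 // h2.
Qed.
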